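(* Let $m_1,m_2\in\mathbb{R}$, let $\sigma\in M^{m_1}_{\rho,\Lambda}(\mathbb{Z}^n\times\mathbb{T}^n)$ and $\tau\in M^{m_2}_{\rho,\Lambda}(\mathbb{Z}^n\times\mathbb{T}^n)$. Then the composition $T_\sigma T_\tau$ of the pseudo-differential operators $T_\sigma$ and $T_\tau$ is a pseudo-differential operator $T_\lambda$ with symbol $\lambda\in M^{m_1+m_2}_{\rho,\Lambda}(\mathbb{Z}^n\times\mathbb{T}^n)$ having the asymptotic expansion $$\lambda(k,x)\sim\sum_{\alpha\ge 0}\frac{1}{\alpha!}\big(D_x^{(\alpha)}\sigma(k,x)\big)\,\Delta_k^\alpha\tau(k,x),$$ meaning that for every $N\in\mathbb{N}$, $$\lambda(k,x)-\sum_{|\alpha|<N}\frac{1}{\alpha!}\big(D_x^{(\alpha)}\sigma(k,x)\big)\,\Delta_k^\alpha\tau(k,x)\in M^{m_1+m_2-\rho N}_{\rho,\Lambda}(\mathbb{Z}^n\times\mathbb{T}^n).$$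
   Context: Write $\mathbb{T}^n=\mathbb{R}^n/\mathbb{Z}^n$ and $\mathbb{N}_0=\{0,1,2,\dots\}$. For $f$ on $\mathbb{Z}^n$ set $\Delta_{k_j}f(k)=f(k+e_j)-f(k)$ ($e_j$ the $j$-th unit vector) and $\Delta_k^\alpha=\Delta_{k_1}^{\alpha_1}\cdots\Delta_{k_n}^{\alpha_n}$ for $\alpha\in\mathbb{N}_0^n$. On smooth functions on $\mathbb{T}^n$ set $D_x^{(\beta)}=D_{x_1}^{(\beta_1)}\cdots D_{x_n}^{(\beta_n)}$, where $D_{x_j}^{(0)}=I$ and $D_{x_j}^{(\ell)}=\prod_{m=0}^{\ell-1}\big(\frac{1}{2\pi i}\frac{\partial}{\partial x_j}-m\big)$ for $\ell\ge1$. Write $k^\gamma=k_1^{\gamma_1}\cdots k_n^{\gamma_n}$. Weight function: $\Lambda:\mathbb{Z}^n\to(0,\infty)$ is a weight function if there are positive constants $\mu_0\le\mu_1\le\mu$ and $C_0,C_1$ with $C_0(1+|k|)^{\mu_0}\le\Lambda(k)\le C_1(1+|k|)^{\mu_1}$ for all $k\in\mathbb{Z}^n$, and for all $\alpha\in\mathbb{N}_0^n$, $\gamma\in\{0,1\}^n$ there is $C_{\alpha,\gamma}>0$ with $|k^\gamma\Delta_k^{\alpha+\gamma}\Lambda(k)|\le C_{\alpha,\gamma}\Lambda(k)^{1-|\alpha|/\mu}$ for all $k\in\mathbb{Z}^n$. Fix such a $\Lambda$ (with its constants) and $\rho\in(0,1/\mu]$. Symbol classes: for $m\in\mathbb{R}$,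 $S^m_{\rho,\Lambda}(\mathbb{Z}^n\times\mathbb{T}^n)$ is the set of $\sigma:\mathbb{Z}^n\times\mathbb{T}^n\to\mathbb{C}$, smooth in $x$ for every $k$, such that for all $\alpha,\beta\in\mathbb{N}_0^n$ there is a constant $C>0$ with $|D_x^{(\beta)}\Delta_k^\alpha\sigma(k,x)|\le C\Lambda(k)^{m-\rho|\alpha|}$ for all $(k,x)$. $M^m_{\rho,\Lambda}(\mathbb{Z}^n\times\mathbb{T}^n)$ is the set of $\sigma:\mathbb{Z}^n\times\mathbb{T}^n\to\mathbb{C}$, smooth in $x$ for every $k$, such that $k^\gamma\Delta_k^\gamma\sigma(k,x)\in S^m_{\rho,\Lambda}(\mathbb{Z}^n\times\mathbb{T}^n)$ for all $\gamma\in\{0,1\}^n$. Operators: $\mathcal{S}(\mathbb{Z}^n)$ is the space of rapidly decreasing functions on $\mathbb{Z}^n$. For $f\in\mathcal{S}(\mathbb{Z}^n)$ put $\widehat f(x)=\sum_{k\in\mathbb{Z}^n}e^{-2\pi i k\cdot x}f(k)$ and $T_\sigma f(k)=\int_{\mathbb{T}^n}e^{2\pi i k\cdot x}\sigma(k,x)\widehat f(x)\,dx$. The composition is taken as operators on $\mathcal{S}(\mathbb{Z}^n)$. *)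

(* Defs.v *)
From HB Require Import structures.
From mathcomp Require Import all_boot all_order all_algebra.
From mathcomp Require Import all_classical all_reals all_analysis.
From mathcomp Require Import complex.

Set Implicit Arguments.
Unset Strict Implicit.
Unset Printing Implicit Defensive.

Import Order.TTheory GRing.Theory Num.Theory.
Import numFieldNormedType.Exports.

Local Open Scope classical_set_scope.
Local Open Scope ring_scope.

(* Conventions.  Z^n is 'rV[int]_n.  A function on the torus R^n / Z^n is a
   function on 'rV[R]_n that is 1-periodic in every coordinate, so a symbol
   Z^n x T^n -> C is a function 'rV[int]_n -> 'rV[R]_n -> R[i] with periodic
   values.  Derivatives, sums and integrals of complex-valued functions are
   taken on real and imaginary parts. *)

Definition unitv (A : pzRingType) (n : nat) (j : 'I_n) : 'rV[A]_n :=
  delta_mx 0 j.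

Definition mi_size (n : nat) (a : 'I_n -> nat) : nat := (\sum_j a j)%N.

Definition mi_fact (n : nat) (a : 'I_n -> nat) : nat := (\prod_j (a j)`!)%N.

(* The product over j of (op j)^(a j), as an iterated composition. *)
Definition mi_iter (V : Type) (n : nat) (op : 'I_n -> nat -> V -> V)
    (a : 'I_n -> nat) (v : V) : V :=
  foldr (fun j w => op j (a j) w) v (enum 'I_n).

Section Lattice.
Variables (n : nat).
Implicit Types (k : 'rV[int]_n) (a : 'I_n -> nat).

Definition kdiff1 (V : zmodType) (j : 'I_n) (f : 'rV[int]_n -> V) :
    'rV[int]_n -> V :=
  fun k => f (k + unitv int j) - f k.

Definition kdiff (V : zmodType) a (f : 'rV[int]_n -> V) : 'rV[int]_n -> V :=
  mi_iter (fun j l => iter l (kdiff1 j)) a f.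

Definition kpow k a : int := \prod_j k 0 j ^+ a j.

End Lattice.

Section Symbols.
Variables (R : realType) (n : nat).
Implicit Types (k : 'rV[int]_n) (x : 'rV[R]_n) (a b g : 'I_n -> nat).

Definition lnorm k : R := Num.sqrt (\sum_j ((k 0 j)%:~R : R) ^+ 2).

Definition ldot k x : R := \sum_j (k 0 j)%:~R * x 0 j.

(* exp (i t) for real t *)
Definition cis (t : R) : R[i] := Complex (cos t) (sin t).

Definition partial (j : 'I_n) (h : 'rV[R]_n -> R) : 'rV[R]_n -> R :=
  fun x => 'D_(unitv R j) h x.

Definition cpartial (j : 'I_n) (h : 'rV[R]_n -> R[i]) : 'rV[R]_n -> R[i] :=
  fun x => Complex (partial j (fun y => complex.Re (h y)) x)
                   (partial j (fun y => complex.Im (h y)) x).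

(* C^oo: all iterated partial derivatives exist and are continuous. *)
Definition smooth_real (h : 'rV[R]_n -> R) : Prop :=
  forall s : seq 'I_n, let hs := foldr partial h s in
    continuous hs /\ forall (j : 'I_n) x, derivable hs x (unitv R j).

Definition smooth (h : 'rV[R]_n -> R[i]) : Prop :=
  smooth_real (fun x => complex.Re (h x)) /\
  smooth_real (fun x => complex.Im (h x)).

Definition periodic_torus (h : 'rV[R]_n -> R[i]) : Prop :=
  forall (j : 'I_n) x, h (x + unitv R j) = h x.

Definition torus_smooth (h : 'rV[R]_n -> R[i]) : Prop :=
  periodic_torus h /\ smooth h.

Fixpoint Dx1 (j : 'I_n) (l : nat) (h : 'rV[R]_n -> R[i]) : 'rV[R]_n -> R[i] :=
  if l is m.+1 then
    fun x => (Complex 0 (2 * pi))^-1 * cpartial j (Dx1 j m h) x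
             - m%:R * Dx1 j m h x
  else h.

Definition Dx b (h : 'rV[R]_n -> R[i]) : 'rV[R]_n -> R[i] := mi_iter Dx1 b h.

Record weight_function (mu0 mu1 mu C0 C1 : R) (Lam : 'rV[int]_n -> R) :
    Prop := {
  weight_mu0 : 0 < mu0;
  weight_mu01 : mu0 <= mu1;
  weight_mu1 : mu1 <= mu;
  weight_C0 : 0 < C0;
  weight_C1 : 0 < C1;
  weight_gt0 : forall k, 0 < Lam k;
  weight_lower : forall k, C0 * (1 + lnorm k) `^ mu0 <= Lam k;
  weight_upper : forall k, Lam k <= C1 * (1 + lnorm k) `^ mu1;
  weight_diff : forall a g, (forall j, (g j <= 1)%N) ->
    exists2 C : R, 0 < C & forall k,
      `|(kpow k g)%:~R * kdiff (fun j => (a j + g j)%N) Lam k|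
        <= C * Lam k `^ (1 - (mi_size a)%:R / mu) }.

Definition symbol_S (Lam : 'rV[int]_n -> R) (rho m : R)
    (sigma : 'rV[int]_n -> 'rV[R]_n -> R[i]) : Prop :=
  (forall k, torus_smooth (sigma k)) /\
  forall a b, exists2 C : R, 0 < C & forall k x,
    Normc.normc (Dx b (fun y => kdiff a (fun l => sigma l y) k) x)
      <= C * Lam k `^ (m - rho * (mi_size a)%:R).

Definition symbol_M (Lam : 'rV[int]_n -> R) (rho m : R)
    (sigma : 'rV[int]_n -> 'rV[R]_n -> R[i]) : Prop :=
  (forall k, torus_smooth (sigma k)) /\
  forall g, (forall j, (g j <= 1)%N) ->
    symbol_S Lam rho m
      (fun k x => (kpow k g)%:~R * kdiff g (fun l => sigma l x) k).

Definition rapidly_decreasing (f : 'rV[int]_n -> R[i]) : Prop :=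
  forall N : nat, exists C : R, forall k,
    (1 + lnorm k) ^+ N * Normc.normc (f k) <= C.

(* Unordered sums; meaningful for absolutely summable families. *)
Definition lsum (u : 'rV[int]_n -> R) : R :=
  fine (\esum_(k in [set: 'rV[int]_n]) (EFin \o u)^\+ k
        - \esum_(k in [set: 'rV[int]_n]) (EFin \o u)^\- k)%E.

Definition clsum (u : 'rV[int]_n -> R[i]) : R[i] :=
  Complex (lsum (fun k => complex.Re (u k)))
          (lsum (fun k => complex.Im (u k))).

Definition fourier (f : 'rV[int]_n -> R[i]) (x : 'rV[R]_n) : R[i] :=
  clsum (fun k => cis (- (2 * pi * ldot k x)) * f k).

End Symbols.

(* The integral over the fundamental domain [0,1]^n of the torus, as an iterated
   Lebesgue integral (the library has no Lebesgue measure on R^n). *)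
Fixpoint cube_int (R : realType) (n : nat) : ('rV[R]_n -> R) -> R :=
  if n is m.+1 then
    fun h : 'rV[R]_(1 + m) -> R =>
      \int[lebesgue_measure]_(t in `[0, 1])
        cube_int (fun y : 'rV[R]_m => h (row_mx t%:M y))
  else fun h => h 0.

Definition torus_int (R : realType) (n : nat) (h : 'rV[R]_n -> R[i]) : R[i] :=
  Complex (cube_int (fun x => complex.Re (h x)))
          (cube_int (fun x => complex.Im (h x))).

Definition pdo (R : realType) (n : nat)
    (sigma : 'rV[int]_n -> 'rV[R]_n -> R[i]) (f : 'rV[int]_n -> R[i]) :
    'rV[int]_n -> R[i] :=
  fun k => torus_int
    (fun x => cis (2 * pi * ldot k x) * sigma k x * fourier f x).

Definition expansion_term (R : realType) (n : nat)
    (sigma tau : 'rV[int]_n -> 'rV[R]_n -> R[i]) (a : 'I_n -> nat)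
    (k : 'rV[int]_n) (x : 'rV[R]_n) : R[i] :=
  ((mi_fact a)%:R)^-1 * Dx a (sigma k) x * kdiff a (fun l => tau l x) k.

(* Sum over |a| < N: every entry of such an a is < N, so a ranges over the
   finite type {ffun 'I_n -> 'I_N}. *)
Definition expansion_sum (R : realType) (n N : nat)
    (sigma tau : 'rV[int]_n -> 'rV[R]_n -> R[i])
    (k : 'rV[int]_n) (x : 'rV[R]_n) : R[i] :=
  \sum_(a : {ffun 'I_n -> 'I_N} | (mi_size (fun j => a j) < N)%N)
    expansion_term sigma tau (fun j => a j) k x.

(* Main.v *)
Require Import Defs.
From mathcomp Require Import all_boot all_order all_algebra.
From mathcomp Require Import all_classical all_reals all_analysis.
From mathcomp Require Import complex.
From mathcomp Require Import measurable_realfun finmap ring lra zify.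

Set Implicit Arguments.
Unset Strict Implicit.
Unset Printing Implicit Defensive.

Import Order.TTheory GRing.Theory Num.Theory.
Import numFieldNormedType.Exports.

Local Open Scope classical_set_scope.
Local Open Scope ring_scope.

(** Write e_j(x) = exp (2 pi i j.x) and expand a symbol in its Fourier series,
    sigma(k, x) = sum_j s(k, j) e_{-j}(x).  The operator [pdo sigma] then has
    the matrix s(k, k - l) ([pdo_kernel]), so that everything can be computed on
    coefficients.  Multiplying two such matrices shows that the composition has
    the symbol

      lambda(k, x) = sum_j s(k, j) e_{-j}(x) tau(k - j, x)   ([pdo_comp]).

    Newton's formula expands tau(k - j, x) about k as the sum of
    binom(-j, a) Delta^a tau(k, x), and D_x^(a) multiplies e_{-j} by the falling
    factorial of -j, that is by a! binom(-j, a); summing over j gives exactly the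
    terms of the asymptotic expansion.  Hence lambda minus the terms with
    |a| < N is the same series with tau(k - j, x) replaced by its Newton
    remainder ([comp_rem], [comp_rem_expansion]), and N = 0 is lambda itself.

    The estimates rest on one weight.  Put V = Lam^rho.  A function belongs to
    the class M of order m if and only if its iterated difference along a list
    of directions is bounded by Lam^m times a product over the directions l that
    occur in the list, say c times, of V^(1-c) / max(V, |k_l|).  On coefficients
    this is [coefM], with rapid decay in the frequency ([symbol_M_coefM],
    [coefM_symbol_M]).  The weight [omega] has the three properties that matter.
    It is submultiplicative, so that Leibniz' rule gives bounds for products
    ([sdiff_mul_bound]).  One more difference gains V^-1 ([omega_cons]).  And it
    varies at most polynomially under translations ([temperate_omega]), because
    |Delta_l Lam| <= C Lam^(1 - 1/mu) makes Lam^(1/mu) Lipschitz on the lattice.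

    The Newton remainder R_N f(k, h) vanishes at h = 0, and its difference in h
    along l is R_(N-1) (Delta_l f)(k, h).  Walking from 0 to h by unit steps and
    inducting on N yields the gain V^-N with a loss that is polynomial in h
    ([taylor_bound]); with h = -j this loss is absorbed by the rapid decay of
    s(k, j) in j.

    What remains is Fourier analysis on the torus, where integrals are iterated
    one-dimensional integrals.  Integrals of continuous functions depend
    continuously on parameters ([cube_int_param]), integrals of derivatives of
    periodic functions vanish ([cube_int_partial]), whence the decay of
    coefficients ([coef_decay]), and a continuous function with vanishing
    coefficients is zero: induction on the dimension reduces this to one
    variable, where powers of (1 + cos)/2 concentrate at a point
    ([fourier_uniq_pos], [fourier_uniq]).  Inversion ([fourier_inversion])
    follows. *)

(** * Complex numbers and absolutely convergent lattice sums *)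

Local Notation normc := Normc.normc.

Section ComplexNorm.
Variable R : realType.
Implicit Types z w : R[i].

Lemma normc_Re z : `|complex.Re z| <= normc z.
Proof. by have := normc_ge_Re z; rewrite normc_def lecR; case: z. Qed.

Lemma normc_Im z : `|complex.Im z| <= normc z.
Proof.
case: z => a b /=; rewrite -(sqrtr_sqr b) ler_wsqrtr //.
by rewrite lerDr sqr_ge0.
Qed.

Lemma normc_ge0 z : 0 <= normc z.
Proof. exact: le_trans (normr_ge0 _) (normc_Re z). Qed.

Lemma normcD_le z w : normc (z + w) <= normc z + normc w.
Proof. exact: le_normcD. Qed.

Lemma normcN_eq z : normc (- z) = normc z.
Proof. by case: z => a b /=; rewrite !sqrrN. Qed.

Lemma normcB_le z w : normc (z - w) <= normc z + normc w.
Proof. by rewrite (le_trans (normcD_le _ _)) // normcN_eq. Qed.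

Lemma normcBC z w : normc (z - w) = normc (w - z).
Proof. by rewrite -normcN_eq opprB. Qed.

Lemma normc_realE (r : R) : normc (Complex r 0) = `|r|.
Proof. by rewrite /= expr0n /= addr0 sqrtr_sqr. Qed.

Lemma normc_le_ReIm z : normc z <= `|complex.Re z| + `|complex.Im z|.
Proof.
case: z => a b.
have -> : Complex a b = Complex a 0 + Complex 0 b.
  by congr Complex => /=; rewrite ?addr0 ?add0r.
rewrite (le_trans (normcD_le _ _)) // normc_realE /=.
by rewrite expr0n /= add0r sqrtr_sqr addr0 add0r.
Qed.

Lemma normc_eq0 z : normc z <= 0 -> z = 0.
Proof. by move=> h; apply: Normc.eq0_normc; apply/eqP; rewrite eq_le h normc_ge0. Qed.

Lemma normc_small z : (forall e, 0 < e -> normc z <= e) -> z = 0.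
Proof.
move=> h; apply: normc_eq0; apply/ler_addgt0Pl => e e0.
by rewrite addr0; apply: h.
Qed.

Lemma normc_sum (I : Type) (r : seq I) (P : pred I) (F : I -> R[i]) :
  normc (\sum_(i <- r | P i) F i) <= \sum_(i <- r | P i) normc (F i).
Proof.
elim/big_rec2: _ => [|i y1 y2 _ h]; first by rewrite Normc.normc0.
by rewrite (le_trans (normcD_le _ _)) // lerD2l.
Qed.

Lemma normc_nat m : normc (m%:R : R[i]) = m%:R.
Proof.
have -> : (m%:R : R[i]) = Complex m%:R 0.
  by elim: m => [//|m ih]; rewrite -natr1 ih -natr1; congr Complex; rewrite /= ?addr0.
by rewrite normc_realE normr_nat.
Qed.

Lemma normc_int (z : int) : normc (z%:~R : R[i]) = `|z|%:~R.
Proof.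
by case: z => m; rewrite ?NegzE ?mulrNz ?normcN_eq -pmulrn normc_nat ?normrN.
Qed.

Lemma ReD z w : complex.Re (z + w) = complex.Re z + complex.Re w.
Proof. by case: z w => [a b] [c d]. Qed.
Lemma ImD z w : complex.Im (z + w) = complex.Im z + complex.Im w.
Proof. by case: z w => [a b] [c d]. Qed.
Lemma ReB z w : complex.Re (z - w) = complex.Re z - complex.Re w.
Proof. by case: z w => [a b] [c d]. Qed.
Lemma ImB z w : complex.Im (z - w) = complex.Im z - complex.Im w.
Proof. by case: z w => [a b] [c d]. Qed.
Lemma ReM z w : complex.Re (z * w) =
  complex.Re z * complex.Re w - complex.Im z * complex.Im w.
Proof. by case: z w => [a b] [c d]. Qed.
Lemma ImM z w : complex.Im (z * w) =
  complex.Re z * complex.Im w + complex.Im z * complex.Re w.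
Proof. by case: z w => [a b] [c d]. Qed.
Lemma complexE z : z = Complex (complex.Re z) (complex.Im z).
Proof. by case: z. Qed.

Lemma Re_sum (I : Type) (r : seq I) (P : pred I) (F : I -> R[i]) :
  complex.Re (\sum_(i <- r | P i) F i) = \sum_(i <- r | P i) complex.Re (F i).
Proof. by elim/big_rec2: _ => // i y1 y2 _ <-; rewrite ReD. Qed.
Lemma Im_sum (I : Type) (r : seq I) (P : pred I) (F : I -> R[i]) :
  complex.Im (\sum_(i <- r | P i) F i) = \sum_(i <- r | P i) complex.Im (F i).
Proof. by elim/big_rec2: _ => // i y1 y2 _ <-; rewrite ImD. Qed.

End ComplexNorm.

Section LatticeSums.
Variables (R : realType) (n : nat).
Local Notation Zn := 'rV[int]_n.
Implicit Types (b : Zn -> R) (u v : Zn -> R[i]) (F G : {fset Zn}).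

Definition summ b : Prop :=
  (forall k, 0 <= b k) /\ exists B, forall F, \sum_(k <- F) b k <= B.

Lemma sum_fset_disjoint (V : nmodType) (f : Zn -> V) F G : [disjoint F & G]%fset ->
  \sum_(k <- (F `|` G)%fset) f k = \sum_(k <- F) f k + \sum_(k <- G) f k.
Proof.
move=> dFG; rewrite -big_cat; apply: perm_big; apply: uniq_perm.
- exact: fset_uniq.
- rewrite cat_uniq !fset_uniq /= andbT; apply/hasPn => x xG.
  by apply/negP => xF; move/fdisjointP: dFG => /(_ x xF); rewrite xG.
- by move=> x; rewrite mem_cat in_fsetU.
Qed.

Lemma sum_fset_split (V : nmodType) (f : Zn -> V) F G : (F `<=` G)%fset ->
  \sum_(k <- G) f k = \sum_(k <- F) f k + \sum_(k <- (G `\` F)%fset) f k.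
Proof.
move=> FG; have {1}-> : G = (F `|` (G `\` F))%fset.
  apply/fsetP => x; rewrite in_fsetU in_fsetD.
  by case: (boolP (x \in F)) => //= xF; exact: (fsubsetP FG).
by rewrite sum_fset_disjoint //; apply/fdisjointP => x xF; rewrite in_fsetD xF.
Qed.

Lemma ler_sum_fset b F G : (forall k, 0 <= b k) -> (F `<=` G)%fset ->
  \sum_(k <- F) b k <= \sum_(k <- G) b k.
Proof.
by move=> b0 FG; rewrite (sum_fset_split _ FG) lerDl sumr_ge0.
Qed.

(** Cauchy's criterion; every limit argument about lattice sums goes through
    the finite set that it provides. *)
Lemma summ_tail b : summ b -> forall e, 0 < e -> exists F, forall G,
  [disjoint F & G]%fset -> \sum_(k <- G) b k <= e.
Proof.
move=> [b0 [B hB]] e e0.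
pose S := [set \sum_(k <- F) b k | F in [set: {fset Zn}]].
have hS : has_sup S.
  split; first by exists (\sum_(k <- fset0) b k); exists fset0.
  by exists B => _ [F _ <-].
have [_ [F _ <-] hF] := sup_adherent e0 hS.
exists F => G dFG.
have : \sum_(k <- (F `|` G)%fset) b k <= sup S.
  by apply: ub_le_sup; [case: hS | exists (F `|` G)%fset].
rewrite sum_fset_disjoint //; lra.
Qed.

Let summ_tail_nonneg b (v : Zn -> R) F e : summ b -> 0 < e ->
  (forall G, [disjoint F & G]%fset -> \sum_(k <- G) b k <= e) ->
  (forall k, 0 <= v k <= b k) ->
  forall G, (F `<=` G)%fset ->
  0 <= fine (\esum_(k in [set: Zn]) (v k)%:E) - \sum_(k <- G) v k <= e /\
  (\esum_(k in [set: Zn]) (v k)%:E \is a fin_num)%E.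
Proof.
move=> [b0 _] e0 tl hv G FG.
have v0 k : 0 <= v k by case/andP: (hv k).
have vb k : v k <= b k by case/andP: (hv k).
have lo : ((\sum_(k <- G) v k)%:E <= \esum_(k in [set: Zn]) (v k)%:E)%E.
  apply: esum_ge; exists [set` G]; first by split.
  by rewrite fsbig_finite //= set_fsetK sumEFin.
have hi : (\esum_(k in [set: Zn]) (v k)%:E <= (\sum_(k <- G) v k + e)%:E)%E.
  apply: ub_ereal_sup => _ [A [fA _] <-].
  rewrite fsbig_finite //= sumEFin lee_fin.
  set H := fset_set A.
  apply: (@le_trans _ _ (\sum_(k <- (G `|` H)%fset) v k)).
    by apply: ler_sum_fset => //; apply: fsubsetUr.
  rewrite (sum_fset_split _ (fsubsetUl G H)) lerD2l.
  apply: le_trans (ler_sum _ (fun k _ => vb k)) _; apply: tl.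
  apply/fdisjointP => x xF; rewrite in_fsetD; apply/negP => /andP[+ _].
  by rewrite (fsubsetP FG _ xF).
have fn : (\esum_(k in [set: Zn]) (v k)%:E \is a fin_num)%E.
  by rewrite fin_numElt (lt_le_trans _ lo) ?ltNyr // (le_lt_trans hi) ?ltry.
split=> //; move: lo hi; rewrite -(fineK fn) !lee_fin; lra.
Qed.

Let lsum_tail b (v : Zn -> R) F e : summ b -> 0 < e ->
  (forall G, [disjoint F & G]%fset -> \sum_(k <- G) b k <= e) ->
  (forall k, `|v k| <= b k) ->
  forall G, (F `<=` G)%fset -> `|lsum v - \sum_(k <- G) v k| <= e.
Proof.
move=> sb e0 tl vb G FG; rewrite /lsum.
have [b0 _] := sb.
pose vp k := Num.max (v k) 0; pose vn k := Num.max (- v k) 0.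
have hp k : 0 <= vp k <= b k.
  by rewrite /vp le_max lexx orbT /= ge_max b0 (le_trans (ler_norm _) (vb k)).
have hn k : 0 <= vn k <= b k.
  rewrite /vn le_max lexx orbT /= ge_max b0 andbT.
  by rewrite (le_trans (ler_norm _)) // normrN.
have -> : ((EFin \o v)^\+ = (fun k => (vp k)%:E))%E.
  by apply/funext => k; rewrite funeposE /= /vp EFin_max.
have -> : ((EFin \o v)^\- = (fun k => (vn k)%:E))%E.
  by apply/funext => k; rewrite funenegE /= /vn EFin_max.
have [/andP[p1 p2] fp] := summ_tail_nonneg sb e0 tl hp FG.
have [/andP[n1 n2] fn] := summ_tail_nonneg sb e0 tl hn FG.
have -> : \sum_(k <- G) v k = \sum_(k <- G) vp k - \sum_(k <- G) vn k.
  rewrite -sumrB; apply: eq_bigr => k _; rewrite /vp /vn /Num.max.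
  by case: ltP => ?; case: ltP => ?; lra.
rewrite fineB //; rewrite ler_norml; apply/andP; split; lra.
Qed.

(** The finite set depends on the dominating family only, so that the
    approximation is uniform over everything it dominates. *)
Lemma clsum_tail b : summ b -> forall e, 0 < e -> exists F,
  forall G, (F `<=` G)%fset -> forall u, (forall k, normc (u k) <= b k) ->
    normc (clsum u - \sum_(k <- G) u k) <= e.
Proof.
move=> sb e e0; have e2 : 0 < e / 2 by rewrite divr_gt0.
have [F hF] := summ_tail sb e2; exists F => G FG u ub.
rewrite (le_trans (normc_le_ReIm _)) // ReB ImB Re_sum Im_sum /=.
rewrite [leRHS](splitr e) lerD //; apply: (lsum_tail sb e2 hF _ FG).
  by move=> k; apply: le_trans (normc_Re _) _.
by move=> k; apply: le_trans (normc_Im _) _.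
Qed.

(** Convergence of a lattice sum along the directed set of finite subsets. *)
Definition has_sum u (S : R[i]) : Prop := forall e, 0 < e -> exists F,
  forall G, (F `<=` G)%fset -> normc (S - \sum_(k <- G) u k) <= e.

Lemma clsum_has_sum b u : summ b -> (forall k, normc (u k) <= b k) ->
  has_sum u (clsum u).
Proof.
by move=> sb ub e e0; have [F hF] := clsum_tail sb e0; exists F => G /hF; apply.
Qed.

Lemma has_sum_uniq u S T : has_sum u S -> has_sum u T -> S = T.
Proof.
move=> hS hT; apply/eqP; rewrite -subr_eq0; apply/eqP; apply: normc_small => e e0.
have e2 : 0 < e / 2 by rewrite divr_gt0.
have [F hF] := hS _ e2; have [G hG] := hT _ e2.
set H := (F `|` G)%fset.
have {}hF := hF H (fsubsetUl _ _); have {}hG := hG H (fsubsetUr _ _).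
have -> : S - T = (S - \sum_(k <- H) u k) - (T - \sum_(k <- H) u k) by ring.
by rewrite (le_trans (normcB_le _ _)) // [leRHS](splitr e) lerD.
Qed.

Lemma has_sumD u v S T : has_sum u S -> has_sum v T ->
  has_sum (fun k => u k + v k) (S + T).
Proof.
move=> hS hT e e0; have e2 : 0 < e / 2 by rewrite divr_gt0.
have [F hF] := hS _ e2; have [G hG] := hT _ e2.
exists (F `|` G)%fset => H; rewrite fsubUset => /andP[/hF h1 /hG h2].
rewrite big_split /= opprD addrACA (le_trans (normcD_le _ _)) //.
by rewrite [leRHS](splitr e) lerD.
Qed.

Lemma has_sumZ u S (c : R[i]) : has_sum u S -> has_sum (fun k => c * u k) (c * S).
Proof.
move=> hS e e0; have c0 : 0 < normc c + 1 by rewrite ltr_wpDl ?normc_ge0.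
have [F hF] := hS _ (divr_gt0 e0 c0); exists F => G /hF h.
rewrite -mulr_sumr -mulrBr Normc.normcM.
apply: le_trans (_ : (normc c + 1) * (e / (normc c + 1)) <= e); last first.
  by rewrite mulrC divfK // gt_eqF.
by rewrite ler_pM ?normc_ge0 // lerDl ler01.
Qed.

Lemma has_sum_norm_le u S B : has_sum u S ->
  (forall F, \sum_(k <- F) normc (u k) <= B) -> normc S <= B.
Proof.
move=> hS hB; apply/ler_addgt0Pr => e e0; have [F hF] := hS _ e0.
have := hF F (fsubset_refl _).
have -> : S = (S - \sum_(k <- F) u k) + \sum_(k <- F) u k by rewrite subrK.
move=> h; rewrite (le_trans (normcD_le _ _)) // addrC lerD //; last first.
  by move: h; rewrite addrK.
exact: le_trans (normc_sum _ _ _) (hB F).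
Qed.

Lemma has_sum_single u k0 : (forall k, k != k0 -> u k = 0) -> has_sum u (u k0).
Proof.
move=> h e e0; exists [fset k0]%fset => G; rewrite fsub1set => k0G.
rewrite (bigD1_seq k0) ?fset_uniq //= big1 //.
by rewrite addr0 subrr Normc.normc0 ltW.
Qed.

Lemma has_sum_reindex u S (g g' : Zn -> Zn) : cancel g g' -> cancel g' g ->
  has_sum u S -> has_sum (u \o g) S.
Proof.
move=> gK g'K hS e e0; have [F hF] := hS _ e0.
exists (g' @` F)%fset => G FG.
have -> : \sum_(k <- G) (u \o g) k = \sum_(k <- (g @` G)%fset) u k.
  rewrite -(big_map g predT u); apply: perm_big; apply: uniq_perm.
  - by rewrite map_inj_uniq ?fset_uniq //; apply: can_inj gK.
  - exact: fset_uniq.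
  - by move=> x; apply/mapP/imfsetP => [][y yG ->]; exists y.
apply: hF; apply/fsubsetP => x xF; apply/imfsetP; exists (g' x) => //=.
by apply: (fsubsetP FG); apply/imfsetP; exists x.
Qed.

Lemma summD b b' : summ b -> summ b' -> summ (fun k => b k + b' k).
Proof.
move=> [b0 [B hB]] [c0 [C hC]]; split; first by move=> k; rewrite addr_ge0.
by exists (B + C) => F; rewrite big_split /= lerD.
Qed.

Lemma summZ b c : 0 <= c -> summ b -> summ (fun k => c * b k).
Proof.
move=> c0 [b0 [B hB]]; split; first by move=> k; rewrite mulr_ge0.
by exists (c * B) => F; rewrite -mulr_sumr ler_wpM2l.
Qed.

Lemma summ_reindex b (g : Zn -> Zn) : injective g -> summ b -> summ (b \o g).
Proof.
move=> gi [b0 [B hB]]; split; first by move=> k; apply: b0.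
exists B => F; apply: le_trans (hB (g @` F)%fset).
rewrite -(big_map g predT b) le_eqVlt; apply/orP; left; apply/eqP.
apply: perm_big; apply: uniq_perm.
- by rewrite map_inj_uniq ?fset_uniq.
- exact: fset_uniq.
- by move=> x; apply/mapP/imfsetP => [][y yG ->]; exists y.
Qed.

Definition dominated u : Prop := exists2 b, summ b & forall k, normc (u k) <= b k.

Lemma dominated_has_sum u : dominated u -> has_sum u (clsum u).
Proof. by move=> [b sb ub]; apply: clsum_has_sum ub. Qed.

Lemma has_sum_clsum u S : dominated u -> has_sum u S -> clsum u = S.
Proof. by move=> du; apply: has_sum_uniq; apply: dominated_has_sum. Qed.

Lemma dominatedD u v : dominated u -> dominated v -> dominated (fun k => u k + v k).
Proof.
move=> [b sb hb] [c sc hc]; exists (fun k => b k + c k); first exact: summD.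
by move=> k; rewrite (le_trans (normcD_le _ _)) // lerD.
Qed.

Lemma dominatedZ u c : dominated u -> dominated (fun k => c * u k).
Proof.
move=> [b sb hb]; exists (fun k => normc c * b k); first exact: summZ (normc_ge0 _) sb.
by move=> k; rewrite Normc.normcM ler_wpM2l ?normc_ge0.
Qed.

Lemma dominated_reindex u (g : Zn -> Zn) : injective g ->
  dominated u -> dominated (u \o g).
Proof.
move=> gi [b sb hb]; exists (b \o g); first exact: summ_reindex.
by move=> k; apply: hb.
Qed.

Lemma clsumD u v : dominated u -> dominated v ->
  clsum (fun k => u k + v k) = clsum u + clsum v.
Proof.
move=> du dv; apply: has_sum_clsum; first exact: dominatedD.
by apply: has_sumD; apply: dominated_has_sum.
Qed.

Lemma clsumZ u c : dominated u -> clsum (fun k => c * u k) = c * clsum u.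
Proof.
move=> du; apply: has_sum_clsum; first exact: dominatedZ.
by apply: has_sumZ; apply: dominated_has_sum.
Qed.

Lemma clsumB u v : dominated u -> dominated v ->
  clsum (fun k => u k - v k) = clsum u - clsum v.
Proof.
move=> du dv.
have -> : (fun k => u k - v k) = (fun k => u k + (-1) * v k).
  by apply/funext => k; rewrite mulN1r.
by rewrite clsumD ?clsumZ ?mulN1r //; apply: dominatedZ.
Qed.

Lemma clsum0 : clsum (fun _ : Zn => 0 : R[i]) = 0.
Proof.
apply: has_sum_clsum; last exact: (@has_sum_single (fun=> 0) 0).
by exists (fun=> 0) => [|k]; [split=> //; exists 0 => F; rewrite big1 | rewrite Normc.normc0].
Qed.

Lemma dominated0 : dominated (fun _ : Zn => 0 : R[i]).
Proof.
by exists (fun=> 0) => [|k]; [split=> //; exists 0 => F; rewrite big1 | rewrite Normc.normc0].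
Qed.

Lemma dominated_sum (I : Type) (r : seq I) (P : pred I) (f : I -> Zn -> R[i]) :
  (forall i, dominated (f i)) -> dominated (fun k => \sum_(i <- r | P i) f i k).
Proof.
move=> df; elim: r => [|i r ih].
  suff -> : (fun k => \sum_(i <- [::] | P i) f i k) = fun=> 0 by exact: dominated0.
  by apply/funext => k; rewrite big_nil.
have -> : (fun k => \sum_(j <- i :: r | P j) f j k) =
    fun k => (if P i then f i k else 0) + \sum_(j <- r | P j) f j k.
  by apply/funext => k; rewrite big_cons; case: ifP; rewrite ?add0r.
by apply: dominatedD => //; case: (P i) => //; apply: dominated0.
Qed.

Lemma clsum_sum (I : Type) (r : seq I) (P : pred I) (f : I -> Zn -> R[i]) :
  (forall i, dominated (f i)) ->
  clsum (fun k => \sum_(i <- r | P i) f i k) = \sum_(i <- r | P i) clsum (f i).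
Proof.
move=> df; elim: r => [|i r ih].
  by rewrite big_nil -[RHS]clsum0; congr clsum; apply/funext => k; rewrite big_nil.
rewrite big_cons; transitivity
    (clsum (fun k => (if P i then f i k else 0) + \sum_(j <- r | P j) f j k)).
  by congr clsum; apply/funext => k; rewrite big_cons; case: ifP; rewrite ?add0r.
case: ifP => _; first by rewrite clsumD ?ih //; apply: dominated_sum.
by rewrite -ih; congr clsum; apply/funext => k; rewrite add0r.
Qed.

Lemma clsum_reindex u (g g' : Zn -> Zn) : cancel g g' -> cancel g' g ->
  dominated u -> clsum (u \o g) = clsum u.
Proof.
move=> gK g'K du; apply: has_sum_clsum.
  by apply: dominated_reindex du; apply: can_inj gK.
by apply: has_sum_reindex gK g'K _; apply: dominated_has_sum.
Qed.

Lemma clsum_norm_le u B : dominated u ->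
  (forall F, \sum_(k <- F) normc (u k) <= B) -> normc (clsum u) <= B.
Proof. by move=> du; apply: has_sum_norm_le; apply: dominated_has_sum. Qed.

Lemma clsum_single u k0 : (forall k, k != k0 -> u k = 0) -> clsum u = u k0.
Proof.
move=> h; apply: has_sum_clsum; last exact: has_sum_single.
exists (fun k => normc (u k)) => //; split; first by move=> k; apply: normc_ge0.
exists (normc (u k0)) => F.
have h0 k : k != k0 -> normc (u k) = 0 by move/h => ->; rewrite Normc.normc0.
have [k0F|k0F] := boolP (k0 \in F).
  by rewrite (bigD1_seq k0) ?fset_uniq //= big1 ?addr0 // => k /h0.
rewrite big_seq big1 ?normc_ge0 // => k kF; apply: h0.
by apply: contraNneq k0F => <-.
Qed.

(** Serves for sums against integrals as well as for sums against sums: the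
    finite partial sums converge uniformly on [X], and [L] is bounded for the
    uniform norm on the space [D] where it is linear. *)
Lemma clsum_exchange (X : Type) (D : (X -> R[i]) -> Prop)
    (L : (X -> R[i]) -> R[i]) (C : R) (v : Zn -> X -> R[i]) b :
  D (fun=> 0) ->
  (forall f g, D f -> D g -> D (fun x => f x - g x)) ->
  (forall f g, D f -> D g -> L (fun x => f x - g x) = L f - L g) ->
  0 <= C ->
  (forall f B, 0 <= B -> D f -> (forall x, normc (f x) <= B) -> normc (L f) <= C * B) ->
  summ b -> (forall k, D (v k)) -> (forall k x, normc (v k x) <= b k) ->
  D (fun x => clsum (fun k => v k x)) ->
  L (fun x => clsum (fun k => v k x)) = clsum (fun k => L (v k)).
Proof.
move=> D0 DB LB C0 Lb sb Dv vb Dc.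
have [b0 _] := sb.
have L0 : L (fun=> 0) = 0.
  by have := LB _ _ D0 D0; rewrite !subrr.
have DD f g : D f -> D g -> D (fun x => f x + g x).
  move=> Df Dg; rewrite (_ : (fun x => _) = (fun x => f x - (0 - g x))).
    by apply: (DB) => //; apply: (DB).
  by apply/funext => x; rewrite sub0r opprK.
have LD f g : D f -> D g -> L (fun x => f x + g x) = L f + L g.
  move=> Df Dg; rewrite (_ : (fun x => _) = (fun x => f x - (0 - g x))).
    rewrite LB ?LB ?L0 ?sub0r ?opprK //; exact: (DB).
  by apply/funext => x; rewrite sub0r opprK.
have Lsum (F : seq Zn) : D (fun x => \sum_(k <- F) v k x) /\
    L (fun x => \sum_(k <- F) v k x) = \sum_(k <- F) L (v k).
  elim: F => [|k F [ih1 ih2]].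
    suff -> : (fun x => \sum_(k <- [::]) v k x) = fun=> 0 by rewrite big_nil L0.
    by apply/funext => x; rewrite big_nil.
  have -> : (fun x => \sum_(j <- k :: F) v j x) = fun x => v k x + \sum_(j <- F) v j x.
    by apply/funext => x; rewrite big_cons.
  by rewrite big_cons -ih2; split; [exact: DD | exact: LD].
have dL : dominated (fun k => L (v k)).
  by exists (fun k => C * b k); [exact: summZ | move=> k; apply: Lb].
apply/esym; apply: (has_sum_clsum dL) => e e0.
have e1 : 0 < e / (C + 1) by rewrite divr_gt0 // ltr_wpDl.
have [F hF] := clsum_tail sb e1; exists F => G FG.
have [DG <-] := Lsum G; rewrite -LB //.
apply: le_trans (Lb _ (e / (C + 1)) (ltW e1) _ _) _.
- exact: DB.
- by move=> x; apply: (hF G FG (fun k => v k x)) => k; apply: vb.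
- rewrite mulrA ler_pdivrMr ?ltr_wpDl //; nra.
Qed.

End LatticeSums.

(** * The l1 length on the lattice *)

Section Length.
Variables (R : realType) (n : nat).
Local Notation Zn := 'rV[int]_n.
Implicit Types (k h : Zn).

Definition l1 k : nat := (\sum_j `|k 0%R j|)%N.

(** The Japanese bracket of a frequency. *)
Definition jp k : R := 1 + (l1 k)%:R.

Lemma l10 : l1 0 = 0%N.
Proof. by rewrite /l1 big1 // => j _; rewrite mxE. Qed.

Lemma l1N k : l1 (- k) = l1 k.
Proof. by apply: eq_bigr => j _; rewrite mxE abszN. Qed.

Lemma l1D k h : (l1 (k + h) <= l1 k + l1 h)%N.
Proof. by rewrite /l1 -big_split /=; apply: leq_sum => j _; rewrite mxE;
  by move: (k 0 j) (h 0 j) => a b; lia. Qed.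

Lemma l1_eq0 k : l1 k = 0%N -> k = 0.
Proof.
move=> h; apply/rowP => j; rewrite mxE.
have : (`|k 0%R j| <= l1 k)%N by rewrite /l1 (bigD1 j) //= leq_addr.
by rewrite h leqn0 absz_eq0 => /eqP.
Qed.

Lemma jp_ge1 k : 1 <= jp k.
Proof. by rewrite /jp lerDl ler0n. Qed.

Lemma jp_gt0 k : 0 < jp k.
Proof. exact: lt_le_trans ltr01 (jp_ge1 k). Qed.

Lemma jp_ge0 k : 0 <= jp k. Proof. exact: ltW (jp_gt0 k). Qed.

Lemma jpN k : jp (- k) = jp k.
Proof. by rewrite /jp l1N. Qed.

Lemma jpD k h : jp (k + h) <= jp k * jp h.
Proof.
apply: (@le_trans _ _ (1 + (l1 k)%:R + (l1 h)%:R)).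
  by rewrite /jp -addrA lerD2l -natrD ler_nat l1D.
have := ler0n R (l1 k); have := ler0n R (l1 h); rewrite /jp; nra.
Qed.

Lemma jp_sub k h : jp (k - h) <= jp k * jp h.
Proof. by rewrite -(jpN h) jpD. Qed.

Lemma jp_coord k j : `|(k 0 j)%:~R : R| <= jp k.
Proof.
rewrite -intr_norm -natr_absz.
apply: (@le_trans _ _ (l1 k)%:R); last by rewrite /jp lerDr ler01.
by rewrite ler_nat /l1 (bigD1 j) //= leq_addr.
Qed.

Lemma jp_exp_ge1 k N : 1 <= jp k ^+ N.
Proof. by rewrite exprn_ege1 ?jp_ge1. Qed.

Lemma jp_exp_gt0 k N : 0 < jp k ^+ N.
Proof. by rewrite exprn_gt0 ?jp_gt0. Qed.

Lemma jp_exp_mono k M N : (M <= N)%N -> jp k ^+ M <= jp k ^+ N.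
Proof. by move=> MN; rewrite ler_weXn2l ?jp_ge1. Qed.

Lemma lnorm_le_jp k : 1 + lnorm R k <= jp k.
Proof.
rewrite /jp lerD2l /lnorm -[leRHS](ger0_norm (ler0n _ _)) -sqrtr_sqr.
rewrite ler_wsqrtr // /l1.
have -> : \sum_j ((k 0 j)%:~R : R) ^+ 2 = (\sum_j `|k 0%R j| ^ 2)%N%:R.
  rewrite natr_sum; apply: eq_bigr => j _.
  by rewrite natrX natr_absz intr_norm real_normK ?num_real.
rewrite -natrX ler_nat.
elim/big_ind2: _ => // x1 x2 y1 y2 h1 h2; nia.
Qed.

Lemma lnorm_ge0 k : 0 <= lnorm R k. Proof. exact: sqrtr_ge0. Qed.

Lemma jp_le_lnorm k : jp k <= (1 + n%:R) * (1 + lnorm R k).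
Proof.
have coord j : `|(k 0 j)%:~R : R| <= lnorm R k.
  rewrite -sqrtr_sqr ler_wsqrtr // (bigD1 j) //= lerDl sumr_ge0 // => i _.
  exact: sqr_ge0.
have : (l1 k)%:R <= n%:R * lnorm R k.
  rewrite /l1 natr_sum -[X in X%:R * _]card_ord -sum1_card natr_sum mulr_suml.
  apply: ler_sum => j _; rewrite mul1r (le_trans _ (coord j)) //.
  by rewrite -intr_norm natr_absz.
have := lnorm_ge0 k; have := ler0n R n; rewrite /jp; nra.
Qed.

Let g (m : nat) : R := (1 + m%:R) ^- 2.

Let sum_g M : \sum_(i < M.*2.+1) g `|i%:Z - M%:Z|%N <= 4 - 2 / (1 + M%:R).
Proof.
have mpos m : 0 < 1 + m%:R :> R by rewrite ltr_wpDr.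
elim: M => [|M ih].
  rewrite big_ord1 (_ : `|_|%N = 0%N) //= /g addr0 expr1n !invr1; lra.
rewrite doubleS big_ord_recl big_ord_recr /=.
have -> : (M - 0).+1 = M.+1 by lia.
have -> : `|(bump 0 M.*2.+1)%:Z - M.+1%:Z|%N = M.+1 by rewrite /bump; lia.
have -> : \sum_(i < M.*2.+1) g `|(bump 0 i)%:Z - M.+1%:Z|%N
    = \sum_(i < M.*2.+1) g `|i%:Z - M%:Z|%N.
  by apply: eq_bigr => i _; congr g; rewrite /bump; lia.
have h1 := mpos M; have h2 := mpos M.+1.
have ex : 1 + M.+1%:R = 1 + M%:R + 1 :> R by rewrite -natr1 addrA.
have : 2 * g M.+1 <= 2 / (1 + M%:R) - 2 / (1 + M.+1%:R).
  rewrite /g ex; rewrite ex in h2; move: (1 + M%:R) h1 h2 => x h1 h2.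
  have -> : 2 / x - 2 / (x + 1) = 2 / (x * (x + 1)) by field; rewrite !gt_eqF.
  rewrite ler_pM2l // lef_pV2 ?posrE ?exprn_gt0 ?mulr_gt0 //; nra.
by move: ih; set S := \sum_(_ < _) _ => ih; lra.
Qed.

(** Compare with the product over the coordinates of (1 + |k_j|)^-2, whose sum
    over a box is a power of a one-dimensional sum that telescopes. *)
Lemma summ_jp N : (n.*2 <= N)%N -> summ (fun k => jp k ^- N).
Proof.
move=> nN; split; first by move=> k; rewrite invr_ge0 ltW ?jp_exp_gt0.
exists (4 ^+ n) => F.
pose G k := \prod_j g `|k 0%R j|%N.
have g0 m : 0 <= g m by rewrite /g invr_ge0 exprn_ge0 // addr_ge0.
have step1 k : jp k ^- N <= G k.
  rewrite /G /g prodfV lef_pV2 ?posrE ?jp_exp_gt0 //; last first.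
    by apply: prodr_gt0 => j _; rewrite exprn_gt0 // ltr_wpDr.
  apply: le_trans (jp_exp_mono k nN); rewrite -mul2n exprM.
  rewrite -[X in _ ^+ X]card_ord -prodr_const; apply: ler_prod => j _.
  rewrite exprn_ge0 ?addr_ge0 //= lerXn2r ?nnegrE ?addr_ge0 ?ler0n //.
  by rewrite /jp lerD2l ler_nat /l1 (bigD1 j) //= leq_addr.
apply: le_trans (ler_sum _ (fun k _ => step1 k)) _.
pose M := \max_(k <- F) l1 k.
pose V (a : {ffun 'I_n -> 'I_M.*2.+1}) : Zn := \row_j ((a j)%:Z - M%:Z).
have Vi : injective V.
  move=> a b /rowP ab; apply/ffunP => j; apply/val_inj => /=.
  by have := ab j; rewrite !mxE; lia.
have FV k : k \in F -> k \in map V (enum {: {ffun 'I_n -> 'I_M.*2.+1}}).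
  move=> kF.
  have kM j : (`|k 0%R j| <= M)%N.
    apply: leq_trans (_ : l1 k <= M)%N; first by rewrite /l1 (bigD1 j) //= leq_addr.
    by rewrite /M (big_rem k) //= leq_maxl.
  apply/mapP; exists [ffun j => inord `|(k 0 j + M%:Z)%R|%N]; first by rewrite mem_enum.
  apply/rowP => j; rewrite mxE ffunE.
  by move: (k 0 j) (kM j) => z hz; rewrite inordK; lia.
apply: (@le_trans _ _ (\sum_(k <- map V (enum {: {ffun 'I_n -> 'I_M.*2.+1}})) G k)).
  rewrite [leRHS](bigID (fun k => k \in F)) /=.
  rewrite -[leLHS]addr0 lerD //; last first.
    by rewrite sumr_ge0 // => k _; apply: prodr_ge0.
  rewrite le_eqVlt; apply/orP; left; apply/eqP.
  rewrite -[RHS]big_filter; apply: perm_big; apply: uniq_perm.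
  - exact: fset_uniq.
  - by rewrite filter_uniq // map_inj_uniq ?enum_uniq.
  - move=> k; rewrite mem_filter; have [kF|//] := boolP (k \in F).
    by rewrite (FV _ kF).
rewrite big_map big_enum /=.
have -> : \sum_(a : {ffun 'I_n -> 'I_M.*2.+1}) G (V a) =
    \sum_(a : {ffun 'I_n -> 'I_M.*2.+1}) \prod_j g `|(a j)%:Z - M%:Z|%N.
  by apply: eq_bigr => a _; apply: eq_bigr => j _; rewrite mxE.
rewrite -(bigA_distr_bigA (fun (j : 'I_n) (i : 'I_M.*2.+1) => g `|i%:Z - M%:Z|%N)) /=.
rewrite prodr_const card_ord lerXn2r ?nnegrE ?sumr_ge0 //.
apply: le_trans (sum_g M) _; rewrite lerBlDr lerDl.
by rewrite divr_ge0 // addr_ge0.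
Qed.

End Length.

(** * Iterated integrals over the cube of continuous functions *)

Section Pairs.
Variables (S T U : topologicalType).

Lemma continuous_pair (f : S -> T) (g : S -> U) :
  continuous f -> continuous g -> continuous (fun s => (f s, g s)).
Proof. by move=> cf cg s; apply: cvg_pair; [exact: cf | exact: cg]. Qed.

Lemma continuous_compose (f : S -> T) (g : T -> U) :
  continuous f -> continuous g -> continuous (fun s => g (f s)).
Proof. by move=> cf cg s; apply: continuous_comp; [exact: cf | exact: cg]. Qed.

Lemma continuous_const (c : T) : continuous (fun _ : S => c).
Proof. by move=> s; exact: cvg_cst. Qed.

Lemma continuous_ident : continuous (fun s : S => s).
Proof. by move=> s; exact: cvg_id. Qed.

Lemma continuous_fst : continuous (fun z : S * T => z.1).
Proof. by move=> z; exact: cvg_fst. Qed.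

Lemma continuous_snd : continuous (fun z : S * T => z.2).
Proof. by move=> z; exact: cvg_snd. Qed.

End Pairs.

Lemma continuous_slice_pair (T U V : topologicalType) (G : T * U -> V) (t : T) :
  continuous G -> continuous (fun u => G (t, u)).
Proof.
move=> cG; apply: continuous_compose cG.
by apply: continuous_pair; [exact: continuous_const | exact: continuous_ident].
Qed.

Section RealContinuity.
Variables (R : realType) (T : topologicalType).
Implicit Types f g : T -> R.

Lemma continuous_add f g : continuous f -> continuous g ->
  continuous (fun t => f t + g t).
Proof. by move=> cf cg t; apply: cvgD; [exact: cf | exact: cg]. Qed.

Lemma continuous_mul f g : continuous f -> continuous g ->
  continuous (fun t => f t * g t).
Proof. by move=> cf cg t; apply: cvgM; [exact: cf | exact: cg]. Qed.

Lemma continuous_sub f g : continuous f -> continuous g ->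
  continuous (fun t => f t - g t).
Proof. by move=> cf cg t; apply: cvgB; [exact: cf | exact: cg]. Qed.

Lemma continuous_scale c f : continuous f -> continuous (fun t => c * f t).
Proof. by apply: continuous_mul; exact: continuous_const. Qed.

Lemma continuous_exp f N : continuous f -> continuous (fun t => f t ^+ N).
Proof.
move=> cf; elim: N => [|N ih]; first exact: continuous_const.
rewrite (_ : (fun t => _) = fun t => f t * f t ^+ N); first exact: continuous_mul.
by apply/funext => t; rewrite exprS.
Qed.

End RealContinuity.

Section UnitInterval.
Variable R : realType.
Implicit Types (g h : R -> R).

Definition int01 g : R := \int[lebesgue_measure]_(t in `[0, 1]) g t.

Lemma integrable01 g : continuous g ->
  lebesgue_measure.-integrable `[0, 1] (EFin \o g).
Proof.
move=> cg; apply: continuous_compact_integrable; first exact: segment_compact.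
exact: continuous_subspaceT.
Qed.

Lemma int01B g h : continuous g -> continuous h ->
  int01 (fun t => g t - h t) = int01 g - int01 h.
Proof. by move=> cg ch; rewrite /int01 RintegralB //; apply: integrable01. Qed.

Lemma int01D g h : continuous g -> continuous h ->
  int01 (fun t => g t + h t) = int01 g + int01 h.
Proof. by move=> cg ch; rewrite /int01 RintegralD //; apply: integrable01. Qed.

Lemma int01Z c g : continuous g -> int01 (fun t => c * g t) = c * int01 g.
Proof. by move=> cg; rewrite /int01 RintegralZl //; apply: integrable01. Qed.

Lemma int01N g : continuous g -> int01 (fun t => - g t) = - int01 g.
Proof.
by move=> cg; rewrite -mulN1r -int01Z //; congr int01; apply/funext => t; rewrite mulN1r.
Qed.

Lemma int01_cst c : int01 (fun=> c) = c.
Proof.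
rewrite /int01 Rintegral_cst //= lebesgue_measure_itv /= lte_fin ltr01.
by rewrite sube0 mulr1.
Qed.

Lemma le_int01 g h : continuous g -> continuous h ->
  (forall t, 0 <= t <= 1 -> g t <= h t) -> int01 g <= int01 h.
Proof.
by move=> cg ch gh; apply: le_Rintegral => //; exact: integrable01.
Qed.

Lemma int01_norm_le g B : continuous g ->
  (forall t, 0 <= t <= 1 -> `|g t| <= B) -> `|int01 g| <= B.
Proof.
move=> cg gB; have cc (c : R) : continuous (fun _ : R => c) by move=> t; exact: cvg_cst.
rewrite ler_norml; apply/andP; split.
  rewrite -(int01_cst (- B)); apply: le_int01 => // t /gB.
  by rewrite ler_norml => /andP[].
rewrite -(int01_cst B); apply: le_int01 => // t /gB.
by rewrite ler_norml => /andP[].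
Qed.

Lemma int01_ge_subitv g u v r : continuous g -> 0 <= u -> u <= v -> v <= 1 ->
  0 <= r -> (forall t, 0 <= t <= 1 -> 0 <= g t) ->
  (forall t, u <= t <= v -> r <= g t) -> (v - u) * r <= int01 g.
Proof.
move=> cg u0 uv v1 r0 g0 gr.
pose I : set R := [set` `[u, v]].
have sub : I `<=` [set` `[0, 1]].
  by move=> t; rewrite /I /= !in_itv /= => /andP[] *; apply/andP; split; lra.
have mg (D : set R) : measurable_fun D g.
  by apply: measurable_funTS; exact: continuous_measurable_fun.
have ig := integrable01 cg.
rewrite /int01 -lee_fin /Rintegral fineK; last exact: integrable_fin_num.
apply: (@le_trans _ _ (\int[lebesgue_measure]_(t in I) (g t)%:E)%E).
  have -> : (((v - u) * r)%:E = \int[lebesgue_measure]_(t in I) r%:E)%E.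
    transitivity (r%:E * lebesgue_measure I)%E; last exact/esym/(integral_cst lebesgue_measure (measurable_itv _)).
    rewrite /I lebesgue_measure_itv /= lte_fin.
    case: ltgtP uv => // [uv _|-> _]; first by rewrite -EFinD -EFinM mulrC.
    by rewrite subrr mul0r mule0.
  apply: ge0_le_integral => //.
  - exact: measurable_itv.
  - by apply/measurable_EFinP; exact: mg.
apply: ge0_subset_integral => //.
- exact: measurable_itv.
- by apply/measurable_EFinP; exact: mg.
Qed.

Lemma int01_deriv g g' : (forall t : R, is_derive t (1 : R) g (g' t)) -> continuous g' ->
  int01 g' = g 1 - g 0.
Proof.
move=> dg cg'.
have cg : continuous g.
  by move=> t; apply/differentiable_continuous/derivable1_diffP; case: (dg t).
rewrite /int01 /Rintegral (@continuous_FTC2 _ g' g) ?ltr01 //.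
- exact: continuous_subspaceT.
- split; first by move=> t _; case: (dg t).
    exact/cvg_at_right_filter/cg.
  exact/cvg_at_left_filter/cg.
- by move=> t _; rewrite derive1E; case: (dg t).
Qed.

(** Joint continuity makes the integrand uniformly close along the compact
    interval, hence the integral depends continuously on the parameter. *)
Lemma int01_param (T : topologicalType) (G : T -> R -> R) :
  continuous (fun z : T * R => G z.1 z.2) -> continuous (fun t => int01 (G t)).
Proof.
move=> cG t0; apply/cvgrPdist_le => e e0.
have cGt t : continuous (G t).
  exact: (continuous_slice_pair (G := fun z => G z.1 z.2)).
have /compact_near_coveringP := @segment_compact R 0 1.
move=> /(_ _ (nbhs t0) (fun t s => `|G t0 s - G t s| <= e) _) near_unif.
have : \forall t \near nbhs t0, `[0, 1] `<=` (fun s => `|G t0 s - G t s| <= e).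
  apply: near_unif => s _.
  have e2 : 0 < e / 2 by rewrite divr_gt0.
  have h1 : \forall z \near (s, t0), `|G t0 s - G z.2 z.1| <= e / 2.
    have : ((fun z : R * T => G z.2 z.1) @ (s, t0) --> G t0 s).
      apply: (continuous_compose (f := fun z : R * T => (z.2, z.1))) cG (s, t0).
      by apply: continuous_pair; [exact: continuous_snd | exact: continuous_fst].
    by move/cvgrPdist_le => /(_ _ e2).
  have h2 : \forall s' \near s, `|G t0 s - G t0 s'| <= e / 2.
    by have /cvgrPdist_le/(_ _ e2) := cGt t0 s.
  have h3 : \forall z \near (s, t0), `|G t0 s - G t0 z.1| <= e / 2.
    exact: (cvg_fst h2).
  near=> z.
  have z1 : `|G t0 s - G z.2 z.1| <= e / 2 by near: z; exact: h1.
  have z2 : `|G t0 s - G t0 z.1| <= e / 2 by near: z; exact: h3.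
  rewrite (_ : G t0 z.1 - G z.2 z.1 =
    (G t0 s - G z.2 z.1) - (G t0 s - G t0 z.1)); last by ring.
  by rewrite (le_trans (ler_normB _ _)) // [leRHS](splitr e) lerD.
apply: filterS => t ht.
rewrite -int01B //; apply: int01_norm_le.
  by move=> s; apply: cvgB; apply: cGt.
by move=> s s01; apply: ht; rewrite /= in_itv.
Unshelve. all: by end_near. Qed.

End UnitInterval.

Section CubeIntegral.
Variable R : realType.

Lemma continuous_mx (T : topologicalType) m n (f : T -> 'M[R]_(m, n)) :
  (forall i j, continuous (fun t => f t i j)) -> continuous f.
Proof.
move=> cf t A [P hP PA]; rewrite nbhs_simpl /=.
have : \forall s \near t, forall i j, P i j (f s i j).
  apply: filter_forall => i; apply: filter_forall => j.
  exact: (cf i j t _ (hP i j)).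
by apply: filterS => s hs; apply: PA.
Qed.

Lemma continuous_coord n (j : 'I_n) : continuous (fun x : 'rV[R]_n => x 0 j).
Proof. exact: coord_continuous. Qed.

Lemma continuous_consmx (T : topologicalType) m (f : T -> R) (g : T -> 'rV[R]_m) :
  continuous f -> continuous g ->
  continuous (fun t => row_mx (f t)%:M (g t) : 'rV[R]_(1 + m)).
Proof.
move=> cf cg; apply: continuous_mx => i j.
have [k|k] := split_ordP j; move=> ->.
  rewrite (_ : (fun t => _) = f) //.
  by apply/funext => t; rewrite row_mxEl mxE !ord1 eqxx.
rewrite (_ : (fun t => _) = fun t => g t 0 k); last first.
  by apply/funext => t; rewrite row_mxEr (ord1 i).
exact: (continuous_compose cg (@continuous_coord _ k)).
Qed.

Lemma cube_int_param n : forall (T : topologicalType) (h : T -> 'rV[R]_n -> R),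
  continuous (fun z : T * 'rV[R]_n => h z.1 z.2) ->
  continuous (fun t => cube_int (h t)).
Proof.
elim: n => [|m ih] T h ch.
  apply: (@continuous_compose T (T * 'rV[R]_0)%type R (fun s => (s, 0)) _ _ ch).
  by apply: continuous_pair; [exact: continuous_ident | exact: continuous_const].
apply: (@int01_param _ _ (fun t s => cube_int (fun y : 'rV[R]_m => h t (row_mx s%:M y)))).
apply: (ih _ (fun (z : T * R) y => h z.1 (row_mx z.2%:M y))).
apply: (@continuous_compose _ (T * 'rV[R]_(1 + m))%type R (fun z : T * R * 'rV[R]_m =>
  (z.1.1, row_mx (z.1.2)%:M z.2 : 'rV[R]_(1 + m))) (fun z => h z.1 z.2) _ ch).
have c1 := @continuous_fst (T * R)%type 'rV[R]_m.
apply: continuous_pair; first exact: (continuous_compose c1 (@continuous_fst _ _)).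
apply: continuous_consmx; last exact: continuous_snd.
exact: (continuous_compose c1 (@continuous_snd _ _)).
Qed.

Lemma continuous_slice m (h : 'rV[R]_(1 + m) -> R) t : continuous h ->
  continuous (fun y : 'rV[R]_m => h (row_mx t%:M y)).
Proof.
move=> ch; apply: continuous_compose ch.
by apply: continuous_consmx; [exact: continuous_const | exact: continuous_ident].
Qed.

Lemma continuous_cube_slice m (h : 'rV[R]_(1 + m) -> R) : continuous h ->
  continuous (fun t => cube_int (fun y : 'rV[R]_m => h (row_mx t%:M y))).
Proof.
move=> ch; apply: cube_int_param; apply: continuous_compose ch.
by apply: continuous_consmx; [exact: continuous_fst | exact: continuous_snd].
Qed.

Lemma cube_intS m (h : 'rV[R]_(1 + m) -> R) :
  cube_int (h : 'rV[R]_m.+1 -> R) =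
  int01 (fun t => cube_int (fun y : 'rV[R]_m => h (row_mx t%:M y))).
Proof. by []. Qed.

Lemma cube_intD n (g h : 'rV[R]_n -> R) : continuous g -> continuous h ->
  cube_int (fun x => g x + h x) = cube_int g + cube_int h.
Proof.
elim: n g h => [//|m ih] g h cg ch; rewrite !cube_intS -int01D;
  try exact: continuous_cube_slice.
by congr int01; apply/funext => t; apply: ih; apply: continuous_slice.
Qed.

Lemma cube_intZ n c (h : 'rV[R]_n -> R) : continuous h ->
  cube_int (fun x => c * h x) = c * cube_int h.
Proof.
elim: n h => [//|m ih] h ch; rewrite !cube_intS -int01Z;
  try exact: continuous_cube_slice.
by congr int01; apply/funext => t; apply: ih; apply: continuous_slice.
Qed.

Lemma cube_int_norm_le n (h : 'rV[R]_n -> R) B : continuous h ->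
  (forall x, `|h x| <= B) -> `|cube_int h| <= B.
Proof.
elim: n h => [h _ hB|m ih h ch hB]; first exact: hB.
rewrite cube_intS; apply: int01_norm_le; first exact: continuous_cube_slice.
by move=> t _; apply: ih => [|y]; [exact: continuous_slice | exact: hB].
Qed.

Lemma cube_int_cst n c : cube_int (fun _ : 'rV[R]_n => c) = c.
Proof.
elim: n => [//|m ih]; rewrite cube_intS -[RHS]int01_cst.
by congr int01; apply/funext => t; apply: ih.
Qed.

End CubeIntegral.

(** * The integral of a partial derivative of a periodic function *)

Section DerivativeTransfer.
Variable R : realType.

Lemma is_derive_cvg (V : normedModType R) (f : V -> R) x v (d : R) :
  (e^-1 * (f (e *: v + x) - f x)) @[e --> (0 : R)^'] --> d -> is_derive x v f d.
Proof.
move=> h; split; first by apply/cvg_ex; exists d; exact: h.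
by apply: cvg_lim => //; exact: h.
Qed.

(** A directional derivative only sees the function along a line. *)
Lemma is_derive_transfer (V W : normedModType R) (f : V -> R) (g : W -> R)
    x v y w (d : R) :
  (forall e : R, g (e *: w + y) = f (e *: v + x)) ->
  is_derive x v f d -> is_derive y w g d.
Proof.
move=> gf [df fd]; apply: is_derive_cvg.
have g0 : g y = f x by have := gf 0; rewrite !scale0r !add0r.
under eq_fun do rewrite gf g0.
by rewrite -fd; exact: df.
Qed.

Lemma derivable_partial n (j : 'I_n) (h : 'rV[R]_n -> R) x :
  derivable h x (unitv R j) -> is_derive x (unitv R j) h (partial j h x).
Proof. by move=> dh; split. Qed.

(** Differentiation under the integral: by the fundamental theorem of calculus
    the difference quotient of [H] is an average of [D], jointly continuous in
    the increment and the integration variable. *)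
Lemma is_derive_cube_int m (H D : R -> 'rV[R]_m -> R) :
  continuous (fun z : R * 'rV[R]_m => H z.1 z.2) ->
  continuous (fun z : R * 'rV[R]_m => D z.1 z.2) ->
  (forall (t : R) y, is_derive t (1 : R) (fun t => H t y) (D t y)) ->
  forall t : R, is_derive t (1 : R) (fun t => cube_int (H t)) (cube_int (D t)).
Proof.
move=> cH cD dH t.
pose Q (e : R) (y : 'rV[R]_m) := int01 (fun s => D (t + s * e) y).
have cQ : continuous (fun z : R * 'rV[R]_m => Q z.1 z.2).
  apply: (@int01_param R (R * 'rV[R]_m)%type (fun z s => D (t + s * z.1) z.2)).
  apply: (@continuous_compose _ (R * 'rV[R]_m)%type R
    (fun z : R * 'rV[R]_m * R => (t + z.2 * z.1.1, z.1.2)) _ _ cD).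
  have c1 := @continuous_fst (R * 'rV[R]_m)%type R.
  apply: continuous_pair; last exact: (continuous_compose c1 (@continuous_snd _ _)).
  move=> z; apply: cvgD; first exact: cvg_cst.
  apply: cvgM; first exact: continuous_snd.
  exact: (continuous_compose c1 (@continuous_fst _ _)).
have cHs u : continuous (H u) by exact: (continuous_slice_pair (G := fun z => H z.1 z.2)).
have cDs u : continuous (D u) by exact: (continuous_slice_pair (G := fun z => D z.1 z.2)).
have cQs e : continuous (Q e) by exact: (continuous_slice_pair (G := fun z => Q z.1 z.2)).
have HQ e y : H (t + e) y - H t y = e * Q e y.
  have cDy : continuous (fun s : R => D (t + s * e) y).
    apply: (@continuous_compose _ (R * 'rV[R]_m)%type R
      (fun s : R => (t + s * e, y)) _ _ cD).
    apply: continuous_pair; last exact: continuous_const.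
    by move=> s; apply: cvgD; [exact: cvg_cst | apply: cvgM; [exact: cvg_id|exact: cvg_cst]].
  rewrite /Q -int01Z //.
  rewrite (_ : H (t + e) y - H t y = H (t + 1 * e) y - H (t + 0 * e) y); last first.
    by rewrite mul1r mul0r addr0.
  apply/esym/(@int01_deriv _ (fun s => H (t + s * e) y)).
  - move=> s.
    have d1 : is_derive s (1 : R) (fun s : R => t + s * e) e.
      apply: is_derive_cvg; apply/cvgrPdist_le => eps eps0; near=> x.
      rewrite (_ : x^-1 * _ = e) ?subrr ?normr0 ?ltW //.
      have x0 : x != 0 by near: x; exact: nbhs_dnbhs_neq.
      by rewrite /GRing.scale /= mulr1; field.
    have := @is_derive1_comp R (fun u => H u y) (fun s => t + s * e) s _ _ (dH _ y) d1.
    by rewrite mulrC.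
  - exact: continuous_scale.
apply: is_derive_cvg.
have -> : cube_int (D t) = cube_int (Q 0).
  congr cube_int; apply/funext => y; rewrite /Q -[LHS]int01_cst; congr int01.
  by apply/funext => s; rewrite mulr0 addr0.
have cIQ := cube_int_param cQ.
apply: (@cvg_trans _ ((fun e => cube_int (Q e)) @ (0 : R)^')); last first.
  by apply: cvg_trans (cIQ 0); apply: cvg_app; exact: nbhs_dnbhs.
apply: near_eq_cvg; near=> e.
have e0 : e != 0 by near: e; exact: nbhs_dnbhs_neq.
rewrite /GRing.scale /= mulr1.
have -> : cube_int (H (e + t)) = cube_int (H t) + e * cube_int (Q e).
  rewrite -cube_intZ // -cube_intD //; last exact: continuous_scale.
  by congr cube_int; apply/funext => y; rewrite -HQ addrC; ring.
by field.
Unshelve. all: by end_near. Qed.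

Lemma row_mx_unitv0 m (e t : R) (y : 'rV[R]_m) :
  e *: unitv R (lshift m (0 : 'I_1)) + (row_mx t%:M y : 'rV_(1 + m)) =
  row_mx (e + t)%:M y.
Proof.
apply/rowP => i; rewrite [LHS]mxE.
case: (split_ordP i) => k ->; rewrite ?row_mxEl ?row_mxEr !mxE.
  by rewrite !ord1 !eqxx !mulr1n /= mulr1.
by rewrite eq_rlshift mulr0 add0r.
Qed.

Lemma row_mx_unitvS m (e t : R) (y : 'rV[R]_m) j :
  e *: unitv R (rshift 1 j) + (row_mx t%:M y : 'rV_(1 + m)) =
  row_mx t%:M (e *: unitv R j + y).
Proof.
apply/rowP => i; rewrite [LHS]mxE.
case: (split_ordP i) => k ->; rewrite ?row_mxEl ?row_mxEr !mxE.
  by rewrite eq_lrshift mulr0 add0r.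
by rewrite eq_rshift.
Qed.

(** In the outermost variable, differentiate under the inner integrals and
    apply the fundamental theorem of calculus; the other variables follow by
    induction. *)
Lemma cube_int_partial n (j : 'I_n) (h : 'rV[R]_n -> R) :
  continuous h -> (forall x, derivable h x (unitv R j)) -> continuous (partial j h) ->
  (forall x, h (x + unitv R j) = h x) -> cube_int (partial j h) = 0.
Proof.
elim: n j h => [[]//|m ih] j h ch dh cdh ph.
case: (split_ordP (j : 'I_(1 + m))) => k jk; rewrite {}jk in dh cdh ph *.
  rewrite (ord1 k) in dh cdh ph *.
  pose G t := cube_int (fun y : 'rV[R]_m => h (row_mx t%:M y)).
  have -> : 0 = G 1 - G 0.
    apply/esym/eqP; rewrite subr_eq0; apply/eqP; congr cube_int; apply/funext => y.
    by rewrite -[RHS]ph [in RHS]addrC -[unitv _ _]scale1r row_mx_unitv0 addr0.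
  rewrite cube_intS; apply: (@int01_deriv _ G).
  - apply: (@is_derive_cube_int m (fun t y => h (row_mx t%:M y))
      (fun t y => partial (@lshift 1 m 0) h (row_mx t%:M y))).
    + apply: (continuous_compose _ ch).
      by apply: continuous_consmx; [exact: continuous_fst | exact: continuous_snd].
    + apply: (continuous_compose _ cdh).
      by apply: continuous_consmx; [exact: continuous_fst | exact: continuous_snd].
    + move=> t y; apply: (is_derive_transfer _ (derivable_partial (dh _))) => e.
      by rewrite row_mx_unitv0 /GRing.scale /= mulr1.
  - exact: continuous_cube_slice.
rewrite cube_intS -[RHS](int01_cst (0 : R)); congr int01; apply/funext => t.
pose ht (y : 'rV[R]_m) := h (row_mx t%:M y).
have dht y : is_derive y (unitv R k) ht (partial (rshift 1 k) h (row_mx t%:M y)).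
  by apply: (is_derive_transfer _ (derivable_partial (dh _))) => e; rewrite row_mx_unitvS.
have pht : partial k ht = fun y => partial (rshift 1 k) h (row_mx t%:M y).
  by apply/funext => y; rewrite /partial; case: (dht y).
rewrite -pht; apply: ih.
- exact: continuous_slice.
- by move=> y; case: (dht y).
- by rewrite pht; exact: continuous_slice.
- move=> y; rewrite /ht -[RHS]ph; congr h.
  by rewrite [RHS]addrC -[X in _ = X + _]scale1r row_mx_unitvS scale1r addrC.
Qed.

End DerivativeTransfer.

(** * Uniqueness of Fourier coefficients *)

Lemma ler_cos (R : realType) : {in `[0 : R, pi] &, {mono cos : x y /~ y <= x}}.
Proof. by move=> x y x0 y0; rewrite !leNgt ltr_cos. Qed.

Section UniquenessOneVariable.
Variables (R : realType) (g : R -> R).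
Hypothesis cg : continuous g.
Hypothesis g_cos : forall j : int, int01 (fun t => g t * cos (2 * pi * j%:~R * t)) = 0.
Hypothesis g_sin : forall j : int, int01 (fun t => g t * sin (2 * pi * j%:~R * t)) = 0.

Let orth (w : R -> R) := continuous w /\ int01 (fun t => g t * w t) = 0.

Let orthD w1 w2 : orth w1 -> orth w2 -> orth (fun t => w1 t + w2 t).
Proof.
move=> [c1 h1] [c2 h2]; split; first exact: continuous_add.
under eq_fun do rewrite mulrDr.
by rewrite int01D ?h1 ?h2 ?addr0 //; exact: continuous_mul.
Qed.

Let orthZ c w : orth w -> orth (fun t => c * w t).
Proof.
move=> [c1 h1]; split; first exact: continuous_scale.
under eq_fun do rewrite mulrCA.
by rewrite int01Z ?h1 ?mulr0 //; exact: continuous_mul.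
Qed.

Let C (j : int) (t : R) := cos (2 * pi * j%:~R * t).
Let S (j : int) (t : R) := sin (2 * pi * j%:~R * t).
Let p (a t : R) := (1 + cos (2 * pi * (t - a))) / 2.

Let continuous_lin (c : R) : continuous (fun t : R => c * t).
Proof. by apply: continuous_scale; exact: continuous_ident. Qed.

Let continuous_dilate (f : R -> R) (c : R) :
  continuous f -> continuous (fun t => f (c * t)).
Proof. by move=> cf; apply: continuous_compose cf; exact: continuous_lin. Qed.

Let continuous_p a : continuous (p a).
Proof.
apply: continuous_mul; last exact: continuous_const.
apply: continuous_add; first exact: continuous_const.
apply: (@continuous_compose _ _ _ (fun t => 2 * pi * (t - a)) _ _ (@continuous_cos R)).
apply: continuous_scale; apply: continuous_sub; last exact: continuous_const.
exact: continuous_ident.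
Qed.

Let orth_p a N : forall j, orth (fun t => p a t ^+ N * C j t) /\ orth (fun t => p a t ^+ N * S j t).
Proof.
elim: N => [|N ih] j.
  split.
    rewrite (_ : (fun t => _) = C j); last by apply/funext => t; rewrite expr0 mul1r.
    split; last exact: g_cos.
    exact: continuous_dilate (@continuous_cos R).
  rewrite (_ : (fun t => _) = S j); last by apply/funext => t; rewrite expr0 mul1r.
  split; last exact: g_sin.
  exact: continuous_dilate (@continuous_sin R).
have [cj sj] := ih j; have [cj1 sj1] := ih (j + 1); have [cj2 sj2] := ih (j - 1).
have e1 t : cos (2 * pi * (t - a)) = cos (2 * pi * t) * cos (2 * pi * a) +
     sin (2 * pi * t) * sin (2 * pi * a) by rewrite mulrBr cosB.
have e2 t : 2 * pi * (j + 1)%:~R * t = 2 * pi * j%:~R * t + 2 * pi * t :> R.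
  by rewrite intrD; ring.
have e3 t : 2 * pi * (j - 1)%:~R * t = 2 * pi * j%:~R * t - 2 * pi * t :> R.
  by rewrite intrB; ring.
pose ca : R := cos (2 * pi * a); pose sa : R := sin (2 * pi * a).
split.
  rewrite (_ : (fun t => _) = fun t =>
    2^-1 * (p a t ^+ N * C j t) + (4^-1 * ca * (p a t ^+ N * C (j + 1) t) +
    (4^-1 * ca * (p a t ^+ N * C (j - 1) t) + (4^-1 * sa * (p a t ^+ N * S (j + 1) t) +
      (- (4^-1 * sa)) * (p a t ^+ N * S (j - 1) t))))).
    by do ?[apply: orthD | apply: orthZ].
  apply/funext => t; rewrite exprS {1}/p e1 /C /S e2 e3 cosD sinD cosB sinB.
  by rewrite -/ca -/sa; field.
rewrite (_ : (fun t => _) = fun t =>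
    2^-1 * (p a t ^+ N * S j t) + (4^-1 * ca * (p a t ^+ N * S (j + 1) t) +
    (4^-1 * ca * (p a t ^+ N * S (j - 1) t) + ((- (4^-1 * sa)) * (p a t ^+ N * C (j + 1) t) +
      (4^-1 * sa) * (p a t ^+ N * C (j - 1) t))))).
  by do ?[apply: orthD | apply: orthZ].
apply/funext => t; rewrite exprS {1}/p e1 /C /S e2 e3 cosD sinD cosB sinB.
by rewrite -/ca -/sa; field.
Qed.

Let int01_gp a N : int01 (fun t => g t * p a t ^+ N) = 0.
Proof.
have [[_ h] _] := orth_p a N 0; rewrite -[RHS]h; congr int01; apply/funext => t.
by rewrite /C mulr0 mul0r cos0 mulr1.
Qed.

(** The nonnegative trigonometric polynomials ((1 + cos 2 pi (t - a)) / 2) ^ N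
    are orthogonal to [g] and concentrate at [a] as N grows, which is
    incompatible with [g a > 0]. *)
Lemma fourier_uniq_pos a : 0 < a < 1 -> g a <= 0.
Proof.
move=> /andP[a0 a1]; rewrite leNgt; apply/negP => ga.
pose c := g a / 2; have c0 : 0 < c by rewrite divr_gt0.
have pi0 := @pi_gt0 R.
have [d [d0 dp da da1]] : exists d, [/\ 0 < d, (forall t, `|t - a| <= 2 * d -> c <= g t),
     2 * d <= a & 2 * d <= 1 - a].
  have /cvgrPdist_le/(_ _ c0) := @cg a.
  move=> /nbhs_ballP[e /= e0 he].
  have m0 : 0 < Num.min e (Num.min a (1 - a)) by rewrite !lt_min e0 a0 subr_gt0 a1.
  exists (Num.min e (Num.min a (1 - a)) / 4).
  have m1 : Num.min e (Num.min a (1 - a)) <= e by rewrite ge_min lexx.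
  have m2 : Num.min e (Num.min a (1 - a)) <= a by rewrite !ge_min lexx ?orbT.
  have m3 : Num.min e (Num.min a (1 - a)) <= 1 - a by rewrite !ge_min lexx ?orbT.
  move: (Num.min _ _) m0 m1 m2 m3 => m m0 m1 m2 m3.
  split; try lra.
  move=> t ta; have /he : ball a e t by rewrite /ball /= distrC; lra.
  by rewrite /= ler_norml /c => /andP[]; lra.
(* [r1] bounds the kernel below on |t - a| <= d, and [r2 < r1] bounds it above
   away from |t - a| <= 2 d. *)
pose r1 := (1 + cos (2 * pi * d)) / 2; pose r2 := (1 + cos (2 * pi * (2 * d))) / 2.
have d4 : d <= 4^-1 by lra.
have r2_ge0 : 0 <= r2 by rewrite divr_ge0 // -lerBlDl sub0r cos_geN1.
have r12 : r2 < r1.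
  rewrite ltr_pM2r ?invr_gt0 // ltrD2l ltr_cos ?in_itv /=; nra.
have r1_gt0 : 0 < r1 by exact: le_lt_trans r12.
have p_ge0 t : 0 <= p a t by rewrite divr_ge0 // -lerBlDl sub0r cos_geN1.
have p_norm t : p a t = (1 + cos (2 * pi * `|t - a|)) / 2.
  by rewrite /p -[in LHS]cos_norm normrM (ger0_norm (_ : 0 <= 2 * pi)) // mulr_ge0 // ltW.
have p_in t : `|t - a| <= d -> r1 <= p a t.
  move=> ta; have := normr_ge0 (t - a) => ta0.
  rewrite p_norm ler_pM2r ?invr_gt0 // lerD2l ler_cos ?in_itv /=; nra.
have p_out t : 0 <= t <= 1 -> 2 * d < `|t - a| -> p a t <= r2.
  move=> /andP[t0 t1] ta; have ta1 : `|t - a| <= 1 - 2 * d.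
    by rewrite ler_norml; apply/andP; split; lra.
  rewrite p_norm ler_pM2r ?invr_gt0 // lerD2l.
  move: `|t - a| ta ta1 => s ta ta1.
  have [s2|s2] := leP s 2^-1; first by rewrite ler_cos ?in_itv /=; nra.
  have -> : cos (2 * pi * s) = cos (2 * pi * (1 - s)) :> R.
    rewrite -cosN (_ : 2 * pi * (1 - s) = - (2 * pi * s) + pi *+ 2) ?cosD2pi //.
    by rewrite mulr2n; ring.
  by rewrite ler_cos ?in_itv /=; nra.
have [B B0 gB] : exists2 B, 0 <= B & forall t, 0 <= t <= 1 -> `|g t| <= B.
  have cng : {within `[0, 1], continuous (fun t => `|g t|)}.
    apply: continuous_subspaceT => t.
    by apply: (@continuous_comp _ _ _ g (fun x => `|x|)); [exact: cg | exact: norm_continuous].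
  have [x x01 hx] := EVT_max ler01 cng.
  by exists `|g x| => // t t01; apply: hx; rewrite in_itv.
have cpN N : continuous (fun t => p a t ^+ N) by exact: continuous_exp.
have upper N : c * int01 (fun t => p a t ^+ N) <= (B + c) * r2 ^+ N.
  rewrite -int01Z // -[leRHS]addr0 -(int01_gp a N) -[X in _ <= X + _]int01_cst.
  rewrite -int01D; [|exact: continuous_const|exact: continuous_mul].
  apply: le_int01; first exact: continuous_scale.
    apply: continuous_add; first exact: continuous_const.
    exact: continuous_mul.
  move=> t t01; have pN0 : 0 <= p a t ^+ N by exact: exprn_ge0.
  have rN0 : 0 <= r2 ^+ N by exact: exprn_ge0.
  have [ta|ta] := leP `|t - a| (2 * d).
    have := dp _ ta; nra.
  have : p a t ^+ N <= r2 ^+ N by rewrite lerXn2r ?nnegrE ?p_out.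
  by have := gB _ t01; rewrite ler_norml => /andP[]; nra.
have lower N : 2 * d * r1 ^+ N <= int01 (fun t => p a t ^+ N).
  rewrite (_ : 2 * d = (a + d) - (a - d)); last by ring.
  apply: int01_ge_subitv => //; rewrite ?exprn_ge0 ?(ltW r1_gt0) //; try lra.
    by move=> t _; rewrite exprn_ge0.
  move=> t /andP[t1 t2]; rewrite lerXn2r ?nnegrE ?(ltW r1_gt0) ?p_in //.
  by rewrite ler_norml; apply/andP; split; lra.
have key N : 2 * d * c <= (B + c) * (r2 / r1) ^+ N.
  rewrite expr_div_n [leRHS]mulrA ler_pdivlMr ?exprn_gt0 //.
  apply: le_trans (upper N); rewrite [leLHS](_ : _ = c * (2 * d * r1 ^+ N)); last by ring.
  by rewrite ler_wpM2l // ltW.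
have /cvg_expr : `|r2 / r1| < 1.
  by rewrite ger0_norm ?divr_ge0 ?(ltW r1_gt0) // ltr_pdivrMr // mul1r.
have e0 : 0 < 2 * d * c / (B + c + 1) by rewrite divr_gt0 ?mulr_gt0 //; lra.
move=> /cvgrPdist_lt/(_ _ e0) [N _ /(_ N (leqnn N))] /=.
rewrite sub0r normrN => hN.
have := key N; have := le_lt_trans (ler_norm _) hN; rewrite ltr_pdivlMr; last lra.
have : 0 <= (r2 / r1) ^+ N by rewrite exprn_ge0 // divr_ge0 // ltW.
move: (_ ^+ N) => y; have : 0 < d * c by rewrite mulr_gt0.
by move=> ?; nra.
Qed.

End UniquenessOneVariable.

Section ComplexContinuity.
Variables (R : realType) (T : topologicalType).
Implicit Types f g : T -> R[i].

Definition ccont f : Prop :=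
  continuous (fun t => complex.Re (f t)) /\ continuous (fun t => complex.Im (f t)).

Lemma ccont_cst c : ccont (fun=> c).
Proof. by split; exact: continuous_const. Qed.

Lemma ccontD f g : ccont f -> ccont g -> ccont (fun t => f t + g t).
Proof.
move=> [rf jf] [rg jg]; split; under eq_fun do rewrite ?ReD ?ImD; exact: continuous_add.
Qed.

Lemma ccontB f g : ccont f -> ccont g -> ccont (fun t => f t - g t).
Proof.
move=> [rf jf] [rg jg]; split; under eq_fun do rewrite ?ReB ?ImB; exact: continuous_sub.
Qed.

Lemma ccontM f g : ccont f -> ccont g -> ccont (fun t => f t * g t).
Proof.
move=> [rf jf] [rg jg]; split; under eq_fun do rewrite ?ReM ?ImM.
  by apply: continuous_sub; exact: continuous_mul.
by apply: continuous_add; exact: continuous_mul.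
Qed.

Lemma ccontZ c f : ccont f -> ccont (fun t => c * f t).
Proof. by apply: ccontM; exact: ccont_cst. Qed.

Lemma ccont_sum (I : Type) (r : seq I) (P : pred I) (F : I -> T -> R[i]) :
  (forall i, ccont (F i)) -> ccont (fun t => \sum_(i <- r | P i) F i t).
Proof.
move=> cF; elim: r => [|i r ih].
  have -> : (fun t => \sum_(i <- [::] | P i) F i t) = fun=> 0.
    by apply/funext => t; rewrite big_nil.
  exact: ccont_cst.
have -> : (fun t => \sum_(j <- i :: r | P j) F j t) =
    fun t => (if P i then F i t else 0) + \sum_(j <- r | P j) F j t.
  by apply/funext => t; rewrite big_cons; case: (P i); rewrite ?add0r.
by apply: ccontD => //; case: (P i) => //; exact: ccont_cst.
Qed.

Lemma continuous_cis (h : T -> R) : continuous h -> ccont (fun t => cis (h t)).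
Proof.
move=> ch; split.
  exact: (continuous_compose ch (@continuous_cos R)).
exact: (continuous_compose ch (@continuous_sin R)).
Qed.

(** The domination makes the convergence uniform in [t]. *)
Lemma ccont_clsum n (v : 'rV[int]_n -> T -> R[i]) b : summ b ->
  (forall k, ccont (v k)) -> (forall k t, normc (v k t) <= b k) ->
  ccont (fun t => clsum (fun k => v k t)).
Proof.
move=> sb cv vb.
have close e : 0 < e -> exists F : {fset 'rV[int]_n}, forall t,
    normc (clsum (fun k => v k t) - \sum_(k <- F) v k t) <= e.
  move=> e0; have [F hF] := clsum_tail sb e0; exists F => t.
  exact: (hF F (fsubset_refl _) (fun k => v k t)).
have lim (p : R[i] -> R) : (forall z w, p (z - w) = p z - p w) ->
    (forall z, `|p z| <= normc z) ->
    (forall F : {fset 'rV[int]_n}, continuous (fun t => p (\sum_(k <- F) v k t))) ->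
    continuous (fun t => p (clsum (fun k => v k t))).
  move=> pB pn cp t; apply/cvgrPdist_le => e e0.
  have e3 : 0 < e / 3 by rewrite divr_gt0.
  have [F hF] := close _ e3.
  have /cvgrPdist_le/(_ _ e3) := cp F t; apply: filterS => s hs.
  set A := clsum _; set B := clsum _.
  rewrite (_ : p A - p B = p (A - \sum_(k <- F) v k t) +
    (p (\sum_(k <- F) v k t) - p (\sum_(k <- F) v k s)) -
    p (B - \sum_(k <- F) v k s)); last by rewrite !pB; ring.
  rewrite (_ : e = e / 3 + e / 3 + e / 3); last by field.
  apply: le_trans (ler_normB _ _) _; apply: lerD; last exact: le_trans (pn _) (hF s).
  apply: le_trans (ler_normD _ _) _; apply: lerD => //; exact: le_trans (pn _) (hF t).
have cs (F : {fset 'rV[int]_n}) : ccont (fun t => \sum_(k <- F) v k t) by exact: ccont_sum.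
split; apply: lim => [z w|z|F].
- exact: ReB. - exact: normc_Re. - exact: (cs F).1.
- exact: ImB. - exact: normc_Im. - exact: (cs F).2.
Qed.

End ComplexContinuity.

Lemma ccont_comp (R : realType) (S T : topologicalType) (f : S -> T) (g : T -> R[i]) :
  continuous f -> ccont g -> ccont (fun s => g (f s)).
Proof.
by move=> cf [c1 c2]; split; [exact: (continuous_compose cf c1) | exact: (continuous_compose cf c2)].
Qed.

Section Characters.
Variable R : realType.

Lemma cis0 : cis (0 : R) = 1.
Proof. by rewrite /cis cos0 sin0. Qed.

Lemma cisD (s t : R) : cis (s + t) = cis s * cis t.
Proof. by rewrite /cis cosD sinD; congr Complex; rewrite addrC [cos s * _]mulrC mulrC. Qed.

Lemma normc_cis (t : R) : normc (cis t) = 1.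
Proof. by rewrite /= cos2Dsin2 sqrtr1. Qed.

Lemma cis_nat (m : nat) : cis (2 * pi * m%:R : R) = 1.
Proof.
elim: m => [|m ih]; first by rewrite mulr0 cis0.
rewrite -(natr1 m) mulrDr cisD ih mul1r mulr1 /cis.
by rewrite mulr_natl cos2pi sin2pi.
Qed.

Lemma cis_int (z : int) : cis (2 * pi * z%:~R : R) = 1.
Proof.
case: z => m; first exact: cis_nat.
rewrite NegzE mulrNz mulrN -pmulrn -[LHS]mulr1.
by rewrite -[X in _ * X = _](cis_nat m.+1) -cisD addNr cis0.
Qed.

Variable n : nat.
Implicit Types (k l : 'rV[int]_n) (x y : 'rV[R]_n).

Lemma ldotDl k l x : ldot (k + l) x = ldot k x + ldot l x.
Proof. by rewrite /ldot -big_split; apply: eq_bigr => j _; rewrite mxE intrD mulrDl. Qed.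

Lemma ldotNl k x : ldot (- k) x = - ldot k x.
Proof. by rewrite /ldot -sumrN; apply: eq_bigr => j _; rewrite mxE mulrNz mulNr. Qed.

Lemma ldotDr k x y : ldot k (x + y) = ldot k x + ldot k y.
Proof. by rewrite /ldot -big_split; apply: eq_bigr => j _; rewrite mxE mulrDr. Qed.

Lemma ldot_unitv k e j : ldot k (e *: unitv R j) = (k 0 j)%:~R * e.
Proof.
rewrite /ldot (bigD1 j) //= big1 ?addr0.
  by rewrite !mxE !eqxx mulr1.
by move=> i ij; rewrite !mxE /= (negbTE ij) mulr0 mulr0.
Qed.

Lemma continuous_ldot k : continuous (ldot k : 'rV[R]_n -> R).
Proof.
rewrite /ldot; elim: (index_enum _) => [|j r ih].
  under eq_fun do rewrite big_nil; exact: continuous_const.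
under eq_fun do rewrite big_cons.
by apply: continuous_add => //; apply: continuous_scale; exact: continuous_coord.
Qed.

Definition ek k x : R[i] := cis (2 * pi * ldot k x).

Lemma ekD k l x : ek (k + l) x = ek k x * ek l x.
Proof. by rewrite /ek ldotDl mulrDr cisD. Qed.

Lemma ek0 x : ek 0 x = 1.
Proof. by rewrite /ek /ldot big1 ?mulr0 ?cis0 // => j _; rewrite mxE mul0r. Qed.

Lemma ekN k x : cis (- (2 * pi * ldot k x)) = ek (- k) x.
Proof. by rewrite /ek ldotNl mulrN. Qed.

Lemma normc_ek k x : normc (ek k x) = 1.
Proof. exact: normc_cis. Qed.

Lemma ccont_ek k : ccont (ek k).
Proof. by apply: continuous_cis; apply: continuous_scale; exact: continuous_ldot. Qed.

Lemma ek_unitv k x j : ek k (x + unitv R j) = ek k x.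
Proof.
rewrite /ek ldotDr mulrDr cisD -[unitv R j]scale1r ldot_unitv mulr1.
by rewrite cis_int mulr1.
Qed.

Lemma fourierE (f : 'rV[int]_n -> R[i]) x :
  fourier f x = clsum (fun k => ek (- k) x * f k).
Proof. by rewrite /fourier; congr clsum; apply/funext => k; rewrite ekN. Qed.

End Characters.

Lemma ek_row_mx (R : realType) m (j : int) (l : 'rV[int]_m) (t : R) (y : 'rV[R]_m) :
  ek (row_mx j%:M l : 'rV_(1 + m)) (row_mx t%:M y : 'rV_(1 + m)) =
  cis (2 * pi * j%:~R * t) * ek l y.
Proof.
rewrite /ek -cisD; congr cis; rewrite /ldot big_split_ord /= big_ord1 mulrDr.
rewrite !row_mxEl !mxE !eqxx !mulr1n mulrA; congr (_ + _ * _).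
by apply: eq_bigr => i _; rewrite !row_mxEr.
Qed.

Section TorusIntegral.
Variable R : realType.

Lemma torus_intD n (f g : 'rV[R]_n -> R[i]) : ccont f -> ccont g ->
  torus_int (fun x => f x + g x) = torus_int f + torus_int g.
Proof.
move=> [rf jf] [rg jg]; rewrite /torus_int.
under eq_fun do rewrite ReD; under [X in Complex _ (cube_int X)]eq_fun do rewrite ImD.
by rewrite !cube_intD.
Qed.

Lemma torus_intZ n (c : R[i]) (f : 'rV[R]_n -> R[i]) : ccont f ->
  torus_int (fun x => c * f x) = c * torus_int f.
Proof.
move=> [rf jf]; case: c => a b; rewrite /torus_int.
have -> : (fun x => complex.Re (Complex a b * f x)) =
    fun x => a * complex.Re (f x) + - b * complex.Im (f x).
  by apply/funext => x; rewrite ReM /= mulNr.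
have -> : (fun x => complex.Im (Complex a b * f x)) =
    fun x => a * complex.Im (f x) + b * complex.Re (f x).
  by apply/funext => x; rewrite ImM.
rewrite !cube_intD ?cube_intZ //; try exact: continuous_scale.
by congr Complex; rewrite mulNr.
Qed.

Lemma torus_intB n (f g : 'rV[R]_n -> R[i]) : ccont f -> ccont g ->
  torus_int (fun x => f x - g x) = torus_int f - torus_int g.
Proof.
move=> cf cg; rewrite -[in RHS]mulN1r -torus_intZ // -torus_intD //; last exact: ccontZ.
by congr torus_int; apply/funext => x; rewrite mulN1r.
Qed.

Lemma torus_int_norm_le n (f : 'rV[R]_n -> R[i]) B : ccont f ->
  (forall x, normc (f x) <= B) -> normc (torus_int f) <= 2 * B.
Proof.
move=> [rf jf] fB; apply: le_trans (normc_le_ReIm _) _ => /=.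
rewrite mulr_natl mulr2n; apply: lerD; apply: cube_int_norm_le => // x.
  exact: le_trans (normc_Re _) (fB x).
exact: le_trans (normc_Im _) (fB x).
Qed.

Lemma torus_int_cst n (c : R[i]) : torus_int (fun _ : 'rV[R]_n => c) = c.
Proof. by case: c => a b; rewrite /torus_int !cube_int_cst. Qed.

(** The vanishing for [j] and [- j] separates the cosines from the sines and
    the real part from the imaginary part. *)
Lemma fourier_uniq_line (U : R -> R[i]) : ccont U -> (forall t, U (t + 1) = U t) ->
  (forall j : int, int01 (fun t => complex.Re (cis (2 * pi * j%:~R * t) * U t)) = 0 /\
     int01 (fun t => complex.Im (cis (2 * pi * j%:~R * t) * U t)) = 0) ->
  forall t, U t = 0.
Proof.
move=> [cr ci] pU hU.
pose cosj (j : int) (t : R) := cos (2 * pi * j%:~R * t).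
pose sinj (j : int) (t : R) := sin (2 * pi * j%:~R * t).
have dil (f : R -> R) (c : R) : continuous f -> continuous (fun t => f (c * t)).
  move=> cf; apply: continuous_compose cf; apply: continuous_scale; exact: continuous_ident.
have ccos j : continuous (cosj j) by exact: dil (@continuous_cos R).
have csin j : continuous (sinj j) by exact: dil (@continuous_sin R).
have e (j : int) : [/\ int01 (fun t => complex.Re (U t) * cosj j t) = 0,
   int01 (fun t => complex.Re (U t) * sinj j t) = 0,
   int01 (fun t => complex.Im (U t) * cosj j t) = 0 &
   int01 (fun t => complex.Im (U t) * sinj j t) = 0].
  have cN t : cosj (- j) t = cosj j t by rewrite /cosj mulrNz mulrN mulNr cosN.
  have sN t : sinj (- j) t = - sinj j t by rewrite /sinj mulrNz mulrN mulNr sinN.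
  have expand i : int01 (fun t => complex.Re (U t) * cosj i t) -
        int01 (fun t => complex.Im (U t) * sinj i t) = 0 /\
      int01 (fun t => complex.Im (U t) * cosj i t) +
        int01 (fun t => complex.Re (U t) * sinj i t) = 0.
    have [h1 h2] := hU i; rewrite -int01B -?int01D; try exact: continuous_mul.
    split; [rewrite -[RHS]h1 | rewrite -[RHS]h2]; congr int01; apply/funext => t.
      by rewrite ReM /= /cosj /sinj mulrC [complex.Im _ * _]mulrC.
    by rewrite ImM /= /cosj /sinj mulrC [complex.Re _ * _]mulrC.
  have neg (f : R -> R) : continuous f ->
      int01 (fun t => f t * sinj (- j) t) = - int01 (fun t => f t * sinj j t).
    move=> cf; rewrite -[RHS]mulN1r -int01Z; last exact: continuous_mul.
    by congr int01; apply/funext => t; rewrite sN; ring.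
  have even (f : R -> R) : int01 (fun t => f t * cosj (- j) t) = int01 (fun t => f t * cosj j t).
    by congr int01; apply/funext => t; rewrite cN.
  have [a1 a2] := expand j; have [b1 b2] := expand (- j).
  rewrite !neg // !even in b1 b2; split; lra.
have zero (g : R -> R) : continuous g -> (forall t, g (t + 1) = g t) ->
    (forall j, int01 (fun t => g t * cosj j t) = 0) ->
    (forall j, int01 (fun t => g t * sinj j t) = 0) -> forall t, g t = 0.
  move=> cg pg gc gs.
  have in01 a : 0 < a < 1 -> g a = 0.
    move=> a01; apply/eqP; rewrite eq_le (fourier_uniq_pos cg gc gs a01) /=.
    rewrite -oppr_le0.
    apply: (@fourier_uniq_pos _ (fun t => - g t)) a01.
    - by move=> t; apply: cvgN; exact: cg.
    - by move=> j; rewrite -[RHS]oppr0 -(gc j) -int01N; [congr int01; apply/funext => t; rewrite mulNr | exact: continuous_mul].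
    - by move=> j; rewrite -[RHS]oppr0 -(gs j) -int01N; [congr int01; apply/funext => t; rewrite mulNr | exact: continuous_mul].
  have at0 : g 0 = 0.
    apply/eqP; rewrite -normr_le0; apply/ler_addgt0Pr => e0 e0_gt0; rewrite add0r.
    have /cvgrPdist_le/(_ _ e0_gt0)/nbhs_ballP[d /= d0 hd] := @cg 0.
    pose a := Num.min (d / 2) (1 / 2) : R.
    have a01 : 0 < a < 1.
      apply/andP; split; first by rewrite lt_min; apply/andP; split; lra.
      by rewrite gt_min; apply/orP; right; lra.
    have /hd : ball 0 d a.
      rewrite /ball /= sub0r normrN gtr0_norm; last by case/andP: a01.
      by rewrite /a gt_min; apply/orP; left; lra.
    by rewrite /= (in01 _ a01) subr0.
  have nat_per m t : g (t + m%:R) = g t.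
    by elim: m => [|m ih]; rewrite ?addr0 // -(natr1 m) addrA pg.
  have int_per (z : int) t : g (t + z%:~R) = g t.
    case: z => m; first exact: nat_per.
    by rewrite NegzE mulrNz -pmulrn -[LHS](nat_per m.+1) subrK.
  move=> t; rewrite -(int_per (- Num.floor t)) mulrNz.
  have /andP[f1 f2] := floor_itv t.
  have [tf|ne] := eqVneq t (Num.floor t)%:~R; first by rewrite {1}tf subrr.
  by apply: in01; rewrite subr_gt0 ltrBlDl lt_neqAle eq_sym ne f1 /=; move: f2; rewrite intrD.
move=> t; rewrite (complexE (U t)).
rewrite (zero (fun t => complex.Re (U t))) ?(zero (fun t => complex.Im (U t))) //.
all: by move=> s; rewrite ?pU //; case: (e s).
Qed.

(** Integrating against a character in all variables but the first leaves a
    function of one variable with vanishing coefficients; hence every slice has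
    vanishing coefficients on a torus of smaller dimension. *)
Lemma fourier_uniq n (u : 'rV[R]_n -> R[i]) : ccont u -> periodic_torus u ->
  (forall l, torus_int (fun x => ek l x * u x) = 0) -> forall x, u x = 0.
Proof.
elim: n u => [|m ih] u cu pu hu x.
  have := hu 0; under eq_fun do rewrite ek0 mul1r.
  by rewrite /torus_int /= -complexE (_ : x = 0) // thinmx0.
pose u' (t : R) (y : 'rV[R]_m) : R[i] := u (row_mx t%:M y).
have cu2 : ccont (fun z : R * 'rV[R]_m => u' z.1 z.2).
  apply: (ccont_comp _ cu).
  by apply: continuous_consmx; [exact: continuous_fst | exact: continuous_snd].
have cu' t : ccont (u' t).
  apply: (ccont_comp _ cu).
  by apply: continuous_consmx; [exact: continuous_const | exact: continuous_ident].
have zero t : forall y, u' t y = 0.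
  apply: ih => //.
    move=> j y; rewrite /u' -[RHS](pu (rshift 1 j)); congr u.
    by rewrite [RHS]addrC -[X in _ = X + _]scale1r row_mx_unitvS scale1r addrC.
  move=> l.
  pose U s := torus_int (fun y => ek l y * u' s y).
  suff : forall s, U s = 0 by exact.
  have cU2 : ccont (fun z : R * 'rV[R]_m => ek l z.2 * u' z.1 z.2).
    apply: ccontM => //.
    exact: (@ccont_comp R (R * 'rV[R]_m)%type _ snd _ (@continuous_snd _ _) (ccont_ek R l)).
  apply: fourier_uniq_line.
  - by case: cU2 => c1 c2; split; exact: cube_int_param.
  - move=> s; congr torus_int; apply/funext => y; congr (_ * _).
    rewrite /u' -[RHS](pu (@lshift 1 m 0)); congr u.
    by rewrite [RHS]addrC -[X in _ = X + _]scale1r row_mx_unitv0 addrC.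
  move=> j.
  have := hu (row_mx j%:M l : 'rV_(1 + m)).
  have slice s : (fun y => ek (row_mx j%:M l : 'rV_(1 + m)) (row_mx s%:M y : 'rV_(1 + m)) * u' s y)
      = fun y => cis (2 * pi * j%:~R * s) * (ek l y * u' s y).
    by apply/funext => y; rewrite ek_row_mx mulrA.
  have cl s : ccont (fun y => ek l y * u' s y) by apply: ccontM => //; exact: ccont_ek.
  have eU s : cis (2 * pi * j%:~R * s) * U s = torus_int (fun y =>
      ek (row_mx j%:M l : 'rV_(1 + m)) (row_mx s%:M y : 'rV_(1 + m)) * u' s y).
    by rewrite slice torus_intZ.
  rewrite /torus_int !cube_intS => -[hr hi].
  by split; [rewrite -[RHS]hr | rewrite -[RHS]hi]; congr int01; apply/funext => s; rewrite eU.
have -> : x = row_mx (x 0 (@lshift 1 m 0))%:M (rsubmx (x : 'rV_(1 + m))).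
  apply/rowP => i; case: (@split_ordP 1 m i) => k ->.
    by rewrite (@row_mxEl _ 1 1 m) mxE (ord1 k) eqxx mulr1n.
  by rewrite (@row_mxEr _ 1 1 m) mxE.
exact: zero.
Qed.

End TorusIntegral.

(** * Fourier series of rapidly decreasing coefficients *)

Section RapidDecay.
Variables (R : realType) (n : nat).
Local Notation Zn := 'rV[int]_n.
Implicit Types (c : Zn -> R[i]) (k l : Zn).

Definition rapid c : Prop :=
  forall L, exists2 C : R, 0 <= C & forall k, normc (c k) <= C * jp R k ^- L.

Lemma rapidP c : rapidly_decreasing c <-> rapid c.
Proof.
split=> h L.
  have [C hC] := h L; exists (`|C| * (1 + n%:R) ^+ L) => [|k].
    by rewrite mulr_ge0 // exprn_ge0 // addr_ge0.
  rewrite ler_pdivlMr ?jp_exp_gt0 // mulrC.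
  apply: (@le_trans _ _ (((1 + n%:R) * (1 + lnorm R k)) ^+ L * normc (c k))).
    rewrite ler_wpM2r ?normc_ge0 // lerXn2r ?nnegrE ?jp_ge0 ?jp_le_lnorm //.
    by rewrite mulr_ge0 ?addr_ge0 ?lnorm_ge0.
  rewrite exprMn -mulrA mulrC ler_wpM2r ?exprn_ge0 ?addr_ge0 //.
  exact: le_trans (hC k) (ler_norm _).
have [C C0 hC] := h L; exists C => k.
rewrite mulrC -ler_pdivlMr ?exprn_gt0 ?ltr_wpDr ?lnorm_ge0 //.
apply: le_trans (hC k) _; rewrite ler_wpM2l // lef_pV2 ?posrE ?jp_exp_gt0 //.
  by rewrite lerXn2r ?nnegrE ?jp_ge0 ?addr_ge0 ?lnorm_ge0 // lnorm_le_jp.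
by rewrite exprn_gt0 // ltr_wpDr ?lnorm_ge0.
Qed.

Lemma jp_exp_split k M L : jp R k ^+ M * jp R k ^- (M + L) = jp R k ^- L.
Proof. by rewrite exprD invfM mulrA divff ?mul1r // gt_eqF // jp_exp_gt0. Qed.

Lemma rapid_mul c (p : Zn -> R[i]) M B : (forall k, normc (p k) <= B * jp R k ^+ M) ->
  rapid c -> rapid (fun k => p k * c k).
Proof.
move=> hp hc L; have [C C0 hC] := hc (M + L)%N.
have B0 : 0 <= B.
  by have := le_trans (normc_ge0 _) (hp 0); rewrite pmulr_lge0 ?jp_exp_gt0.
exists (B * C) => [|k]; first by rewrite mulr_ge0.
rewrite Normc.normcM -(jp_exp_split k M L) mulrACA.
by apply: ler_pM; rewrite ?normc_ge0.
Qed.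

Lemma rapidZ a c : rapid c -> rapid (fun k => a * c k).
Proof. by apply: (@rapid_mul _ _ 0 (normc a)) => k; rewrite expr0 mulr1. Qed.

Lemma rapidD c d : rapid c -> rapid d -> rapid (fun k => c k + d k).
Proof.
move=> hc hd L; have [C C0 hC] := hc L; have [D D0 hD] := hd L.
exists (C + D) => [|k]; first exact: addr_ge0.
by rewrite mulrDl; apply: le_trans (normcD_le _ _) (lerD _ _).
Qed.

Lemma rapidB c d : rapid c -> rapid d -> rapid (fun k => c k - d k).
Proof.
move=> hc hd; rewrite (_ : (fun k => _) = fun k => c k + (-1) * d k).
  by apply: rapidD => //; exact: rapidZ.
by apply/funext => k; rewrite mulN1r.
Qed.

Lemma rapid_summ c : rapid c ->
  exists2 b : Zn -> R, summ b & forall k, normc (c k) <= b k.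
Proof.
move=> /(_ n.*2)[C C0 hC]; exists (fun k => C * jp R k ^- n.*2) => //.
by apply: summZ => //; exact: summ_jp.
Qed.

Lemma rapid_dominated c x : rapid c -> dominated (fun k => ek (- k) x * c k).
Proof.
by move=> /rapid_summ[b sb hb]; exists b => // k; rewrite Normc.normcM normc_ek mul1r.
Qed.

Lemma rapid_single k0 (a : R[i]) : rapid (fun k => if k == k0 then a else 0).
Proof.
move=> L; exists (normc a * jp R k0 ^+ L) => [|k].
  by rewrite mulr_ge0 ?normc_ge0 // ltW ?jp_exp_gt0.
case: eqP => [->|_]; first by rewrite mulfK // gt_eqF // jp_exp_gt0.
by rewrite Normc.normc0 !mulr_ge0 ?normc_ge0 ?invr_ge0 // ltW ?jp_exp_gt0.
Qed.

Lemma ccont_fourier c : rapid c -> ccont (fourier c : 'rV[R]_n -> R[i]).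
Proof.
move=> /rapid_summ[b sb hb].
rewrite (_ : fourier c = fun x => clsum (fun k => ek (- k) x * c k)); last first.
  by apply/funext => x; rewrite fourierE.
apply: (ccont_clsum sb) => [k|k x].
  by apply: ccontM; [exact: ccont_ek | exact: ccont_cst].
by rewrite Normc.normcM normc_ek mul1r.
Qed.

Lemma fourier_periodic c : periodic_torus (fourier c : 'rV[R]_n -> R[i]).
Proof.
move=> j x; rewrite !fourierE; congr clsum; apply/funext => k.
by rewrite ek_unitv.
Qed.

Lemma fourierD c d x : rapid c -> rapid d ->
  fourier (fun k => c k + d k) x = fourier c x + fourier d x.
Proof.
move=> hc hd; rewrite !fourierE -clsumD; try exact: rapid_dominated.
by congr clsum; apply/funext => k; rewrite mulrDr.
Qed.

Lemma fourierZ a c x : rapid c -> fourier (fun k => a * c k) x = a * fourier c x.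
Proof.
move=> hc; rewrite !fourierE -clsumZ; last exact: rapid_dominated.
by congr clsum; apply/funext => k; rewrite mulrCA.
Qed.

Lemma fourierB c d x : rapid c -> rapid d ->
  fourier (fun k => c k - d k) x = fourier c x - fourier d x.
Proof.
move=> hc hd; rewrite !fourierE -clsumB; try exact: rapid_dominated.
by congr clsum; apply/funext => k; rewrite mulrBr.
Qed.

End RapidDecay.

Lemma cis_taylor (R : realType) (t : R) : normc (cis t - 1 - Complex 0 t) <= 2 * t ^+ 2.
Proof.
have sinle s : `|sin s| <= `|s| :> R.
  wlog s0 : s / 0 <= s.
    move=> H; have [/H//|s0] := leP 0 s.
    by have := H (- s); rewrite sinN !normrN; apply; rewrite oppr_ge0 ltW.
  have [|x _] := @MVT_segment R sin cos 0 s s0 (fun x _ => is_derive_sin x).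
    by apply: continuous_subspaceT => x; exact: continuous_sin.
  rewrite sin0 !subr0 => ->; rewrite normrM ler_piMl // ?normr_ge0 //; exact: cos_max.
have cosle s : `|cos s - 1| <= s ^+ 2 :> R.
  wlog s0 : s / 0 <= s.
    move=> H; have [/H//|s0] := leP 0 s.
    by have := H (- s); rewrite cosN sqrrN; apply; rewrite oppr_ge0 ltW.
  have [|x x0s] := @MVT_segment R cos (fun x => - sin x) 0 s s0 (fun x _ => is_derive_cos x).
    by apply: continuous_subspaceT => x; exact: continuous_cos.
  rewrite cos0 subr0 => ->; rewrite normrM normrN expr2 (ger0_norm s0) ler_wpM2r //.
  apply: le_trans (sinle x) _; move: x0s; rewrite in_itv /= => /andP[x0 xs].
  by rewrite ger0_norm.
have cosle1 s : `|cos s - 1| <= `|s| :> R.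
  wlog s0 : s / 0 <= s.
    move=> H; have [/H//|s0] := leP 0 s.
    by have := H (- s); rewrite cosN normrN; apply; rewrite oppr_ge0 ltW.
  have [|x x0s] := @MVT_segment R cos (fun x => - sin x) 0 s s0 (fun x _ => is_derive_cos x).
    by apply: continuous_subspaceT => x; exact: continuous_cos.
  by rewrite cos0 subr0 => ->; rewrite normrM normrN ler_piMl // ?normr_ge0 // sin_max.
have sinle2 s : `|sin s - s| <= s ^+ 2 :> R.
  wlog s0 : s / 0 <= s.
    move=> H; have [/H//|s0] := leP 0 s.
    have := H (- s); rewrite sinN sqrrN -opprD normrN; apply; rewrite oppr_ge0 ltW //.
  have dd (x : R) : x \in `]0, s[ -> is_derive x (1 : R) (fun x => sin x - x) (cos x - 1).
    by move=> _; apply: is_derive_eq.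
  have [|x x0s] := @MVT_segment R (fun x => sin x - x) (fun x => cos x - 1) 0 s s0 dd.
    apply: continuous_subspaceT => x; apply: cvgB; [exact: continuous_sin | exact: cvg_id].
  rewrite sin0 !subr0 => ->; rewrite normrM expr2 (ger0_norm s0) ler_wpM2r //.
  apply: le_trans (cosle1 x) _; move: x0s; rewrite in_itv /= => /andP[x0 xs].
  by rewrite ger0_norm.
apply: le_trans (normc_le_ReIm _) _; rewrite /= subr0 oppr0 addr0 mulr_natl mulr2n.
exact: lerD.
Qed.

Section Derivatives.
Variables (R : realType) (n : nat).
Implicit Types (j : 'I_n) (h f g : 'rV[R]_n -> R[i]) (x : 'rV[R]_n).

Definition cderiv j h x (d : R[i]) : Prop :=
  is_derive x (unitv R j) (fun y => complex.Re (h y)) (complex.Re d) /\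
  is_derive x (unitv R j) (fun y => complex.Im (h y)) (complex.Im d).

Lemma cderiv_cpartial j h x d : cderiv j h x d -> cpartial j h x = d.
Proof.
by move=> [[_ r] [_ i]]; rewrite /cpartial /partial r i -complexE.
Qed.

Lemma torus_smooth_cderiv j h x : torus_smooth h -> cderiv j h x (cpartial j h x).
Proof.
move=> [_ [hr hi]].
have [_ dr] := hr [::]; have [_ di] := hi [::].
by split; split => //=.
Qed.

Lemma cderivM j f g x df dg : cderiv j f x df -> cderiv j g x dg ->
  cderiv j (fun y => f y * g y) x (f x * dg + df * g x).
Proof.
move=> [fr fi] [gr gi]; split.
  rewrite (_ : (fun y => _) = (fun y => complex.Re (f y)) * (fun y => complex.Re (g y)) -
     (fun y => complex.Im (f y)) * (fun y => complex.Im (g y))); last first.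
    by apply/funext => y; rewrite ReM.
  apply: is_derive_eq; rewrite ReD !ReM /GRing.scale /=; ring.
rewrite (_ : (fun y => _) = (fun y => complex.Re (f y)) * (fun y => complex.Im (g y)) +
     (fun y => complex.Im (f y)) * (fun y => complex.Re (g y))); last first.
  by apply/funext => y; rewrite ImM.
apply: is_derive_eq; rewrite ImD !ImM /GRing.scale /=; ring.
Qed.

Lemma torus_int_cderiv j h d : ccont h -> periodic_torus h ->
  (forall x, cderiv j h x (d x)) -> ccont d -> torus_int d = 0.
Proof.
move=> [cr ci] ph dh [dr di]; rewrite /torus_int.
have er : (fun x => complex.Re (d x)) = partial j (fun x => complex.Re (h x)).
  by apply/funext => x; have [[_ <-] _] := dh x.
have ei : (fun x => complex.Im (d x)) = partial j (fun x => complex.Im (h x)).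
  by apply/funext => x; have [_ [_ <-]] := dh x.
rewrite er ei in dr di *; rewrite !cube_int_partial // => x; rewrite ?ph //.
  by have [_ []] := dh x.
by have [[]] := dh x.
Qed.

End Derivatives.

Section FourierSmooth.
Variables (R : realType) (n : nat).
Local Notation Zn := 'rV[int]_n.
Implicit Types (c : Zn -> R[i]) (j : 'I_n).

Definition dcoef j c (k : Zn) : R[i] := Complex 0 (- (2 * pi * (k 0 j)%:~R)) * c k.

Lemma rapid_dcoef j c : rapid c -> rapid (dcoef j c).
Proof.
apply: (@rapid_mul _ _ _ _ 1 (2 * pi)) => k; rewrite expr1.
apply: le_trans (normc_le_ReIm _) _; rewrite /= normr0 add0r normrN normrM.
by rewrite ger0_norm ?mulr_ge0 ?pi_ge0 // ler_wpM2l ?mulr_ge0 ?pi_ge0 // jp_coord.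
Qed.

(** Termwise differentiation: the error is quadratic in the increment,
    uniformly summable over the lattice. *)
Lemma cderiv_fourier j c x : rapid c ->
  cderiv j (fourier c) x (fourier (dcoef j c) x).
Proof.
move=> hc.
have [K K0 hK] : exists2 K : R, 0 <= K & forall e : R,
    normc (fourier c (e *: unitv R j + x) - fourier c x -
      Complex e 0 * fourier (dcoef j c) x) <= e ^+ 2 * K.
  have [C C0 hC] := hc (2 + n.*2)%N.
  have [_ [S hS]] := summ_jp R (leqnn n.*2).
  have S0 : 0 <= S by have := hS fset0; rewrite big_seq_fset0.
  exists (2 * (2 * pi) ^+ 2 * C * S) => [|e].
    by rewrite !mulr_ge0 ?exprn_ge0 ?mulr_ge0 ?pi_ge0.
  have d1 := rapid_dominated (e *: unitv R j + x) hc.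
  have d2 := rapid_dominated x hc.
  have d3 := dominatedZ (Complex e 0) (rapid_dominated x (rapid_dcoef j hc)).
  have d12 := dominatedD d1 (dominatedZ (-1) d2).
  have d12E : (fun k => ek (- k) (e *: unitv R j + x) * c k + -1 * (ek (- k) x * c k)) =
     fun k => ek (- k) (e *: unitv R j + x) * c k - ek (- k) x * c k.
    by apply/funext => k; rewrite mulN1r.
  rewrite d12E in d12.
  rewrite !fourierE -(clsumZ _ (rapid_dominated x (rapid_dcoef j hc))).
  rewrite -(clsumB d1 d2) -(clsumB d12 d3).
  have d := dominatedD d12 (dominatedZ (-1) d3).
  have dE : (fun k => ek (- k) (e *: unitv R j + x) * c k - ek (- k) x * c k +
      -1 * (Complex e 0 * (ek (- k) x * dcoef j c k))) =
     fun k => ek (- k) (e *: unitv R j + x) * c k - ek (- k) x * c k -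
      Complex e 0 * (ek (- k) x * dcoef j c k).
    by apply/funext => k; rewrite mulN1r.
  rewrite dE in d.
  apply: clsum_norm_le => // F.
  apply: (@le_trans _ _ (\sum_(k <- F) e ^+ 2 * (2 * (2 * pi) ^+ 2 * C) * jp R k ^- n.*2)); last first.
    rewrite -mulr_sumr -[leLHS]mulrA; apply: ler_wpM2l; first exact: sqr_ge0.
    by apply: ler_wpM2l => //; rewrite !mulr_ge0 ?exprn_ge0 ?mulr_ge0 ?pi_ge0.
  apply: ler_sum => k _.
  pose t : R := - (2 * pi * (k 0 j)%:~R * e).
  have -> : ek (- k) (e *: unitv R j + x) * c k - ek (- k) x * c k -
      Complex e 0 * (ek (- k) x * dcoef j c k) =
      ek (- k) x * c k * (cis t - 1 - Complex 0 t).
    have -> : ek (- k) (e *: unitv R j + x) = cis t * ek (- k) x.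
      rewrite /ek ldotDr mulrDr cisD ldot_unitv /t; congr (cis _ * _).
      by rewrite mxE mulrNz mulNr mulrN mulrA.
    have -> : Complex 0 t = Complex e 0 * Complex 0 (- (2 * pi * (k 0 j)%:~R)).
      by rewrite /t; congr Complex; ring.
    by rewrite /dcoef; ring.
  rewrite !Normc.normcM normc_ek mul1r.
  apply: le_trans (ler_wpM2l (normc_ge0 _) (cis_taylor t)) _.
  apply: le_trans (_ : normc (c k) * (2 * ((2 * pi) ^+ 2 * jp R k ^+ 2 * e ^+ 2)) <= _).
    have kj : (k 0 j)%:~R ^+ 2 <= jp R k ^+ 2.
      by rewrite -real_normK ?num_real // lerXn2r ?nnegrE ?jp_ge0 ?jp_coord.
    rewrite (_ : t ^+ 2 = (2 * pi) ^+ 2 * (k 0 j)%:~R ^+ 2 * e ^+ 2); last by rewrite /t; ring.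
    apply: ler_wpM2l; first exact: normc_ge0.
    apply: ler_wpM2l => //; apply: ler_wpM2r; first exact: sqr_ge0.
    by apply: ler_wpM2l => //; exact: sqr_ge0.
  apply: le_trans (ler_wpM2r _ (hC k)) _.
    by apply: mulr_ge0 => //; apply: mulr_ge0 (sqr_ge0 _); apply: mulr_ge0; exact: sqr_ge0.
  rewrite -(jp_exp_split R k 2 n.*2) le_eqVlt; apply/orP; left; apply/eqP; ring.
have part (p : R[i] -> R) : (forall z w, p (z - w) = p z - p w) ->
    (forall z (e : R), p (Complex e 0 * z) = e * p z) -> (forall z, `|p z| <= normc z) ->
    is_derive x (unitv R j) (fun y => p (fourier c y)) (p (fourier (dcoef j c) x)).
  move=> pB pZ pn; apply: is_derive_cvg; apply/cvgrPdist_le => eps eps0.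
  near=> e.
  have e0 : e != 0 by near: e; exact: nbhs_dnbhs_neq.
  have eK : `|e| * K <= eps.
    have eK1 : `|e| <= eps / (K + 1).
      near: e; apply: nbhs_dnbhs; apply/nbhs_ballP; exists (eps / (K + 1)) => /=.
        by rewrite divr_gt0 // ltr_wpDl.
      by move=> y; rewrite /ball /= sub0r normrN => /ltW.
    apply: le_trans (ler_wpM2r K0 eK1) _.
    by rewrite mulrAC ler_pdivrMr ?ltr_wpDl // ler_pM2l // lerDl.
  have -> : p (fourier (dcoef j c) x) -
      e^-1 * (p (fourier c (e *: unitv R j + x)) - p (fourier c x)) =
    - (e^-1 * p (fourier c (e *: unitv R j + x) - fourier c x -
      Complex e 0 * fourier (dcoef j c) x)).
    by rewrite !pB pZ; field.
  rewrite normrN normrM normfV ler_pdivrMl ?normr_gt0 //.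
  apply: le_trans (pn _) _; apply: le_trans (hK e) _.
  rewrite -(real_normK (num_real e)) expr2 -mulrA ler_wpM2l //.
split; apply: part.
- exact: ReB. - by move=> [a b] e /=; rewrite mul0r subr0. - exact: normc_Re.
- exact: ImB. - by move=> [a b] e /=; rewrite mul0r addr0. - exact: normc_Im.
Unshelve. all: by end_near. Qed.

Lemma fourier_torus_smooth c : rapid c -> torus_smooth (fourier c : 'rV[R]_n -> R[i]).
Proof.
move=> hc; split; first exact: fourier_periodic.
have iter (s : seq 'I_n) : exists2 d, rapid d &
   foldr (@partial R n) (fun x => complex.Re (fourier c x)) s = (fun x => complex.Re (fourier d x)) /\
   foldr (@partial R n) (fun x => complex.Im (fourier c x)) s = (fun x => complex.Im (fourier d x)).
  elim: s => [|j s [d hd [er ei]]]; first by exists c.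
  exists (dcoef j d); first exact: rapid_dcoef.
  rewrite /= er ei; split; apply/funext => x; rewrite /partial.
    by have [[_ ->] _] := cderiv_fourier j x hd.
  by have [_ [_ ->]] := cderiv_fourier j x hd.
split=> s /=; have [d hd [er ei]] := iter s; have [c1 c2] := ccont_fourier hd.
  by rewrite er; split => // j x; have [[]] := cderiv_fourier j x hd.
by rewrite ei; split => // j x; have [_ []] := cderiv_fourier j x hd.
Qed.

Definition fall (x : R[i]) (m : nat) : R[i] := \prod_(i < m) (x - i%:R).

(** The factor by which D_x^(b) multiplies the character e_k. *)
Definition fallmx (b : 'I_n -> nat) (k : Zn) : R[i] :=
  \prod_j fall ((k 0 j)%:~R) (b j).

Lemma normc_prod (I : Type) (r : seq I) (P : pred I) (F : I -> R[i]) :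
  normc (\prod_(i <- r | P i) F i) = \prod_(i <- r | P i) normc (F i).
Proof. by elim/big_rec2: _ => [|i x y _ h]; rewrite ?Normc.normc1 // Normc.normcM h. Qed.

Lemma fall_norm_le j (k : Zn) m :
  normc (fall ((k 0 j)%:~R) m) <= (1 + m%:R) ^+ m * jp R k ^+ m.
Proof.
rewrite /fall normc_prod -exprMn -[X in _ ^+ X]card_ord -prodr_const.
apply: ler_prod => i _; rewrite normc_ge0 /=.
apply: le_trans (normcB_le _ _) _; rewrite normc_int normc_nat.
have := jp_coord R k j; rewrite -intr_norm; have := jp_ge1 R k.
have : (i%:R : R) <= m%:R by rewrite ler_nat ltnW.
have : 0 <= (m%:R : R) by []; have : 0 <= (i%:R : R) by [].
move: (m%:R : R) (i%:R : R) (jp R k) => M I J; nra.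
Qed.

Lemma fallmx_norm_le b : exists2 B : R, 0 <= B &
  forall k, normc (fallmx b k) <= B * jp R k ^+ mi_size b.
Proof.
exists (\prod_j (1 + (b j)%:R) ^+ b j) => [|k].
  by apply: prodr_ge0 => j _; rewrite exprn_ge0 // addr_ge0.
rewrite /fallmx normc_prod /mi_size expr_sum -big_split /=.
by apply: ler_prod => j _; rewrite normc_ge0 fall_norm_le.
Qed.

Lemma fallS x m : fall x m.+1 = fall x m * (x - m%:R).
Proof. by rewrite /fall big_ord_recr. Qed.

Lemma fallmxE b k : fallmx b k = \prod_(j <- enum 'I_n) fall ((k 0 j)%:~R) (b j).
Proof. by rewrite /fallmx big_enum. Qed.

Lemma mulr_2pii (a : R) : (Complex 0 (2 * pi))^-1 * Complex 0 (2 * pi * a) = Complex a 0 :> R[i].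
Proof.
have pi0 : Complex 0 (2 * pi) != 0 :> R[i].
  by rewrite eq_complex /= eqxx /= mulf_neq0 // gt_eqF // pi_gt0.
apply: (mulfI pi0); rewrite mulrA divff // mul1r.
by apply/eqP; rewrite eq_complex /=; apply/andP; split; apply/eqP; ring.
Qed.

Lemma complex_intr (z : int) : (z%:~R : R[i]) = Complex z%:~R 0.
Proof.
have nat_case m : (m%:R : R[i]) = Complex m%:R 0.
  elim: m => [//|m ih]; rewrite -[in LHS](natr1 m) ih -(natr1 m).
  by apply/eqP; rewrite eq_complex /= addr0 !eqxx.
case: z => m; first exact: nat_case.
rewrite NegzE !mulrNz -pmulrn nat_case.
by apply/eqP; rewrite eq_complex /= oppr0 !eqxx.
Qed.

Lemma Dx1_fourier j m c : rapid c ->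
  Dx1 j m (fourier c) = (fourier (fun k => fall (((- k) 0 j)%:~R) m * c k) : 'rV[R]_n -> R[i]).
Proof.
move=> hc.
have hr i : rapid (fun k => fall (((- k) 0 j)%:~R) i * c k).
  apply: (@rapid_mul _ _ _ _ i ((1 + i%:R) ^+ i)) hc => k.
  by rewrite -(jpN R k) fall_norm_le.
elim: m => [|m ih] /=.
  by congr fourier; apply/funext => k; rewrite /fall big_ord0 mul1r.
apply/funext => x; rewrite ih (cderiv_cpartial (cderiv_fourier j x (hr m))).
rewrite -(fourierZ _ x (rapid_dcoef j (hr m))) -(fourierZ _ x (hr m)).
rewrite -(fourierB x (rapidZ _ (rapid_dcoef j (hr m))) (rapidZ _ (hr m))).
congr (fourier _ x); apply/funext => k; rewrite fallS /dcoef mxE.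
have e : (Complex 0 (2 * pi))^-1 * Complex 0 (- (2 * pi * (k 0 j)%:~R)) = (- k 0 j)%:~R :> R[i].
  by rewrite -mulrN mulr_2pii -mulrNz complex_intr.
by rewrite mulrA e; ring.
Qed.

Lemma Dx_fourier b c : rapid c ->
  Dx b (fourier c) = (fourier (fun k => fallmx b (- k) * c k) : 'rV[R]_n -> R[i]).
Proof.
move=> hc; rewrite /Dx /mi_iter.
suff [_ ->] : rapid (fun k => \prod_(j <- enum 'I_n) fall (((- k) 0 j)%:~R) (b j) * c k) /\
  foldr (fun j w => Dx1 j (b j) w) (fourier c) (enum 'I_n) = (fourier (fun k =>
    \prod_(j <- enum 'I_n) fall (((- k) 0 j)%:~R) (b j) * c k) : 'rV[R]_n -> R[i]).
  by congr fourier; apply/funext => k; rewrite fallmxE.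
elim: (enum 'I_n) => [|j s [ih1 ih2]] /=.
  by rewrite (_ : (fun k => _) = c) //; apply/funext => k; rewrite big_nil mul1r.
have e : (fun k : Zn => \prod_(i <- j :: s) fall (((- k) 0 i)%:~R) (b i) * c k) =
   fun k : Zn => fall (((- k) 0 j)%:~R) (b j) * (\prod_(i <- s) fall (((- k) 0 i)%:~R) (b i) * c k).
  by apply/funext => k; rewrite big_cons mulrA.
rewrite e ih2 Dx1_fourier //; split => //.
apply: (@rapid_mul _ _ _ _ (b j) ((1 + (b j)%:R) ^+ b j)) ih1 => k.
by rewrite -(jpN R k) fall_norm_le.
Qed.

Lemma ek_fourier l : (ek l : 'rV[R]_n -> R[i]) = fourier (fun k => if k == - l then 1 else 0).
Proof.
apply/funext => x; rewrite fourierE (@clsum_single _ _ _ (- l)).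
  by rewrite eqxx opprK mulr1.
by move=> k /negbTE ->; rewrite mulr0.
Qed.

Lemma cderiv_ek j l (x : 'rV[R]_n) : cderiv j (ek l) x (Complex 0 (2 * pi * (l 0 j)%:~R) * ek l x).
Proof.
have h := cderiv_fourier j x (rapid_single (- l) (1 : R[i])).
rewrite -ek_fourier in h; move: h; congr cderiv.
rewrite fourierE (@clsum_single _ _ _ (- l)).
  by rewrite /dcoef eqxx opprK mulr1 mxE mulrNz mulrN opprK mulrC.
by move=> k /negbTE kl; rewrite /dcoef kl !mulr0.
Qed.

(** Orthogonality: the integral of a nontrivial character, being a derivative,
    vanishes. *)
Lemma torus_int_ek l : torus_int (ek l : 'rV[R]_n -> R[i]) = if l == 0 then 1 else 0.
Proof.
case: eqP => [->|/eqP l0].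
  by rewrite (_ : ek 0 = fun=> 1) ?torus_int_cst //; apply/funext => x; rewrite ek0.
have [j lj] : exists j, l 0 j != 0.
  apply/existsP; apply: contraR l0; rewrite negb_exists => /forallP h.
  by apply/eqP/rowP => j; rewrite mxE; apply/eqP; rewrite -[_ == _]negbK h.
have c0 : Complex 0 (2 * pi * (l 0 j)%:~R) != 0 :> R[i].
  by rewrite eq_complex /= eqxx /= !mulf_neq0 ?intr_eq0 // gt_eqF // pi_gt0.
apply: (mulfI c0); rewrite mulr0 -torus_intZ; last exact: ccont_ek.
apply: (@torus_int_cderiv _ _ j (ek l)).
- exact: ccont_ek.
- by move=> i x; rewrite ek_unitv.
- by move=> x; exact: cderiv_ek.
- by apply: ccontZ; exact: ccont_ek.
Qed.

(** The sign is chosen so that [fourier] is the inverse transform. *)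
Definition coef (h : 'rV[R]_n -> R[i]) (l : Zn) : R[i] := torus_int (fun x => ek l x * h x).

Lemma torus_int_clsum (g : 'rV[R]_n -> R[i]) G (v : Zn -> 'rV[R]_n -> R[i]) (b : Zn -> R) :
  ccont g -> 0 <= G -> (forall x, normc (g x) <= G) -> summ b ->
  (forall k, ccont (v k)) -> (forall k x, normc (v k x) <= b k) ->
  torus_int (fun x => g x * clsum (fun k => v k x)) =
  clsum (fun k => torus_int (fun x => g x * v k x)).
Proof.
move=> cg G0 gG sb cv vb.
apply: (@clsum_exchange _ _ _ (@ccont R 'rV[R]_n) (fun w => torus_int (fun x => g x * w x))
  (2 * G) v b) => //.
- exact: ccont_cst.
- by move=> u w; exact: ccontB.
- move=> u w cu cw; rewrite -torus_intB; try exact: ccontM.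
  by congr torus_int; apply/funext => x; rewrite mulrBr.
- by rewrite mulr_ge0.
- move=> u B B0 cu uB; rewrite -mulrA; apply: torus_int_norm_le; first exact: ccontM.
  by move=> x; rewrite Normc.normcM ler_pM ?normc_ge0.
- exact: ccont_clsum cv vb.
Qed.

Lemma coef_fourier c l : rapid c -> coef (fourier c) l = c l.
Proof.
move=> hc; have [b sb hb] := rapid_summ hc.
rewrite /coef (_ : (fun x => _) = fun x => ek l x * clsum (fun k => ek (- k) x * c k)); last first.
  by apply/funext => x; rewrite fourierE.
rewrite (@torus_int_clsum _ 1 _ b) //.
- rewrite (@clsum_single _ _ _ l) => [|k kl].
    rewrite -[RHS](@torus_int_cst R n); congr torus_int; apply/funext => x.
    by rewrite mulrA -ekD subrr ek0 mul1r.
  rewrite (_ : (fun x => _) = fun x => c k * ek (l - k) x); last first.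
    by apply/funext => x; rewrite mulrA -ekD mulrC.
  rewrite torus_intZ ?torus_int_ek; last exact: ccont_ek.
  by rewrite subr_eq0 eq_sym (negbTE kl) mulr0.
- exact: ccont_ek.
- by move=> x; rewrite normc_ek.
- by move=> k; apply: ccontM; [exact: ccont_ek | exact: ccont_cst].
- by move=> k x; rewrite Normc.normcM normc_ek mul1r.
Qed.

Lemma torus_smooth_ccont h : torus_smooth h -> ccont (h : 'rV[R]_n -> R[i]).
Proof. by move=> [_ [hr hi]]; split; [case: (hr [::]) | case: (hi [::])]. Qed.

(** Both sides are continuous and have the same coefficients. *)
Lemma fourier_inversion h : torus_smooth h -> rapid (coef h) -> fourier (coef h) = h.
Proof.
move=> sh hc; apply/funext => x; apply/esym/eqP; rewrite -subr_eq0; apply/eqP.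
have cf := ccont_fourier hc; have ch := torus_smooth_ccont sh.
apply: (@fourier_uniq _ _ (fun x => h x - fourier (coef h) x)).
- exact: ccontB.
- by move=> j y; rewrite (sh.1 j) fourier_periodic.
- move=> l; have ce := @ccont_ek R n l.
  transitivity (coef h l - coef (fourier (coef h)) l); last by rewrite coef_fourier ?subrr.
  rewrite /coef -torus_intB; try exact: ccontM.
  by congr torus_int; apply/funext => y; rewrite mulrBr.
Qed.

Lemma coef_cpartial j h l : torus_smooth h -> ccont (cpartial j h) ->
  coef (cpartial j h) l = - (Complex 0 (2 * pi * (l 0 j)%:~R) * coef h l).
Proof.
move=> sh cdh; have ch := torus_smooth_ccont sh; have ce := @ccont_ek R n l.
have ceh : ccont (fun x => ek l x * h x) by exact: ccontM.
apply/eqP; rewrite -subr_eq0 opprK; apply/eqP; rewrite /coef -torus_intZ //.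
rewrite -torus_intD; [|exact: ccontM|exact: ccontZ].
apply: (@torus_int_cderiv _ _ j (fun x => ek l x * h x)) => //.
- by move=> i x; rewrite ek_unitv (sh.1 i).
- move=> x; rewrite mulrA; apply: cderivM (cderiv_ek j l x) _.
  exact: torus_smooth_cderiv.
- by apply: ccontD; [exact: ccontM | exact: ccontZ].
Qed.

End FourierSmooth.

(** * Fourier coefficients of derivatives of smooth functions *)

Section CoefficientsOfDerivatives.
Variables (R : realType) (n : nat).
Local Notation Zn := 'rV[int]_n.
Implicit Types (h f g : 'rV[R]_n -> R[i]).

Lemma smooth_real_lin (a b : R) (f g : 'rV[R]_n -> R) : smooth_real f -> smooth_real g ->
  smooth_real (fun x => a * f x + b * g x).
Proof.
move=> sf sg.
have e s : foldr (@partial R n) (fun x => a * f x + b * g x) s =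
    fun x => a * foldr (@partial R n) f s x + b * foldr (@partial R n) g s x.
  elim: s => [//|j s ih]; rewrite /= ih; apply/funext => x.
  have [_ df] := sf s; have [_ dg] := sg s.
  have d1 := derivable_partial (df j x); have d2 := derivable_partial (dg j x).
  have := is_deriveD (is_deriveZ a d1) (is_deriveZ b d2).
  by case=> _ <-.
move=> s; rewrite e /=; have [cf df] := sf s; have [cg dg] := sg s.
split; first by apply: continuous_add; exact: continuous_scale.
move=> j x.
have d1 := derivable_partial (df j x); have d2 := derivable_partial (dg j x).
by have [] := is_deriveD (is_deriveZ a d1) (is_deriveZ b d2).
Qed.

Lemma torus_smoothD f g : torus_smooth f -> torus_smooth g ->
  torus_smooth (fun x => f x + g x).
Proof.
move=> [pf [rf jf]] [pg [rg jg]]; split; first by move=> j x; rewrite pf pg.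
split.
  rewrite (_ : (fun x => _) = fun x => 1 * complex.Re (f x) + 1 * complex.Re (g x)).
    exact: smooth_real_lin.
  by apply/funext => x; rewrite ReD !mul1r.
rewrite (_ : (fun x => _) = fun x => 1 * complex.Im (f x) + 1 * complex.Im (g x)).
  exact: smooth_real_lin.
by apply/funext => x; rewrite ImD !mul1r.
Qed.

Lemma torus_smoothZ (c : R[i]) f : torus_smooth f -> torus_smooth (fun x => c * f x).
Proof.
case: c => a b [pf [rf jf]]; split; first by move=> j x; rewrite pf.
split.
  rewrite (_ : (fun x => _) = fun x => a * complex.Re (f x) + - b * complex.Im (f x)).
    exact: smooth_real_lin.
  by apply/funext => x; rewrite ReM mulNr.
rewrite (_ : (fun x => _) = fun x => a * complex.Im (f x) + b * complex.Re (f x)).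
  exact: smooth_real_lin.
by apply/funext => x; rewrite ImM.
Qed.

Lemma torus_smoothB f g : torus_smooth f -> torus_smooth g ->
  torus_smooth (fun x => f x - g x).
Proof.
move=> sf sg; rewrite (_ : (fun x => _) = fun x => f x + -1 * g x).
  by apply: (torus_smoothD sf); exact: (torus_smoothZ _ sg).
by apply/funext => x; rewrite mulN1r.
Qed.

Lemma torus_smooth_cpartial j h : torus_smooth h -> torus_smooth (cpartial j h).
Proof.
move=> [ph [rh ih]]; split.
  have der (f : 'rV[R]_n -> R) (x : 'rV[R]_n) (i : 'I_n) :
      (forall y, f (y + unitv R i) = f y) ->
      (forall y, derivable f y (unitv R j)) -> partial j f (x + unitv R i) = partial j f x.
    move=> pf df.
    have E (e : R) : f (e *: unitv R j + x) = f (e *: unitv R j + (x + unitv R i)).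
      by rewrite addrA pf.
    by have [_ <-] := is_derive_transfer E (derivable_partial (df (x + unitv R i))).
  move=> i x; rewrite /cpartial !der // => y; rewrite ?ph //.
    by case: (ih [::]) => _; apply.
  by case: (rh [::]) => _; apply.
by split => s; rewrite -foldr_rcons; [exact: (rh (rcons s j)) | exact: (ih (rcons s j))].
Qed.

Lemma torus_smooth_Dx1 j m h : torus_smooth h -> torus_smooth (Dx1 j m h).
Proof.
move=> sh; elim: m => [|m ih] /=; first exact: sh.
apply: torus_smoothB; apply: torus_smoothZ; last exact: ih.
exact: torus_smooth_cpartial.
Qed.

Lemma coef_Dx1 j m h l : torus_smooth h ->
  coef (Dx1 j m h) l = fall (((- l) 0 j)%:~R) m * coef h l.
Proof.
move=> sh; elim: m => [|m ih]; first by rewrite /fall big_ord0 mul1r.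
have s1 := torus_smooth_Dx1 j m sh.
have c1 := torus_smooth_ccont s1.
have c2 := torus_smooth_ccont (torus_smooth_cpartial j s1).
have ce := @ccont_ek R n l.
transitivity ((Complex 0 (2 * pi))^-1 * coef (cpartial j (Dx1 j m h)) l - m%:R * coef (Dx1 j m h) l).
  have e1 := ccontM ce c1; have e2 := ccontM ce c2.
  rewrite /coef -(torus_intZ _ e1) -(torus_intZ _ e2) -(torus_intB (ccontZ _ e2) (ccontZ _ e1)).
  by congr torus_int; apply/funext => x /=; ring.
rewrite coef_cpartial // ih fallS mxE mulrN [X in - X]mulrA mulr_2pii -complex_intr mulrNz.
ring.
Qed.

Lemma Dx_torus_smooth b h : torus_smooth h -> torus_smooth (Dx b h).
Proof.
move=> sh; rewrite /Dx /mi_iter; elim: (enum _) => [//|j s ih] /=.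
exact: torus_smooth_Dx1.
Qed.

Lemma coef_Dx b h l : torus_smooth h -> coef (Dx b h) l = fallmx R b (- l) * coef h l.
Proof.
move=> sh; rewrite fallmxE /Dx /mi_iter.
suff [_ ->//] : torus_smooth (foldr (fun j w => Dx1 j (b j) w) h (enum 'I_n)) /\
  coef (foldr (fun j w => Dx1 j (b j) w) h (enum 'I_n)) l =
  \prod_(j <- enum 'I_n) fall (((- l) 0 j)%:~R) (b j) * coef h l.
elim: (enum 'I_n) => [|j s [ih1 ih2]] /=; first by rewrite big_nil mul1r.
split; first exact: torus_smooth_Dx1.
by rewrite coef_Dx1 // ih2 big_cons mulrA.
Qed.

Lemma coef_norm_le h l B : ccont h -> (forall x, normc (h x) <= B) ->
  normc (coef h l) <= 2 * B.
Proof.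
move=> ch hB; apply: torus_int_norm_le => [|x].
  by apply: ccontM => //; exact: ccont_ek.
by rewrite Normc.normcM normc_ek mul1r.
Qed.

(** Powers of a coordinate are combinations of falling factorials, by
    x * fall x m = fall x m.+1 + m * fall x m. *)
Lemma coord_decay (A : Type) (B : A -> R) (c : A -> Zn -> R[i]) (j : 'I_n) :
  (forall a, 0 <= B a) ->
  (forall m, exists2 C : R, 0 <= C &
     forall a (k : Zn), normc (fall ((k 0 j)%:~R) m * c a k) <= C * B a) ->
  forall L m, exists2 C : R, 0 <= C &
     forall a (k : Zn), `|(k 0 j)%:~R : R| ^+ L * normc (fall ((k 0 j)%:~R) m * c a k) <= C * B a.
Proof.
move=> B0 hc; elim=> [|L ih] m.
  by have [C C0 hC] := hc m; exists C => // a k; rewrite expr0 mul1r.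
have [C C0 hC] := ih m.+1; have [D D0 hD] := ih m.
exists (C + m%:R * D) => [|a k]; first by rewrite addr_ge0 ?mulr_ge0.
have zE : normc ((k 0 j)%:~R : R[i]) = `|(k 0 j)%:~R : R| by rewrite normc_int intr_norm.
rewrite exprSr -mulrA -zE -Normc.normcM.
have -> : (k 0 j)%:~R * (fall ((k 0 j)%:~R) m * c a k) =
  fall ((k 0 j)%:~R) m.+1 * c a k + m%:R * (fall ((k 0 j)%:~R) m * c a k) :> R[i].
  by rewrite fallS; ring.
apply: le_trans (ler_wpM2l _ (normcD_le _ _)) _; first by rewrite exprn_ge0 // zE.
rewrite zE mulrDr mulrDl; apply: lerD; first exact: hC.
by rewrite Normc.normcM normc_nat mulrCA -mulrA; apply: ler_wpM2l.
Qed.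

End CoefficientsOfDerivatives.

Section CoefficientDecay.
Variables (R : realType) (n : nat).
Local Notation Zn := 'rV[int]_n.

Lemma jp_exp_coords (k : Zn) L :
  jp R k ^+ L <= (1 + n%:R) ^+ L * (1 + \sum_j `|(k 0 j)%:~R : R| ^+ L).
Proof.
pose M := (\max_j `|k 0%R j|)%N.
have kM j : (`|k 0%R j| <= M)%N by exact: (@leq_bigmax _ (fun j => `|k 0%R j|%N) j).
have l1M : (l1 k <= n * M)%N.
  rewrite /l1 -[X in (_ <= X * _)%N]card_ord -sum_nat_const; exact: leq_sum.
have coord0 j : 0 <= `|(k 0 j)%:~R : R| ^+ L by rewrite exprn_ge0.
have sum0 : 0 <= \sum_j `|(k 0 j)%:~R : R| ^+ L by rewrite sumr_ge0.
have n0 : 0 <= 1 + n%:R :> R by rewrite addr_ge0.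
have jM : jp R k <= (1 + n%:R) * (maxn 1 M)%:R.
  rewrite /jp -[1 + (l1 k)%:R](natrD _ 1) -[1 + n%:R](natrD _ 1) -natrM ler_nat; nia.
apply: le_trans (_ : ((1 + n%:R) * (maxn 1 M)%:R) ^+ L <= _).
  by rewrite lerXn2r ?nnegrE ?jp_ge0 ?mulr_ge0.
rewrite exprMn ler_wpM2l ?exprn_ge0 //.
have [M0|M0] := posnP M; first by rewrite M0 expr1n lerDl.
have nI : (0 < #|'I_n|)%N.
  rewrite card_ord lt0n; apply: contraTneq M0 => n0'.
  by rewrite /M big1 // => j; have := ltn_ord j; rewrite {2}n0'.
have [j jE] := @bigop.eq_bigmax 'I_n (fun j => `|k 0%R j|%N) nI.
have -> : maxn 1 M = M by lia.
rewrite /M jE natr_absz intr_norm (bigD1 j) //= addrCA lerDl addr_ge0 //.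
by rewrite sumr_ge0.
Qed.

(** Integration by parts, [coef_Dx], trades derivatives for powers of the
    frequency; the constants are uniform over the family. *)
Lemma coef_decay (A : Type) (B : A -> R) (h : A -> 'rV[R]_n -> R[i]) :
  (forall a, 0 <= B a) -> (forall a, torus_smooth (h a)) ->
  (forall b, exists2 C : R, 0 <= C & forall a x, normc (Dx b (h a) x) <= C * B a) ->
  forall L, exists2 C : R, 0 <= C & forall a l, normc (coef (h a) l) <= C * B a * jp R l ^- L.
Proof.
move=> B0 sh hD L.
have one (j : 'I_n) : exists C : R, 0 <= C /\ forall a (k : Zn),
    `|(k 0 j)%:~R : R| ^+ L * normc (coef (h a) k) <= C * B a.
  have [|C C0 hC] := @coord_decay R n A B (fun a k => coef (h a) (- k)) j B0 _ L 0.
    move=> m; have [C C0 hC] := hD (fun i => if i == j then m else 0%N).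
    exists (2 * C) => [|a k]; first by rewrite mulr_ge0.
    have -> : fall ((k 0 j)%:~R) m = fallmx R (fun i => if i == j then m else 0%N) (- - k).
      rewrite opprK /fallmx (bigD1 j) //= eqxx big1 ?mulr1 // => i /negbTE ->.
      by rewrite /fall big_ord0.
    rewrite -coef_Dx // -mulrA; apply: coef_norm_le => //.
    exact/torus_smooth_ccont/Dx_torus_smooth.
  exists C; split=> // a k; have := hC a (- k).
  by rewrite opprK mxE mulrNz normrN /fall big_ord0 mul1r.
have [C hC] := choice one.
have [C' C'0 hC'] := hD (fun=> 0%N).
exists ((1 + n%:R) ^+ L * (2 * C' + \sum_j C j)) => [|a l].
  rewrite mulr_ge0 ?exprn_ge0 ?addr_ge0 ?mulr_ge0 //.
  by apply: sumr_ge0 => j _; case: (hC j).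
rewrite ler_pdivlMr ?jp_exp_gt0 // mulrC.
apply: le_trans (ler_wpM2r (normc_ge0 _) (jp_exp_coords l L)) _.
rewrite -!mulrA; apply: ler_wpM2l; first by rewrite exprn_ge0 // addr_ge0.
rewrite mulrDl mul1r mulr_suml mulrDl mulr_suml; apply: lerD.
  rewrite -mulrA; apply: coef_norm_le; first exact/torus_smooth_ccont.
  move=> x; have := hC' a x; congr (normc (_ x) <= _).
  by rewrite /Dx /mi_iter; elim: (enum _).
by apply: ler_sum => j _; case: (hC j) => _; apply.
Qed.

End CoefficientDecay.

(** * Iterated differences *)

Section Differences.
Variables (n : nat).
Local Notation Zn := 'rV[int]_n.

Definition sdiff (V : zmodType) (s : seq 'I_n) (f : Zn -> V) : Zn -> V :=
  foldr (@kdiff1 n V) f s.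

Definition seq_of_mi (a : 'I_n -> nat) : seq 'I_n :=
  flatten [seq nseq (a j) j | j <- enum 'I_n].

Section Zmod.
Variable V : zmodType.
Implicit Types (f g : Zn -> V) (s t : seq 'I_n).

Lemma sdiff_cons j s f : sdiff (j :: s) f = kdiff1 j (sdiff s f).
Proof. by []. Qed.

Lemma sdiff_cat s t f : sdiff (s ++ t) f = sdiff s (sdiff t f).
Proof. by rewrite /sdiff foldr_cat. Qed.

Lemma kdiff1C i j f : kdiff1 i (kdiff1 j f) = kdiff1 j (kdiff1 i f).
Proof.
apply/funext => k; rewrite /kdiff1 (addrAC k) !opprB addrACA [RHS]addrACA.
by congr (_ + _); rewrite addrC.
Qed.

Lemma sdiff_kdiff1 j s f : sdiff s (kdiff1 j f) = kdiff1 j (sdiff s f).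
Proof. by elim: s => [//|i s ih]; rewrite !sdiff_cons ih kdiff1C. Qed.

Lemma sdiff_perm s t f : perm_eq s t -> sdiff s f = sdiff t f.
Proof.
elim: s t => [|j s ih] t; first by rewrite perm_sym => /perm_nilP ->.
move=> st; have jt : j \in t by rewrite -(perm_mem st) mem_head.
case/splitPr: jt st => t1 t2 st.
rewrite sdiff_cons (ih (t1 ++ t2)); first by rewrite [RHS]sdiff_cat sdiff_cons sdiff_kdiff1 -sdiff_cat.
by rewrite -(perm_cons j) (perm_trans st) // -cat_rcons -cats1 -catA perm_catCA.
Qed.

Lemma kdiffE a f : kdiff a f = sdiff (seq_of_mi a) f.
Proof.
rewrite /kdiff /mi_iter /seq_of_mi; elim: (enum _) => [//|j s ih] /=.
rewrite sdiff_cat -ih; elim: (a j) => [//|m ihm] /=.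
by rewrite ihm.
Qed.

Lemma count_seq_of_mi a j : count_mem j (seq_of_mi a) = a j.
Proof.
rewrite /seq_of_mi count_flatten -map_comp.
rewrite (_ : map _ _ = [seq (if i == j then a j else 0%N) | i <- enum 'I_n]); last first.
  by apply: eq_map => i /=; rewrite count_nseq /=; case: eqP => [->|_]; rewrite ?mul1n ?mul0n.
rewrite sumnE big_map big_enum /= (bigD1 j) //= eqxx big1 ?addn0 //.
by move=> i /negbTE ->.
Qed.

Lemma size_seq_of_mi a : size (seq_of_mi a) = mi_size a.
Proof.
rewrite /seq_of_mi size_flatten /shape -map_comp sumnE big_map big_enum /=.
by apply: eq_bigr => j _; rewrite /= size_nseq.
Qed.

Lemma perm_seq_of_count s : perm_eq (seq_of_mi (fun j => count_mem j s)) s.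
Proof. by apply/allP => j _ /=; rewrite count_seq_of_mi. Qed.

Lemma mi_size_count s : mi_size (fun j => count_mem j s) = size s.
Proof. by rewrite -size_seq_of_mi; apply/perm_size/perm_seq_of_count. Qed.

Lemma sdiff_kdiff s f : sdiff s f = kdiff (fun j => count_mem j s) f.
Proof. by rewrite kdiffE; apply: sdiff_perm; rewrite perm_sym perm_seq_of_count. Qed.

End Zmod.

Section Ring.
Variable K : comPzRingType.
Implicit Types (f g : Zn -> K) (s t : seq 'I_n).

Lemma sdiffD s f g : sdiff s (fun k => f k + g k) = fun k => sdiff s f k + sdiff s g k.
Proof.
elim: s => [//|j s ih]; rewrite sdiff_cons ih.
by apply/funext => k; rewrite /kdiff1 opprD addrACA.
Qed.

(** Leibniz' rule without shifted arguments, so that only bounds at [k] enter. *)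
Lemma kdiff1M j f g : kdiff1 j (fun k => f k * g k) =
  fun k => kdiff1 j f k * g k + f k * kdiff1 j g k + kdiff1 j f k * kdiff1 j g k.
Proof. by apply/funext => k; rewrite /kdiff1; ring. Qed.

End Ring.

End Differences.

(** * Temperate weights *)

Section Temperate.
Variables (R : realType) (n : nat).
Local Notation Zn := 'rV[int]_n.
Implicit Types (g : Zn -> R) (k h : Zn) (l : 'I_n).

(** Weights that satisfy an inequality of Peetre's type. *)
Definition temperate g : Prop := (forall k, 0 < g k) /\
  exists C : R, exists M : nat, 1 <= C /\ forall k h, g (k + h) <= C * jp R h ^+ M * g k.

Lemma temperateM g1 g2 : temperate g1 -> temperate g2 -> temperate (fun k => g1 k * g2 k).
Proof.
move=> [p1 [C1 [M1 [C11 h1]]]] [p2 [C2 [M2 [C21 h2]]]]; split.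
  by move=> k; rewrite mulr_gt0.
exists (C1 * C2), (M1 + M2)%N; split; first by rewrite mulr_ege1.
move=> k h; rewrite exprD [leRHS](_ : _ = (C1 * jp R h ^+ M1 * g1 k) * (C2 * jp R h ^+ M2 * g2 k)); last by ring.
by apply: ler_pM; [exact/ltW/p1 | exact/ltW/p2 | exact: h1 | exact: h2].
Qed.

Lemma temperateV g : temperate g -> temperate (fun k => (g k)^-1).
Proof.
move=> [p [C [M [C1 h1]]]]; split; first by move=> k; rewrite invr_gt0.
exists C, M; split=> // k h.
have C0 : 0 < C by exact: lt_le_trans ltr01 C1.
have := h1 (k + h) (- h); rewrite addrK jpN => hk.
have p1 := p k; have p2 := p (k + h).
by rewrite -[leLHS]mul1r ler_pdivrMr // mulrAC ler_pdivlMr // mul1r.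
Qed.

Lemma temperate1 : temperate (fun=> 1).
Proof.
split=> //; exists 1, 0%N; split=> // k h.
by rewrite expr0 !mulr1.
Qed.

Lemma temperateX g N : temperate g -> temperate (fun k => g k ^+ N).
Proof.
move=> tg; elim: N => [|N ih]; first exact: temperate1.
by under eq_fun do rewrite exprS; exact: temperateM.
Qed.

Lemma temperate_prod (I : Type) (r : seq I) (F : I -> Zn -> R) :
  (forall i, temperate (F i)) -> temperate (fun k => \prod_(i <- r) F i k).
Proof.
move=> tF; elim: r => [|i r ih].
  under eq_fun do rewrite big_nil; exact: temperate1.
under eq_fun do rewrite big_cons; exact: temperateM.
Qed.

Lemma temperate_powR g r : temperate g -> temperate (fun k => g k `^ r).
Proof.
wlog r0 : r / 0 <= r.
  move=> H tg; have [/H/(_ tg)//|r0] := leP 0 r.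
  rewrite (_ : (fun k => _) = fun k => (g k `^ (- r))^-1).
    by apply: temperateV; apply: H => //; rewrite oppr_ge0 ltW.
  by apply/funext => k; rewrite powRN invrK.
move=> [p [C [M [C1 h1]]]]; split; first by move=> k; rewrite powR_gt0.
have C0 : 0 <= C by exact: le_trans ler01 C1.
pose N := (Num.truncn (M%:R * r)).+1.
exists (C `^ r), N; split.
  by rewrite -[leLHS](powRr0 C) ler_powR.
move=> k h; apply: (@le_trans _ _ ((C * jp R h ^+ M * g k) `^ r)).
  by rewrite ge0_ler_powR ?nnegrE // ltW // ?mulr_gt0 // ?jp_exp_gt0 // (lt_le_trans ltr01).
rewrite !powRM ?mulr_ge0 ?(ltW (jp_exp_gt0 _ _ _)) ?(ltW (p k)) //.
rewrite ler_wpM2r ?powR_ge0 // ler_wpM2l ?powR_ge0 //.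
rewrite -powR_mulrn ?jp_ge0 // -powRrM -powR_mulrn ?jp_ge0 // ler_powR ?jp_ge1 //.
by rewrite ltW // truncnS_gt.
Qed.

Lemma l1_unitv_lt h l : h 0 l != 0 ->
  exists2 h', (l1 h' < l1 h)%N & h = h' + unitv int l \/ h' = h + unitv int l.
Proof.
move=> hl.
have step (u v : Zn) : (forall i, i != l -> u 0 i = v 0 i) -> (`|u 0%R l| < `|v 0%R l|)%N ->
    (l1 u < l1 v)%N.
  move=> uv ul; rewrite /l1 (bigD1 l) //= [ltnRHS](bigD1 l) //=.
  rewrite (eq_bigr (fun i => `|v 0%R i|%N)) ?ltn_add2r // => i /uv ->.
  by [].
have [h0|h0] := leP 0 (h 0 l).
  exists (h - unitv int l); last by left; rewrite subrK.
  apply: step => [i il|]; rewrite !mxE ?(negbTE il) ?andbF ?subr0 //.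
  by rewrite !eqxx; move: (h 0 l) hl h0 => z; lia.
exists (h + unitv int l); last by right.
apply: step => [i il|]; rewrite !mxE ?(negbTE il) ?andbF ?addr0 //.
by rewrite !eqxx; move: (h 0 l) hl h0 => z; lia.
Qed.

(** Walking from 0 to [h] along the axes takes [l1 h] unit steps. *)
Lemma telescope_bound (N : Zn -> R) K M : N 0 <= 0 -> 0 <= K ->
  (forall h l, N (h + unitv int l) <= N h + K * jp R h ^+ M) ->
  (forall h l, N h <= N (h + unitv int l) + K * jp R h ^+ M) ->
  forall h, N h <= K * jp R h ^+ M.+1.
Proof.
move=> N0 K0 up dn h.
suff H p : forall h, (l1 h <= p)%N -> N h <= K * (l1 h)%:R * (1 + p%:R) ^+ M.
  apply: le_trans (H _ h (leqnn _)) _; rewrite exprS -!mulrA ler_wpM2l //.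
  by rewrite ler_wpM2r ?exprn_ge0 ?addr_ge0 // /jp lerDr.
elim: p => [|p ih] {}h hp.
  have -> : h = 0 by apply: l1_eq0; apply/eqP; rewrite -leqn0.
  by rewrite l10 mulr0 mul0r.
have [h0|] := eqVneq h 0; first by rewrite h0 l10 mulr0 mul0r.
move=> h0; have [l hl] : exists l, h 0 l != 0.
  apply/existsP; apply: contraR h0; rewrite negb_exists => /forallP hh.
  by apply/eqP/rowP => i; rewrite mxE; apply/eqP; rewrite -[_ == _]negbK hh.
have [h' lt hh'] := l1_unitv_lt hl.
have lp : (l1 h' <= p)%N by lia.
have pw q : (q <= p.+1)%N -> (1 + q%:R) ^+ M <= (1 + p.+1%:R) ^+ M :> R.
  by move=> qp; rewrite lerXn2r ?nnegrE ?addr_ge0 // lerD2l ler_nat.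
have step : N h <= N h' + K * (1 + p.+1%:R) ^+ M.
  case: hh' => [->|e].
    apply: le_trans (up _ _) _; rewrite lerD2l ler_wpM2l // /jp pw //; lia.
  rewrite e; apply: le_trans (dn _ l) _; rewrite lerD2l ler_wpM2l // /jp pw //.
apply: le_trans step _; apply: le_trans (lerD (ih _ lp) (lexx _)) _.
have : (l1 h')%:R + 1 <= (l1 h)%:R :> R by rewrite natr1 ler_nat.
have := pw p (leqnSn p).
have : 0 <= (1 + p%:R) ^+ M :> R by rewrite exprn_ge0 // addr_ge0.
set a := (1 + p%:R) ^+ M; set b := (1 + p.+1%:R) ^+ M => a0 ab hl1.
apply: (@le_trans _ _ (K * ((l1 h')%:R + 1) * b)); last first.
  by apply: ler_wpM2r; [exact: le_trans ab | exact: ler_wpM2l].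
rewrite [leRHS](_ : _ = K * (l1 h')%:R * b + K * b); last by ring.
by rewrite lerD2r; apply: ler_wpM2l => //; exact: mulr_ge0.
Qed.

End Temperate.

Section WeightFunction.
Variables (R : realType) (n : nat) (mu0 mu1 mu C0 C1 : R).
Variables (Lam : 'rV[int]_n -> R) (hLam : weight_function mu0 mu1 mu C0 C1 Lam).
Local Notation Zn := 'rV[int]_n.
Implicit Types (k h : Zn) (l : 'I_n) (s t : seq 'I_n).

Let Lam_gt0 k : 0 < Lam k. Proof. by case: hLam. Qed.

Lemma Lam_ge_C0 k : C0 <= Lam k.
Proof.
case: hLam => m0 _ _ c0 _ _ lo _ _; apply: le_trans (lo k).
rewrite -[leLHS]mulr1 ler_wpM2l ?(ltW c0) // -[leLHS](powRr0 (1 + lnorm R k)).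
by rewrite ler_powR ?(ltW m0) // lerDl lnorm_ge0.
Qed.

Lemma exp1D_le (y Y : R) N : 0 <= y -> y <= Y -> (1 + y) ^+ N <= 1 + y * (N%:R * (1 + Y) ^+ N).
Proof.
move=> y0 yY; elim: N => [|N ih]; first by rewrite expr0 mul0r mulr0 addr0.
have Y1 : 1 <= 1 + Y by rewrite lerDl (le_trans y0).
have YN : 1 <= (1 + Y) ^+ N by rewrite exprn_ege1.
have yN : (1 + y) ^+ N <= (1 + Y) ^+ N by rewrite lerXn2r ?nnegrE ?addr_ge0 ?lerD2l // (le_trans y0).
have : (1 + Y) ^+ N <= (1 + Y) ^+ N.+1 by rewrite ler_weXn2l.
rewrite (exprS (1 + y)) mulrDl mul1r -natr1.
have : 0 <= (N%:R : R) by [].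
set a := (1 + y) ^+ N in ih yN *; set b := (1 + Y) ^+ N in ih yN YN *.
set c := (1 + Y) ^+ N.+1 => M0 bc.
have yc : y * a <= y * c by apply: ler_wpM2l => //; exact: le_trans bc.
have Nc : y * (N%:R * b) <= y * (N%:R * c) by apply: ler_wpM2l => //; apply: ler_wpM2l.
rewrite mulrDl mul1r mulrDr; lra.
Qed.

(** The bound |Delta_l Lam| <= C Lam^(1 - 1/mu) says that Lam^(1/mu) is
    Lipschitz along the lattice. *)
Lemma Lam_root_lipschitz : exists2 B : R, 0 <= B & forall k l,
  `|Lam (k + unitv int l) `^ mu^-1 - Lam k `^ mu^-1| <= B.
Proof.
have [m0 m01 m1 c0 _ _ _ _ wd] := hLam.
have mu_gt0 : 0 < mu by exact: lt_le_trans m0 (le_trans m01 m1).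
pose th := mu^-1; have th0 : 0 < th by rewrite invr_gt0.
have one l : exists C : R, 0 < C /\ forall k,
    `|Lam (k + unitv int l) - Lam k| <= C * Lam k `^ (1 - th).
  have [|C C_gt0 hC] := wd (fun j => (j == l : nat)) (fun=> 0%N); first by [].
  exists C; split=> // k; have := hC k.
  rewrite /kpow big1 ?mul1r; last by move=> j _; rewrite expr0.
  rewrite (_ : mi_size _ = 1%N) ?mulr1; last first.
    by rewrite /mi_size (bigD1 l) //= eqxx big1 // => j /negbTE ->.
  rewrite (_ : kdiff _ Lam k = Lam (k + unitv int l) - Lam k) ?div1r // kdiffE.
  rewrite (_ : sdiff _ Lam = sdiff [:: l] Lam) //; apply: sdiff_perm.
  by apply/allP => j _; apply/eqP; rewrite count_seq_of_mi /= !addn0 eq_sym.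
have [Cl hCl] := choice one.
pose C := \sum_l Cl l.
have C_ge0 : 0 <= C by apply: sumr_ge0 => l _; rewrite ltW; case: (hCl l).
have hC k l : `|Lam (k + unitv int l) - Lam k| <= C * Lam k * (Lam k `^ th)^-1.
  apply: le_trans (proj2 (hCl l) k) _.
  rewrite powRB; last by apply/implyP => _; rewrite gt_eqF.
  rewrite powRr1 ?(ltW (Lam_gt0 _)) // mulrA -[leRHS]mulrA -[leLHS]mulrA ler_wpM2r //.
    by rewrite divr_ge0 ?powR_ge0 // ltW.
  rewrite /C (bigD1 l) //= lerDl sumr_ge0 // => i _; rewrite ltW //; by case: (hCl i).
(* With t = Lam^(-th), which is bounded by T, the hypothesis reads
   |y - x| <= C t x; raising to the power th < N costs a constant times
   t x^th = 1. *)
pose N := (Num.truncn th).+1.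
pose T := (C0 `^ th)^-1.
have T0 : 0 < T by rewrite invr_gt0 powR_gt0.
have vT k : (Lam k `^ th)^-1 <= T.
  rewrite lef_pV2 ?posrE ?powR_gt0 // ge0_ler_powR ?nnegrE ?(ltW th0) ?(ltW c0) ?(ltW (Lam_gt0 k)) //.
  exact: Lam_ge_C0.
have grow (x y D t : R) : 0 < x -> 0 < y -> 0 <= D -> 0 < t -> t <= T -> y <= x * (1 + D * t) ->
    y `^ th <= x `^ th + t * x `^ th * (D * (N%:R * (1 + D * T) ^+ N)).
  move=> x0 y0 D0 t0 tT yx.
  have Dt0 : 0 <= D * t by rewrite mulr_ge0 // ltW.
  apply: (@le_trans _ _ ((x * (1 + D * t)) `^ th)).
    by rewrite ge0_ler_powR ?nnegrE ?(ltW th0) ?(ltW y0) // mulr_ge0 ?addr_ge0 // ltW.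
  rewrite powRM ?addr_ge0 ?(ltW x0) //.
  apply: (@le_trans _ _ (x `^ th * (1 + D * t) ^+ N)).
    rewrite ler_wpM2l ?powR_ge0 // -powR_mulrn ?addr_ge0 // ler_powR ?lerDl //.
    by rewrite ltW // truncnS_gt.
  apply: le_trans (ler_wpM2l (powR_ge0 _ _) (exp1D_le N Dt0 (ler_wpM2l D0 tT))) _.
  by rewrite le_eqVlt; apply/orP; left; apply/eqP; ring.
pose E D := D * (N%:R * (1 + D * T) ^+ N).
have E0 D : 0 <= D -> 0 <= E D.
  by move=> D0; rewrite !mulr_ge0 ?exprn_ge0 ?addr_ge0 ?mulr_ge0 ?(ltW T0).
have EC := E0 _ C_ge0; have E2C := E0 _ (mulr_ge0 (ler0n _ 2) C_ge0).
have Epos : 0 <= 2 * C + E (2 * C) * (1 + E C * T).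
  apply: addr_ge0; first exact: mulr_ge0.
  by apply: mulr_ge0 => //; apply: addr_ge0 => //; apply: mulr_ge0 => //; exact: ltW.
exists (E C + (2 * C + E (2 * C) * (1 + E C * T))) => [|k l].
  exact: addr_ge0.
have := hC k l; have x0 := Lam_gt0 k; have y0 := Lam_gt0 (k + unitv int l).
have := vT k.
have v0 : 0 < Lam k `^ th by rewrite powR_gt0.
move: x0 y0 v0; rewrite -/th; set x := Lam k; set y := Lam _ => x0 y0 v0.
pose t := (x `^ th)^-1; rewrite -/t => tT hxy.
have t0 : 0 < t by rewrite invr_gt0.
have tx : t * x `^ th = 1 by rewrite mulVf // gt_eqF.
have up : y `^ th <= x `^ th + E C.
  have -> : E C = t * x `^ th * E C by rewrite tx mul1r.
  apply: grow => //; move: hxy; rewrite ler_norml => /andP[_ hh]; nra.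
have dn : x `^ th <= y `^ th + (2 * C + E (2 * C) * (1 + E C * T)).
  have yp0 : 0 <= y `^ th by exact: powR_ge0.
  have [Ct|Ct] := leP (C * t) (1 / 2); last first.
    have : x `^ th <= 2 * C.
      have h1 : 1 <= 2 * C * t by lra.
      have e : 2 * C = 2 * C * t * x `^ th by rewrite -mulrA tx mulr1.
      by rewrite [leRHS]e -[leLHS]mul1r; apply: ler_wpM2r => //; exact: ltW.
    have : 0 <= E (2 * C) * (1 + E C * T).
      by apply: mulr_ge0 => //; apply: addr_ge0 => //; apply: mulr_ge0 => //; exact: ltW.
    lra.
  have g := @grow y x (2 * C) t y0 x0 (mulr_ge0 (ler0n _ 2) C_ge0) t0 tT.
  have ty : t * y `^ th <= 1 + E C * T.
    apply: le_trans (ler_wpM2l (ltW t0) up) _; rewrite mulrDr tx lerD2l mulrC.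
    exact: ler_wpM2l.
  have : x `^ th <= y `^ th + t * y `^ th * E (2 * C).
    apply: g; move: hxy; rewrite ler_norml => /andP[hh _].
    have : 0 <= C * t by rewrite mulr_ge0 // ltW.
    have {}hh : x - y <= C * t * x by rewrite mulrAC; lra.
    rewrite (_ : 2 * C * t = 2 * (C * t)); last by rewrite mulrA.
    move: hh Ct; move: (C * t) => c hh Ct c_ge0.
    have h1 : x * (1 - c) <= y by lra.
    have h2 : x * (1 - c) * (1 + 2 * c) <= y * (1 + 2 * c) by apply: ler_wpM2r => //; lra.
    have h3 : 0 <= x * (c * (1 - 2 * c)).
      by apply: mulr_ge0; [exact: ltW | apply: mulr_ge0 => //; lra].
    lra.
  have : t * y `^ th * E (2 * C) <= E (2 * C) * (1 + E C * T).
    by rewrite mulrC; apply: ler_wpM2l.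
  have : 0 <= C by []. lra.
rewrite ler_norml; apply/andP; split; lra.
Qed.

(** A Lipschitz function bounded below by a positive constant is temperate, and
    so are its powers. *)
Lemma temperate_Lam : temperate Lam.
Proof.
have [m0 m01 m1 c0 _ _ _ _ _] := hLam.
have mu_gt0 : 0 < mu by exact: lt_le_trans m0 (le_trans m01 m1).
have -> : Lam = fun k => (Lam k `^ mu^-1) `^ mu.
  by apply/funext => k; rewrite -powRrM mulVf ?powRr1 ?(ltW (Lam_gt0 k)) // gt_eqF.
apply: temperate_powR; split; first by move=> k; rewrite powR_gt0.
have [B B0 hB] := Lam_root_lipschitz.
pose c := C0 `^ mu^-1; have c_gt0 : 0 < c by rewrite powR_gt0.
have vc k : c <= Lam k `^ mu^-1.
  by rewrite ge0_ler_powR ?nnegrE ?invr_ge0 ?(ltW mu_gt0) ?(ltW c0) ?(ltW (Lam_gt0 k)) // Lam_ge_C0.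
exists (1 + B / c), 1%N; split=> [|k h]; first by rewrite lerDl divr_ge0 // ltW.
have := @telescope_bound R n (fun h => Lam (k + h) `^ mu^-1 - Lam k `^ mu^-1) B 0 _ B0 _ _ h.
rewrite addr0 subrr => /(_ (lexx _)) H.
have {}H : Lam (k + h) `^ mu^-1 - Lam k `^ mu^-1 <= B * jp R h ^+ 1.
  by apply: H => {}h l; rewrite expr0 mulr1 addrA; have := hB (k + h) l;
     rewrite ler_norml => /andP[]; lra.
move: H; have := vc k; have := jp_ge1 R h; move: (Lam (k + h) `^ _) (Lam k `^ _) => y x.
rewrite expr1 => j1 cx yx.
have : B * jp R h <= B / c * jp R h * x.
  rewrite -[leLHS]mulr1 -[leRHS](_ : B * jp R h * (x / c) = _); last by ring.
  by apply: ler_wpM2l; [rewrite mulr_ge0 ?jp_ge0 | rewrite ler_pdivlMr // mul1r].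
have : x <= jp R h * x by rewrite ler_peMl // (le_trans (ltW c_gt0)).
nra.
Qed.

Variable rho : R.
Hypothesis rho_gt0 : 0 < rho.

(** Every difference gains 1/V, and in each direction one of the differences may
    gain 1/|k_l| instead; [wdir c] is the better of the two possibilities for c
    differences in one direction. *)
Definition wV k : R := Lam k `^ rho.
Definition wq l k : R := Num.max (wV k) `|(k 0 l)%:~R|.
Definition wdir (c : nat) (V q : R) : R := if c is c'.+1 then V ^- c' / q else 1.
Definition wseq s k : R := \prod_l wdir (count_mem l s) (wV k) (wq l k).

Lemma wV_gt0 k : 0 < wV k.
Proof. by rewrite powR_gt0. Qed.

Lemma wV_le_wq l k : wV k <= wq l k.
Proof. by rewrite /wq le_max lexx. Qed.

Lemma wq_gt0 l k : 0 < wq l k.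
Proof. exact: lt_le_trans (wV_gt0 k) (wV_le_wq l k). Qed.

Lemma wdir_gt0 c V q : 0 < V -> 0 < q -> 0 < wdir c V q.
Proof. by case: c => // c V0 q0; rewrite /= divr_gt0 // invr_gt0 exprn_gt0. Qed.

Lemma wseq_gt0 s k : 0 < wseq s k.
Proof. by apply: prodr_gt0 => l _; apply: wdir_gt0; [exact: wV_gt0 | exact: wq_gt0]. Qed.

Lemma wV_inv_bounded : exists2 D : R, 0 <= D & forall k, (wV k)^-1 <= D.
Proof.
have [_ _ _ c0 _ _ _ _ _] := hLam.
exists (C0 `^ rho)^-1 => [|k]; first by rewrite invr_ge0 powR_ge0.
rewrite lef_pV2 ?posrE ?powR_gt0 //.
by rewrite ge0_ler_powR ?nnegrE ?(ltW rho_gt0) ?(ltW c0) ?(ltW (Lam_gt0 k)) // Lam_ge_C0.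
Qed.

Lemma wdir_mul a b V q : 0 < V -> V <= q -> wdir a V q * wdir b V q <= wdir (a + b) V q.
Proof.
move=> V0 Vq; have q0 : 0 < q by exact: lt_le_trans Vq.
case: a => [|a]; first by rewrite mul1r.
case: b => [|b]; first by rewrite mulr1 addn0.
rewrite /= -!exprVn addnS exprS exprD.
rewrite [leLHS](_ : _ = q^-1 * (V^-1 ^+ a * V^-1 ^+ b / q)); last by ring.
rewrite [leRHS](_ : _ = V^-1 * (V^-1 ^+ a * V^-1 ^+ b / q)); last by ring.
apply: ler_wpM2r; last by rewrite lef_pV2 ?posrE.
by rewrite divr_ge0 ?mulr_ge0 ?exprn_ge0 ?invr_ge0 ?(ltW V0) ?(ltW q0).
Qed.

Lemma wdirS c V q : 0 < V -> V <= q -> wdir c.+1 V q <= V^-1 * wdir c V q.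
Proof.
move=> V0 Vq; have q0 : 0 < q by exact: lt_le_trans Vq.
case: c => [|c] /=; first by rewrite invr1 mul1r mulr1 lef_pV2 ?posrE.
by rewrite exprS invfM mulrA.
Qed.

Lemma wseq_mul s t k : wseq s k * wseq t k <= wseq (s ++ t) k.
Proof.
rewrite /wseq -big_split; apply: ler_prod => l _.
rewrite mulr_ge0 ?(ltW (wdir_gt0 _ (wV_gt0 k) (wq_gt0 l k))) //= count_cat.
by apply: wdir_mul; [exact: wV_gt0 | exact: wV_le_wq].
Qed.

Lemma wseq_cons l s k : wseq (l :: s) k <= (wV k)^-1 * wseq s k.
Proof.
rewrite /wseq (bigD1 l) //= [in leRHS](bigD1 l) //= eqxx add1n mulrA.
rewrite (eq_bigr (fun i => wdir (count_mem i s) (wV k) (wq i k))); last first.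
  by move=> i il; rewrite eq_sym (negbTE il) add0n.
apply: ler_wpM2r; first by apply: prodr_ge0 => i _; exact: ltW (wdir_gt0 _ (wV_gt0 k) (wq_gt0 i k)).
by apply: wdirS; [exact: wV_gt0 | exact: wV_le_wq].
Qed.

Lemma wseq_perm s t : perm_eq s t -> wseq s = wseq t.
Proof.
move=> st; apply/funext => k; apply: eq_bigr => l _.
by move/permP: st => ->.
Qed.

Lemma temperate_wV : temperate wV.
Proof. by apply: temperate_powR; exact: temperate_Lam. Qed.

(** The translation by [h] adds at most [jp h] to |k_l|, and V is bounded below. *)
Lemma temperate_wq l : temperate (wq l).
Proof.
split; first exact: wq_gt0.
have [_ [C [M [C1' hC]]]] := temperate_wV; have [D D0 hD] := wV_inv_bounded.
have C_ge0 : 0 <= C by exact: le_trans ler01 C1'.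
exists (C + 1 + D), M.+1; split=> [|k h]; first by lra.
have j1 := jp_ge1 R h; have j0 := jp_ge0 R h.
have jM : 1 <= jp R h ^+ M by exact: jp_exp_ge1.
have jM1 : jp R h ^+ M <= jp R h ^+ M.+1 by exact: jp_exp_mono.
have jM2 : jp R h <= jp R h ^+ M.+1 by rewrite exprS ler_peMr.
have q0 := wq_gt0 l k; have Vq := wV_le_wq l k; have V0 := wV_gt0 k.
have kq : `|(k 0 l)%:~R : R| <= wq l k by rewrite /wq le_max lexx orbT.
have DV : 1 <= D * wV k by rewrite -ler_pdivrMr // mul1r hD.
move: (jp R h ^+ M.+1) jM1 jM2 => P jM1 jM2.
have P1 : 1 <= P by exact: le_trans jM1.
rewrite {1}/wq ge_max; apply/andP; split.
  apply: le_trans (hC k h) _.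
  apply: (@le_trans _ _ (C * P * wq l k)).
    apply: ler_pM => //; rewrite ?mulr_ge0 ?(ltW V0) ?(le_trans ler01 jM) //.
    exact: ler_wpM2l.
  apply: ler_wpM2r; first exact: ltW.
  by apply: ler_wpM2r; [exact: le_trans ler01 P1 | lra].
have : `|((k + h) 0 l)%:~R : R| <= `|(k 0 l)%:~R : R| + jp R h.
  rewrite mxE intrD; apply: le_trans (ler_normD _ _) _.
  by rewrite lerD2l jp_coord.
move=> h1; apply: le_trans h1 _.
have a1 : `|(k 0 l)%:~R : R| <= P * wq l k.
  by apply: le_trans kq _; rewrite ler_peMl // ltW.
have a2 : jp R h <= D * (P * wq l k).
  apply: le_trans jM2 _; apply: (@le_trans _ _ (P * (D * wV k))).
    by rewrite ler_peMr // (le_trans ler01).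
  rewrite mulrCA; apply: ler_wpM2l => //; apply: ler_wpM2l => //.
  exact: le_trans ler01 P1.
apply: le_trans (lerD a1 a2) _.
have : 0 <= C * (P * wq l k).
  by apply: mulr_ge0 => //; apply: mulr_ge0; [exact: le_trans ler01 P1 | exact: ltW].
by rewrite -mulrA; lra.
Qed.

Lemma temperate_wseq s : temperate (wseq s).
Proof.
apply: temperate_prod => l; case: (count_mem l s) => [|c] /=; first exact: temperate1.
apply: temperateM; apply: temperateV; last exact: temperate_wq.
by apply: temperateX; exact: temperate_wV.
Qed.

Lemma Lam_powR_split m a k : Lam k `^ (m - rho * a%:R) = Lam k `^ m * wV k ^- a.
Proof.
rewrite powRB; last by apply/implyP => _; rewrite gt_eqF.
by congr (_ * _^-1); rewrite powRrM powR_mulrn // ltW // wV_gt0.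
Qed.

End WeightFunction.

(** * Leibniz and Taylor estimates on the lattice *)

Section DifferenceEstimates.
Variables (R : realType) (n : nat) (mu0 mu1 mu C0 C1 : R).
Variables (Lam : 'rV[int]_n -> R) (hLam : weight_function mu0 mu1 mu C0 C1 Lam).
Variables (rho : R) (rho_gt0 : 0 < rho).
Local Notation Zn := 'rV[int]_n.
Implicit Types (k h : Zn) (l : 'I_n) (s t : seq 'I_n).

Let Lam_gt0 k : 0 < Lam k. Proof. by case: hLam. Qed.

(** The bound satisfied by the differences [sdiff s] of a symbol of order [m]
    in the class M. *)
Definition omega (m : R) s k : R := Lam k `^ m * wseq Lam rho s k.

Lemma omega_gt0 m s k : 0 < omega m s k.
Proof. by rewrite mulr_gt0 ?powR_gt0 // (wseq_gt0 hLam). Qed.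

Lemma omega_ge0 m s k : 0 <= omega m s k. Proof. exact: ltW (omega_gt0 m s k). Qed.

Lemma omega_perm m s t : perm_eq s t -> omega m s = omega m t.
Proof. by move=> st; apply/funext => k; rewrite /omega (wseq_perm _ _ st). Qed.

Lemma temperate_omega m s : temperate (omega m s).
Proof.
apply: temperateM; first exact: temperate_powR (temperate_Lam hLam).
exact: (temperate_wseq hLam).
Qed.

Lemma omega_mul m1 m2 s t k : omega m1 s k * omega m2 t k <= omega (m1 + m2) (s ++ t) k.
Proof.
rewrite /omega mulrACA -powRD; last by apply/implyP => _; rewrite gt_eqF.
by rewrite ler_wpM2l ?powR_ge0 // (wseq_mul hLam).
Qed.

Lemma omega_cons m l s k : omega m (l :: s) k <= omega (m - rho) s k.
Proof.
have e := Lam_powR_split hLam rho m 1 k; rewrite mulr1 expr1 in e.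
rewrite /omega e -mulrA ler_wpM2l ?powR_ge0 //.
exact: (wseq_cons hLam).
Qed.

Lemma omega_cons_le m : exists2 D : R, 0 <= D &
  forall l s k, omega m (l :: s) k <= D * omega m s k.
Proof.
have [D D0 hD] := wV_inv_bounded hLam rho_gt0; exists D => // l s k.
rewrite /omega mulrCA ler_wpM2l ?powR_ge0 //.
apply: le_trans (wseq_cons hLam _ _ _ _) _; apply: ler_wpM2r (hD k).
exact: ltW (wseq_gt0 hLam _ _ _).
Qed.

Lemma perm_mid l s t : perm_eq (s ++ l :: t) (l :: s ++ t).
Proof. by rewrite -[l :: t]cat1s perm_catCA. Qed.

Section Product.
Variables (P : Type) (A B : P -> R).
Hypotheses (A1 : forall p, 1 <= A p) (B0 : forall p, 0 <= B p).
Implicit Types (u v : P -> Zn -> R[i]).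

Definition decaying m s0 u : Prop := forall s K, exists2 C : R, 0 <= C &
  forall p k, normc (sdiff s (u p) k) <= C * A p ^- K * omega m (s0 ++ s) k.

Definition growing m s0 v : Prop := forall s, exists C : R, exists M : nat, 0 <= C /\
  forall p k, normc (sdiff s (v p) k) <= C * A p ^+ M * B p * omega m (s0 ++ s) k.

Lemma decaying_kdiff1 m s0 u l :
  decaying m s0 u -> decaying m (l :: s0) (fun p => kdiff1 l (u p)).
Proof.
move=> hu s K; have [C C0' hC] := hu (l :: s) K; exists C => // p k.
by rewrite sdiff_kdiff1 -sdiff_cons -(omega_perm _ (perm_mid l s0 s)).
Qed.

Lemma growing_kdiff1 m s0 v l :
  growing m s0 v -> growing m (l :: s0) (fun p => kdiff1 l (v p)).
Proof.
move=> hu s; have [C [M [C0' hC]]] := hu (l :: s); exists C, M; split=> // p k.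
by rewrite sdiff_kdiff1 -sdiff_cons -(omega_perm _ (perm_mid l s0 s)).
Qed.

(** The prefixes [s0] and [s1] record the differences that already fell on the
    factors; they let the induction on [s] distribute one more difference. *)
Lemma sdiff_mul_bound s : forall m1 m2 s0 s1 u v, decaying m1 s0 u -> growing m2 s1 v ->
  forall K, exists2 C : R, 0 <= C & forall p k,
    normc (sdiff s (fun k => u p k * v p k) k) <=
      C * A p ^- K * B p * omega (m1 + m2) (s0 ++ s1 ++ s) k.
Proof.
have A0 p : 0 < A p by exact: lt_le_trans ltr01 (A1 p).
elim: s => [|l s ih] m1 m2 s0 s1 u v hu hv K.
  have [D [M [D0 hD]]] := hv [::]; have [C C0' hC] := hu [::] (M + K)%N.
  exists (C * D) => [|p k]; first exact: mulr_ge0.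
  rewrite /= Normc.normcM cats0.
  apply: le_trans (ler_pM (normc_ge0 _) (normc_ge0 _) (hC p k) (hD p k)) _.
  rewrite !cats0.
  apply: (@le_trans _ _ (C * D * A p ^- K * B p * (omega m1 s0 k * omega m2 s1 k))).
    rewrite le_eqVlt; apply/orP; left; apply/eqP.
    have -> : A p ^- K = A p ^- (M + K) * A p ^+ M.
      by rewrite exprD invfM mulrAC mulVf ?mul1r // gt_eqF // exprn_gt0.
    by ring.
  apply: ler_wpM2l (omega_mul _ _ _ _ _).
  by rewrite !mulr_ge0 ?invr_ge0 ?exprn_ge0 ?(ltW (A0 p)).
have [D1 D10 hD1] := ih _ _ _ _ _ _ (decaying_kdiff1 l hu) hv K.
have [D2 D20 hD2] := ih _ _ _ _ _ _ hu (growing_kdiff1 l hv) K.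
have [D3 D30 hD3] := ih _ _ _ _ _ _ (decaying_kdiff1 l hu) (growing_kdiff1 l hv) K.
have [E E0 hE] := omega_cons_le (m1 + m2).
exists (D1 + D2 + D3 * E) => [|p k]; first by rewrite !addr_ge0 ?mulr_ge0.
rewrite sdiff_cons -sdiff_kdiff1 kdiff1M !sdiffD.
pose S := s0 ++ s1 ++ l :: s.
have c0 : 0 <= A p ^- K * B p by rewrite mulr_ge0 // invr_ge0 exprn_ge0 // ltW.
have pm1 : perm_eq ((l :: s0) ++ s1 ++ s) S.
  by rewrite /S perm_sym; have := perm_mid l (s0 ++ s1) s; rewrite -!catA.
have pm2 : perm_eq (s0 ++ (l :: s1) ++ s) S.
  by rewrite /S perm_cat2l perm_sym; exact: perm_mid.
have pm3 : perm_eq ((l :: s0) ++ (l :: s1) ++ s) (l :: S) by rewrite perm_cons pm2.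
have h1 := hD1 p k; rewrite (omega_perm _ pm1) in h1.
have h2 := hD2 p k; rewrite (omega_perm _ pm2) in h2.
have h3 := hD3 p k; rewrite (omega_perm _ pm3) in h3.
have {}h3 := le_trans h3 (ler_wpM2l _ (hE l S k)).
apply: le_trans (normcD_le _ _) _.
rewrite -/S [leRHS](_ : _ = (D1 * A p ^- K * B p * omega (m1 + m2) S k +
   D2 * A p ^- K * B p * omega (m1 + m2) S k) +
   D3 * A p ^- K * B p * (E * omega (m1 + m2) S k)); last by ring.
apply: lerD; last first.
  by apply: h3; rewrite -mulrA mulr_ge0.
by apply: le_trans (normcD_le _ _) (lerD h1 h2).
Qed.

End Product.

(** ** Newton expansion with remainder *)

Definition taylor_rem (N : nat) (f : Zn -> R[i]) k h : R[i] :=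
  f (k + h) - \sum_(a : {ffun 'I_n -> 'I_N} | (mi_size (fun j => a j) < N)%N)
    ((mi_fact (fun j => a j))%:R)^-1 * fallmx R (fun j => a j) h * kdiff (fun j => a j) f k.

(** The multi-indices of size at most N with a positive entry at [l] are those of
    size less than N raised by one at [l]. *)
Lemma sum_mi_shift (V : nmodType) N l (F : ('I_n -> nat) -> V) :
  \sum_(a : {ffun 'I_n -> 'I_N.+1} | (mi_size (fun j => a j) < N.+1)%N && (0 < a l)%N)
    F (fun j => a j) =
  \sum_(a : {ffun 'I_n -> 'I_N} | (mi_size (fun j => a j) < N)%N)
    F (fun j => (a j + (j == l))%N).
Proof.
have szD (b : 'I_n -> nat) : mi_size (fun j => (b j + (j == l))%N) = (mi_size b).+1.
  rewrite /mi_size big_split /= (bigD1 l (F := fun j => nat_of_bool (j == l))) //= eqxx.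
  by rewrite [X in (_ + (_ + X))%N]big1 ?addn0 ?addn1 // => j /negbTE ->.
case: N => [|N].
  rewrite big1; last first.
    move=> a /andP[_]; by case: (a l) => [[|//]].
  by rewrite big_pred0.
(* [phi] raises the entry at [l] by one and [psi] lowers it. *)
pose phi (a : {ffun 'I_n -> 'I_N.+1}) : {ffun 'I_n -> 'I_N.+2} :=
  [ffun j => inord (a j + (j == l))].
pose psi (a : {ffun 'I_n -> 'I_N.+2}) : {ffun 'I_n -> 'I_N.+1} :=
  [ffun j => inord (a j - (j == l))].
have phiE (a : {ffun 'I_n -> 'I_N.+1}) : (fun j => nat_of_ord (phi a j)) = fun j => (a j + (j == l))%N.
  apply/funext => j; rewrite ffunE inordK //.
  by have := ltn_ord (a j); case: (j == l); lia.
rewrite (reindex_onto phi psi) /=.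
  apply: eq_big => [a|a _]; last by rewrite phiE.
  rewrite phiE szD ltnS; have -> : (0 < phi a l)%N.
    by have /(congr1 (fun f => f l)) := phiE a; rewrite eqxx addn1 => ->.
  rewrite andbT; have -> : psi (phi a) == a.
    apply/eqP/ffunP => j; rewrite ffunE; apply/val_inj => /=.
    have /(congr1 (fun f => f j)) := phiE a => ->.
    by rewrite addnK inordK.
  by rewrite andbT.
move=> a /andP[sa al]; apply/ffunP => j; rewrite ffunE; apply/val_inj => /=.
have aj : (a j - (j == l) < N.+1)%N.
  case: eqVneq => [->|jl]; first by have := ltn_ord (a l); lia.
  move: sa; rewrite /mi_size (bigD1 l) //= (bigD1 j) //=; lia.
rewrite ffunE (inordK aj) inordK; last by have := aj; case: (j == l); lia.
by case: eqVneq => [->|_]; lia.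
Qed.

Lemma fall_succ (x : R[i]) m : fall (x + 1) m.+1 = (x + 1) * fall x m.
Proof.
rewrite /fall big_ord_recl subr0; congr (_ * _); apply: eq_bigr => i _.
by rewrite lift0 -natr1; ring.
Qed.

Lemma fall_diff (x : R[i]) m : fall (x + 1) m.+1 - fall x m.+1 = m.+1%:R * fall x m.
Proof. by rewrite fall_succ fallS -natr1; ring. Qed.

Lemma fallmx_step (a : 'I_n -> nat) h l :
  fallmx R a (h + unitv int l) - fallmx R a h =
  if (0 < a l)%N then (a l)%:R * fallmx R (fun j => (a j - (j == l))%N) h else 0.
Proof.
rewrite /fallmx (bigD1 l) //= [X in _ - X](bigD1 l) //=.
have -> : \prod_(i | i != l) fall (((h + unitv int l) 0 i)%:~R) (a i) =
    \prod_(i | i != l) fall ((h 0 i)%:~R) (a i) :> R[i].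
  by apply: eq_bigr => i il; rewrite !mxE (negbTE il) andbF addr0.
rewrite -mulrBl !mxE !eqxx intrD.
case: (posnP (a l)) => [->|al]; first by rewrite /fall !big_ord0 subrr mul0r.
rewrite [X in _ = _ * X](bigD1 l) //= eqxx subn1 -{1 2}(prednK al) fall_diff (prednK al) -mulrA.
congr (_ * (_ * _)); apply: eq_bigr => i /negbTE ->.
by rewrite subn0.
Qed.

Lemma kdiff_addl (a : 'I_n -> nat) l (f : Zn -> R[i]) :
  kdiff (fun j => (a j + (j == l))%N) f = kdiff a (kdiff1 l f).
Proof.
rewrite !kdiffE sdiff_kdiff1 -sdiff_cons; apply: sdiff_perm.
by apply/allP => j _; apply/eqP; rewrite /= !count_seq_of_mi addnC eq_sym.
Qed.

Lemma mi_fact_addl (a : 'I_n -> nat) l :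
  mi_fact (fun j => (a j + (j == l))%N) = ((a l).+1 * mi_fact a)%N.
Proof.
rewrite /mi_fact (bigD1 l) //= [in RHS](bigD1 l) //= eqxx addn1 factS mulnA.
by congr (_ * _)%N; apply: eq_bigr => j /negbTE ->; rewrite addn0.
Qed.

(** Pascal's rule for the coefficients binom(h, a).  This recursion is what makes
    the remainder small. *)
Lemma taylor_rem_step N f k h l :
  taylor_rem N.+1 f k (h + unitv int l) - taylor_rem N.+1 f k h =
  taylor_rem N (kdiff1 l f) k h.
Proof.
rewrite /taylor_rem [kdiff1 l f (k + h)](_ : _ = f (k + (h + unitv int l)) - f (k + h)); last first.
  by rewrite /kdiff1 addrA.
set S1 := \sum_(a | _) _; set S2 := \sum_(a | _) _; set S3 := \sum_(a | _) _.
have -> : S3 = S1 - S2; last by ring.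
rewrite /S1 /S2 -sumrB.
pose F (a : 'I_n -> nat) : R[i] := ((mi_fact a)%:R)^-1 *
  ((a l)%:R * fallmx R (fun j => (a j - (j == l))%N) h) * kdiff a f k.
rewrite [RHS](_ : _ = \sum_(a : {ffun 'I_n -> 'I_N.+1} |
    (mi_size (fun j => a j) < N.+1)%N && (0 < a l)%N) F (fun j => a j)).
  rewrite (@sum_mi_shift _ N l F); apply: eq_bigr => a _; rewrite /F kdiff_addl mi_fact_addl eqxx addn1.
  have -> : (fun j => (a j + (j == l) - (j == l))%N) = fun j => nat_of_ord (a j).
    by apply/funext => j; rewrite addnK.
  rewrite natrM invfM; congr (_ * _); rewrite mulrACA; field.
  rewrite pnatr_eq0 -lt0n /mi_fact prodn_gt0 /= => [|j]; last by rewrite fact_gt0.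
  by rewrite -[1]/(1%:R) -natrD pnatr_eq0.
rewrite [RHS]big_mkcondr /=; apply: eq_bigr => a _.
rewrite -mulrBl -mulrBr fallmx_step /F; case: ifP => //.
by rewrite mulr0 mul0r.
Qed.

Lemma taylor_rem0 N f k : taylor_rem N.+1 f k 0 = 0.
Proof.
rewrite /taylor_rem addr0 (bigD1 [ffun=> ord0]) /=; last first.
  by rewrite /mi_size big1 // => j _; rewrite ffunE.
rewrite [X in _ - (_ + X)]big1 ?addr0; last first.
  move=> a /andP[_ a0]; rewrite (_ : fallmx R _ 0 = 0) ?mulr0 ?mul0r //.
  have [j aj] : exists j, a j != ord0.
    apply/existsP; apply: contraR a0; rewrite negb_exists => /forallP hh.
    by apply/eqP/ffunP => j; rewrite ffunE; apply/eqP; rewrite -[_ == _]negbK hh.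
  rewrite /fallmx (bigD1 j) //= mxE.
  have : nat_of_ord (a j) != 0%N by apply: contraNneq aj => e; apply/eqP/val_inj.
  by case: (nat_of_ord (a j)) => // m _; rewrite /fall big_ord_recl subr0 mul0r mul0r.
have -> : (fun j : 'I_n => nat_of_ord ([ffun=> ord0] j : 'I_N.+1)) = fun=> 0%N.
  by apply/funext => j; rewrite ffunE.
rewrite /mi_fact big1 // invr1 mul1r /fallmx big1; last by move=> j _; rewrite /fall big_ord0.
rewrite mul1r kdiffE (_ : sdiff _ f = f) ?subrr //.
rewrite (@sdiff_perm _ _ _ [::]) //.
by apply/allP => j _; rewrite /= count_seq_of_mi.
Qed.

Lemma sdiff_taylor_rem N s f h : sdiff s (fun k => taylor_rem N f k h) =
  fun k => taylor_rem N (sdiff s f) k h.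
Proof.
elim: s => [//|l s ih]; rewrite !sdiff_cons ih; apply/funext => k.
rewrite /taylor_rem {1}/kdiff1 opprD addrACA -opprD; congr (_ - _).
  by rewrite /kdiff1 addrAC.
rewrite -sumrB; apply: eq_bigr => a _; rewrite -mulrBr; congr (_ * _).
by rewrite !kdiffE sdiff_kdiff1.
Qed.

(** For N = 0 the weight at [k + h] is compared with the weight at [k]; each
    further order is gained by one difference and costs a factor [jp h], by
    [telescope_bound] applied to [taylor_rem_step]. *)
Lemma taylor_bound (P : Type) (B : P -> R) (B0 : forall p, 0 <= B p) N : forall m (t : P -> Zn -> R[i]),
  (forall s, exists2 C : R, 0 <= C & forall p k, normc (sdiff s (t p) k) <= C * B p * omega m s k) ->
  forall s, exists C : R, exists M : nat, 0 <= C /\ forall p k h,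
    normc (taylor_rem N (sdiff s (t p)) k h) <= C * jp R h ^+ M * B p * omega (m - rho * N%:R) s k.
Proof.
elim: N => [|N ih] m t ht s.
  have [C C0' hC] := ht s; have [_ [D [M [D1 hD]]]] := temperate_omega m s.
  exists (C * D), M; split=> [|p k h]; first by rewrite mulr_ge0 // (le_trans ler01).
  rewrite mulr0 subr0 /taylor_rem big_pred0 // subr0.
  apply: le_trans (hC p (k + h)) _.
  rewrite [leRHS](_ : _ = C * B p * (D * jp R h ^+ M * omega m s k)); last by ring.
  by apply: ler_wpM2l; rewrite ?mulr_ge0.
have one l : exists CM : R * nat, 0 <= CM.1 /\ forall p k h,
    normc (taylor_rem N (kdiff1 l (sdiff s (t p))) k h) <=
    CM.1 * jp R h ^+ CM.2 * B p * omega (m - rho * N.+1%:R) s k.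
  have [|C [M [C0' hC]]] := ih (m - rho) (fun p => kdiff1 l (t p)) _ s.
    move=> s'; have [C C0' hC] := ht (l :: s'); exists C => // p k.
    rewrite sdiff_kdiff1 -sdiff_cons; apply: le_trans (hC p k) _.
    by apply: ler_wpM2l (omega_cons _ _ _ _); rewrite mulr_ge0.
  exists (C, M); split=> // p k h; rewrite /= -sdiff_kdiff1.
  apply: le_trans (hC p k h) _; rewrite -natr1 mulrDr mulr1 opprD addrA addrAC.
  by rewrite (addrAC m).
have [CM hCM] := choice one.
pose C := \sum_l (CM l).1; pose M := (\sum_l (CM l).2)%N.
have C0' : 0 <= C by apply: sumr_ge0 => l _; case: (hCM l).
exists C, M.+1; split=> // p k h.
have W0 := omega_ge0 (m - rho * N.+1%:R) s k.
have hl l h' : normc (taylor_rem N (kdiff1 l (sdiff s (t p))) k h') <=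
    C * B p * omega (m - rho * N.+1%:R) s k * jp R h' ^+ M.
  apply: le_trans ((hCM l).2 p k h') _.
  rewrite [leRHS](_ : _ = C * jp R h' ^+ M * B p * omega (m - rho * N.+1%:R) s k); last by ring.
  apply: ler_wpM2r => //; apply: ler_wpM2r => //; apply: ler_pM.
  - by case: (hCM l).
  - by rewrite exprn_ge0 ?jp_ge0.
  - rewrite /C (bigD1 l) //= lerDl sumr_ge0 // => i _; by case: (hCM i).
  - by apply: jp_exp_mono; rewrite /M (bigD1 l) //= leq_addr.
rewrite [leRHS](_ : _ = C * B p * omega (m - rho * N.+1%:R) s k * jp R h ^+ M.+1); last by ring.
apply: (@telescope_bound R n (fun h => normc (taylor_rem N.+1 (sdiff s (t p)) k h))).
- by rewrite taylor_rem0 Normc.normc0.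
- by apply: mulr_ge0 => //; exact: mulr_ge0.
- move=> h' l; apply: le_trans (lerD (lexx _) (hl l h')).
  by rewrite -taylor_rem_step; apply: le_trans (normcD_le _ _); rewrite subrKC.
- move=> h' l; apply: le_trans (lerD (lexx _) (hl l h')).
  rewrite -taylor_rem_step normcBC; apply: le_trans (normcD_le _ _).
  by rewrite subrKC.
Qed.

End DifferenceEstimates.

(** * Symbols and their Fourier coefficients *)

Section SymbolCoefficients.
Variables (R : realType) (n : nat) (mu0 mu1 mu C0 C1 : R).
Variables (Lam : 'rV[int]_n -> R) (hLam : weight_function mu0 mu1 mu C0 C1 Lam).
Variables (rho : R) (rho_gt0 : 0 < rho).
Local Notation Zn := 'rV[int]_n.
Local Notation omega := (omega Lam rho).
Implicit Types (k j : Zn) (l : 'I_n) (s t g h : seq 'I_n) (u : Zn -> Zn -> R[i]).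

Let Lam_gt0 k : 0 < Lam k. Proof. by case: hLam. Qed.

(** The class M of order [m], read off the Fourier coefficients: the bound
    [omega] holds with rapid decay in the frequency. *)
Definition coefM m u : Prop := forall s L, exists2 C : R, 0 <= C & forall k j,
  normc (sdiff s (fun k => u k j) k) <= C * jp R j ^- L * omega m s k.

Definition kps h k : int := \prod_(l <- h) k 0 l.

(** Interpolates between the definition of the class M (with [h] empty) and
    coefficient bounds on iterated differences (with [g] empty). *)
Definition mixed_bound m u h g : Prop := forall s L, exists2 C : R, 0 <= C & forall k j,
  normc ((kps h k)%:~R * sdiff (s ++ h) (fun k => (kps g k)%:~R * sdiff g (fun k => u k j) k) k)
  <= C * jp R j ^- L * Lam k `^ (m - rho * (size s)%:R).

Lemma kps_step l g k : l \notin g -> kps g (k + unitv int l) = kps g k.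
Proof.
move=> lg; rewrite /kps; apply: eq_big_seq => i ig; rewrite !mxE.
have /negbTE -> : i != l by apply: contraNneq lg => <-.
by rewrite andbF addr0.
Qed.

Lemma kdiff1_coordM l i (w : Zn -> R[i]) : kdiff1 i (fun k => (k 0 l)%:~R * w k) =
  fun k => (k 0 l)%:~R * kdiff1 i w k + (i == l)%:R * (w k + kdiff1 i w k).
Proof.
apply/funext => k; rewrite /kdiff1 !mxE eqxx /= [l == i]eq_sym intrD.
by case: (i == l); rewrite /= ?mul0r ?mul1r; ring.
Qed.

Lemma sdiff_coordM l t (v : Zn -> R[i]) : sdiff t (fun k => (k 0 l)%:~R * kdiff1 l v k) =
  fun k => (k 0 l)%:~R * sdiff (l :: t) v k +
    (count_mem l t)%:R * (sdiff t v k + sdiff (l :: t) v k).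
Proof.
elim: t => [|i t ih]; first by apply/funext => k; rewrite mul0r addr0.
rewrite sdiff_cons ih.
have e : sdiff (l :: i :: t) v = kdiff1 i (sdiff (l :: t) v).
  by rewrite -sdiff_cons; apply: sdiff_perm; rewrite (perm_catCA [:: l] [:: i] t).
apply/funext => k; rewrite e.
have -> : kdiff1 i (fun k => (k 0 l)%:~R * sdiff (l :: t) v k +
    (count_mem l t)%:R * (sdiff t v k + sdiff (l :: t) v k)) k =
  kdiff1 i (fun k => (k 0 l)%:~R * sdiff (l :: t) v k) k +
  (count_mem l t)%:R * (kdiff1 i (sdiff t v) k + kdiff1 i (sdiff (l :: t) v) k).
  by rewrite /kdiff1; ring.
rewrite kdiff1_coordM /= natrD [kdiff1 i (sdiff t v)]/(sdiff (i :: t) v).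
case: eqVneq => [->|_]; rewrite ?mul0r ?mul1r ?add0r ?addr0 //.
by rewrite /=; ring.
Qed.

Lemma mixed_step l h g (w : Zn -> R[i]) s k : l \notin h -> l \notin g ->
  let v := fun k => (kps g k)%:~R * sdiff g w k in
  (kps h k)%:~R * sdiff (s ++ h) (fun k => (kps (l :: g) k)%:~R * sdiff (l :: g) w k) k =
  (kps (l :: h) k)%:~R * sdiff (s ++ l :: h) v k +
  (count_mem l s)%:R * ((kps h k)%:~R * sdiff (s ++ h) v k +
     (kps h k)%:~R * sdiff ((l :: s) ++ h) v k).
Proof.
move=> lh lg v.
have -> : (fun k => (kps (l :: g) k)%:~R * sdiff (l :: g) w k) =
    fun k => (k 0 l)%:~R * kdiff1 l v k :> R[i].
  apply/funext => q; rewrite /v /kdiff1 kps_step // /kps big_cons intrM sdiff_cons /kdiff1; ring.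
rewrite sdiff_coordM count_cat (count_memPn lh) addn0.
rewrite (sdiff_perm _ (perm_mid l s h)) {2}/kps big_cons intrM -/(kps h k).
by rewrite -cat_cons; ring.
Qed.

(** Commuting [sdiff s] with the factor k_l leaves only terms governed by
    [mixed_bound m u h g], so that a factor k_l may change sides. *)
Lemma mixed_move l h g m u : l \notin h -> l \notin g -> mixed_bound m u h g ->
  (mixed_bound m u h (l :: g) <-> mixed_bound m u (l :: h) g).
Proof.
move=> lh lg hb.
have [D D0 hD] := wV_inv_bounded hLam rho_gt0.
pose v j := fun k => (kps g k)%:~R * sdiff g (fun k => u k j) k.
have err s L : exists2 C : R, 0 <= C & forall k j,
   normc ((count_mem l s)%:R * ((kps h k)%:~R * sdiff (s ++ h) (v j) k +
     (kps h k)%:~R * sdiff ((l :: s) ++ h) (v j) k))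
   <= C * jp R j ^- L * Lam k `^ (m - rho * (size s)%:R).
  have [C1' C10 hC1] := hb s L; have [C2 C20 hC2] := hb (l :: s) L.
  exists ((count_mem l s)%:R * (C1' + C2 * D)) => [|k j].
    by rewrite mulr_ge0 // addr_ge0 // mulr_ge0.
  have e : Lam k `^ (m - rho * (size (l :: s))%:R) <= D * Lam k `^ (m - rho * (size s)%:R).
    rewrite !(Lam_powR_split hLam) /= exprS invfM [leRHS]mulrCA.
    apply: ler_wpM2l; first exact: powR_ge0.
    by apply: ler_wpM2r; rewrite ?invr_ge0 ?exprn_ge0 ?(ltW (wV_gt0 hLam _ _)) // hD.
  have jp0 : 0 <= jp R j ^- L by rewrite invr_ge0 exprn_ge0 ?jp_ge0.
  rewrite Normc.normcM normc_nat -!mulrA; apply: ler_wpM2l => //.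
  apply: le_trans (normcD_le _ _) _; rewrite mulrDl; apply: lerD.
    by rewrite mulrA; exact: hC1.
  apply: le_trans (hC2 k j) _; rewrite -!mulrA; apply: ler_wpM2l => //.
  by rewrite [leRHS]mulrCA; apply: ler_wpM2l.
split=> hm s L; have [E E0 hE] := err s L; have [C C0' hC] := hm s L;
  (exists (C + E) => [|k j]; first exact: addr_ge0); rewrite !mulrDl.
  have -> : (kps (l :: h) k)%:~R * sdiff (s ++ l :: h)
      (fun k => (kps g k)%:~R * sdiff g (fun k => u k j) k) k =
    (kps h k)%:~R * sdiff (s ++ h) (fun k => (kps (l :: g) k)%:~R * sdiff (l :: g) (fun k => u k j) k) k
    - (count_mem l s)%:R * ((kps h k)%:~R * sdiff (s ++ h)
       (fun k => (kps g k)%:~R * sdiff g (fun k => u k j) k) k +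
     (kps h k)%:~R * sdiff ((l :: s) ++ h)
       (fun k => (kps g k)%:~R * sdiff g (fun k => u k j) k) k) :> R[i].
    by rewrite mixed_step // addrK.
  by apply: le_trans (normcB_le _ _) (lerD (hC k j) (hE k j)).
rewrite mixed_step //; exact: le_trans (normcD_le _ _) (lerD (hC k j) (hE k j)).
Qed.

Lemma mixed_from_left m u : (forall g, uniq g -> mixed_bound m u [::] g) ->
  forall h g, uniq (h ++ g) -> mixed_bound m u h g.
Proof.
move=> h0; elim=> [|l h ih] g /=; first exact: h0.
rewrite mem_cat negb_or => /andP[/andP[lh lg] uhg].
apply/mixed_move => //; apply: ih => //.
by rewrite (perm_uniq (perm_mid l h g)) /= mem_cat negb_or lh lg.
Qed.

Lemma mixed_from_right m u : (forall h, uniq h -> mixed_bound m u h [::]) ->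
  forall g h, uniq (h ++ g) -> mixed_bound m u h g.
Proof.
move=> h0; elim=> [|l g ih] h; first by rewrite cats0; exact: h0.
rewrite (perm_uniq (perm_mid l h g)) /= mem_cat negb_or => /andP[/andP[lh lg] uhg].
apply/mixed_move => //; apply: ih => //=.
by rewrite mem_cat negb_or lh lg.
Qed.

Lemma exprV_size (V : R) s : V ^- size s = \prod_l V ^- count_mem l s.
Proof.
rewrite -[in LHS](mi_size_count s) /mi_size expr_sum prodfV.
by [].
Qed.

Lemma kps_prod h k : uniq h -> `|(kps h k)%:~R : R| = \prod_l (if l \in h then `|(k 0 l)%:~R : R| else 1).
Proof.
by move=> uh; rewrite -big_mkcond /= -big_uniq //= /kps rmorph_prod normr_prod.
Qed.

Lemma normc_intr (z : int) : normc (z%:~R : R[i]) = `|z%:~R : R|.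
Proof. by rewrite normc_int intr_norm. Qed.

(** In each direction of [h] the factor k_l cancels the gain 1/max(V, |k_l|). *)
Lemma coefM_mixed m u : coefM m u -> forall h, uniq h -> mixed_bound m u h [::].
Proof.
move=> hu h uh s L; have [C C0' hC] := hu (s ++ h) L; exists C => // k j.
rewrite Normc.normcM normc_intr.
have -> : sdiff (s ++ h) (fun k => (kps [::] k)%:~R * sdiff [::] (fun k => u k j) k) =
    sdiff (s ++ h) (fun k => u k j).
  by congr sdiff; apply/funext => q; rewrite /kps big_nil mul1r.
apply: le_trans (ler_wpM2l (normr_ge0 _) (hC k j)) _.
rewrite mulrCA -!mulrA; apply: ler_wpM2l => //; apply: ler_wpM2l.
  by rewrite invr_ge0 exprn_ge0 ?jp_ge0.
rewrite (Lam_powR_split hLam) /omega mulrCA; apply: ler_wpM2l; first exact: powR_ge0.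
rewrite kps_prod // exprV_size /wseq -big_split /=; apply: ler_prod => l _.
have V0 := wV_gt0 hLam rho k; have q0 := wq_gt0 hLam rho l k; have Vq := wV_le_wq Lam rho l k.
have lq : `|(k 0 l)%:~R : R| <= wq Lam rho l k by rewrite /wq le_max lexx orbT.
apply/andP; split.
  by rewrite mulr_ge0 ?(ltW (wdir_gt0 _ V0 q0)) //; case: ifP.
rewrite count_cat (count_uniq_mem l uh); case: ifP => _ /=.
  rewrite addn1 /= mulrCA ler_piMr ?invr_ge0 ?exprn_ge0 ?(ltW V0) //.
  by rewrite ler_pdivrMr // mul1r.
rewrite mul1r addn0; case: (count_mem l s) => [|c] /=; first by rewrite expr0 invr1.
rewrite exprSr invfM; apply: ler_wpM2l; first by rewrite invr_ge0 exprn_ge0 // ltW.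
by rewrite lef_pV2 ?posrE.
Qed.

(** At each [k], use the bound for the set of those directions in which
    1/|k_l| is better than 1/V; there are finitely many such sets. *)
Lemma mixed_coefM m u : (forall h, uniq h -> mixed_bound m u h [::]) -> coefM m u.
Proof.
move=> hm s L.
(* [rest H] is [s] with one occurrence of each direction of [H] removed. *)
pose rest (H : {set 'I_n}) := seq_of_mi (fun l => (count_mem l s - (l \in H))%N).
have one (H : {set 'I_n}) : exists C : R, 0 <= C /\ forall k j,
    normc ((kps (enum H) k)%:~R * sdiff (rest H ++ enum H) (fun k => u k j) k) <=
    C * jp R j ^- L * Lam k `^ (m - rho * (size (rest H))%:R).
  have [C C0' hC] := hm (enum H) (enum_uniq _) (rest H) L; exists C; split=> // k j.
  have := hC k j; congr (normc (_ * sdiff _ _ _) <= _).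
  by apply/funext => q; rewrite /kps big_nil mul1r.
have [C hC] := choice one.
exists (\sum_H C H) => [|k j]; first by apply: sumr_ge0 => H _; case: (hC H).
have V0 := wV_gt0 hLam rho k.
pose H : {set 'I_n} := finset.finset (fun l => (l \in s) && (wV Lam rho k < `|(k 0 l)%:~R|)).
have restE l : (count_mem l (rest H) + (l \in H) = count_mem l s)%N.
  rewrite count_seq_of_mi subnK // inE.
  by case: (boolP (l \in s)) => //=; rewrite -has_pred1 has_count; case: (_ < _).
have ps : perm_eq s (rest H ++ enum H).
  apply/allP => l _; apply/eqP; rewrite count_cat /= -restE; congr (_ + _)%N.
  by rewrite count_uniq_mem ?enum_uniq // mem_enum.
rewrite (sdiff_perm _ ps).
have := (hC H).2 k j; rewrite Normc.normcM normc_intr.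
have kH : 0 < `|(kps (enum H) k)%:~R : R|.
  rewrite kps_prod ?enum_uniq //; apply: prodr_gt0 => l _; rewrite mem_enum inE.
  by case: ifP => // /andP[_]; apply: lt_trans.
rewrite mulrC -ler_pdivlMr // => h1; apply: le_trans h1 _.
have -> : Lam k `^ (m - rho * (size (rest H))%:R) = omega m s k * `|(kps (enum H) k)%:~R : R|.
  rewrite (Lam_powR_split hLam) /omega -mulrA; congr (_ * _).
  rewrite kps_prod ?enum_uniq // exprV_size /wseq -big_split; apply: eq_bigr => l _ /=.
  rewrite mem_enum -(restE l) inE /wq.
  case: (boolP (l \in s)) => /= ls; last first.
    have : (count_mem l s = 0)%N by apply/count_memPn.
    by rewrite -restE inE (negbTE ls) /= addn0 => ->; rewrite expr0 invr1 mulr1.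
  case: ltP => [Vk|kV].
    rewrite addn1 /= divfK // gt_eqF //; exact: lt_trans Vk.
  rewrite addn0 mulr1; have : (0 < count_mem l s)%N by rewrite -has_count has_pred1.
  rewrite -restE inE ls /= ltNge kV addn0; case: (count_mem l _) => // c _.
  by rewrite /= exprSr invfM.
rewrite [X in X / _]mulrA mulfK ?gt_eqF // -[leLHS]mulrA -[leRHS]mulrA.
apply: ler_wpM2r; last by rewrite (bigD1 H) //= lerDl sumr_ge0 // => i _; case: (hC i).
by rewrite mulr_ge0 ?invr_ge0 ?exprn_ge0 ?jp_ge0 // (omega_ge0 hLam).
Qed.

Lemma kpow_kps (g : 'I_n -> nat) k : kpow k g = kps (seq_of_mi g) k.
Proof.
rewrite /kpow /kps /seq_of_mi -big_enum; elim: (enum _) => [|l s ih] /=.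
  by rewrite !big_nil.
rewrite big_cons ih big_cat /=; congr (_ * _).
by elim: (g l) => [|c ihc] /=; rewrite ?big_nil ?expr0 // big_cons exprS ihc.
Qed.

Lemma torus_smooth_sdiff (sig : Zn -> 'rV[R]_n -> R[i]) s k :
  (forall k, torus_smooth (sig k)) ->
  torus_smooth (fun x => sdiff s (fun k => sig k x) k) /\
  forall j, coef (fun x => sdiff s (fun k => sig k x) k) j = sdiff s (fun k => coef (sig k) j) k.
Proof.
move=> hs; elim: s k => [|i s ih] k; first by split=> //; exact: hs.
have [s1 c1] := ih (k + unitv int i); have [s2 c2] := ih k.
split; first exact: (torus_smoothB s1 s2).
move=> j; rewrite sdiff_cons /kdiff1 -c1 -c2 /coef.
have ce := @ccont_ek R n j.
rewrite -torus_intB; try (apply: ccontM => //; exact: torus_smooth_ccont).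
by congr torus_int; apply/funext => x; rewrite sdiff_cons /kdiff1 mulrBr.
Qed.

Lemma coefZ (c : R[i]) (f : 'rV[R]_n -> R[i]) j : torus_smooth f ->
  coef (fun x => c * f x) j = c * coef f j.
Proof.
move=> sf; rewrite /coef -torus_intZ; last first.
  by apply: ccontM; [exact: ccont_ek | exact: torus_smooth_ccont].
by congr torus_int; apply/funext => x; rewrite mulrCA.
Qed.

(** Integration by parts gives the bounds with all factors k_l inside the
    differences; [mixed_from_left] moves them outside. *)
Lemma symbol_M_coefM m sig : symbol_M Lam rho m sig ->
  coefM m (fun k j => coef (sig k) j).
Proof.
move=> [sm hS]; apply: mixed_coefM => h uh.
apply: mixed_from_left; last by rewrite cats0.
move=> g ug s L.
have [|_ hb] := hS (fun l => count_mem l g).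
  by move=> l; rewrite count_uniq_mem //; case: (_ \in _).
pose sg k (x : 'rV[R]_n) := (kps g k)%:~R * sdiff g (fun k => sig k x) k : R[i].
have sgE : (fun k x => (kpow k (fun l => count_mem l g))%:~R *
    kdiff (fun l => count_mem l g) (fun q => sig q x) k) = sg :> (Zn -> 'rV[R]_n -> R[i]).
  apply/funext => k; apply/funext => x; rewrite -sdiff_kdiff kpow_kps /sg.
  by congr (_%:~R * _); apply: perm_big; exact: perm_seq_of_count.
have ssg k : torus_smooth (sg k).
  by apply: torus_smoothZ; exact: (torus_smooth_sdiff g k sm).1.
have [|k|b|C C0' hC] := @coef_decay R n Zn (fun k => Lam k `^ (m - rho * (size s)%:R))
    (fun k x => sdiff s (fun k => sg k x) k) _ _ _ L.
- by move=> k; exact: powR_ge0.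
- exact: (torus_smooth_sdiff s k ssg).1.
- have [C C0' hC] := hb (fun l => count_mem l s) b.
  exists C => [|k x]; first exact: ltW.
  have := hC k x; rewrite mi_size_count.
  have E y : kdiff (fun l => count_mem l s) (fun r => (kpow r (fun l => count_mem l g))%:~R *
      kdiff (fun l => count_mem l g) (fun q => sig q y) r) k = sdiff s (fun k => sg k y) k.
    rewrite -sdiff_kdiff; congr (sdiff _ _ _); apply/funext => q.
    by rewrite -sgE.
  by rewrite (_ : (fun y => _) = (fun y => sdiff s (fun k => sg k y) k)) //; apply/funext => y.
exists C => // k j; rewrite {1}/kps big_nil mul1r cats0.
have := hC k j; rewrite (torus_smooth_sdiff s k ssg).2 mulrAC.
congr (normc (sdiff _ _ _) <= _); apply/funext => q.
by rewrite /sg coefZ ?(torus_smooth_sdiff g q sm).2 //; exact: (torus_smooth_sdiff g q sm).1.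
Qed.

Lemma coefM_rapid m u k : coefM m u -> rapid (u k).
Proof.
move=> hu L; have [C C0' hC] := hu [::] L.
exists (C * omega m [::] k) => [|j]; first by rewrite mulr_ge0 // (omega_ge0 hLam).
by rewrite mulrAC; exact: hC.
Qed.

Lemma sdiff_fourier (w : Zn -> Zn -> R[i]) s k : (forall k, rapid (w k)) ->
  rapid (fun j => sdiff s (fun k => w k j) k) /\
  forall x : 'rV[R]_n, sdiff s (fun k => fourier (w k) x) k = fourier (fun j => sdiff s (fun k => w k j) k) x.
Proof.
move=> hw; elim: s k => [|i s ih] k; first by split=> //; exact: hw.
have [r1 f1] := ih (k + unitv int i); have [r2 f2] := ih k.
split; first exact: (rapidB r1 r2).
by move=> x; rewrite sdiff_cons /kdiff1 f1 f2 -fourierB.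
Qed.

Lemma fourier_bound c B N (x : 'rV[R]_n) : (n.*2 <= N)%N -> rapid c ->
  (forall j : Zn, normc (c j) <= B * jp R j ^- N) ->
  forall S, (forall F : {fset Zn}, \sum_(j <- F) jp R j ^- N <= S) -> 0 <= B ->
  normc (fourier c x) <= B * S.
Proof.
move=> nN hc cB S hS B0; rewrite fourierE; apply: clsum_norm_le; first exact: rapid_dominated.
move=> F; apply: le_trans (ler_wpM2l B0 (hS F)); rewrite mulr_sumr; apply: ler_sum => j _.
by rewrite Normc.normcM normc_ek mul1r.
Qed.

(** The multipliers of the derivatives grow polynomially, which the decay of the
    coefficients absorbs when the series is differentiated termwise. *)
Lemma coefM_symbol_M m u : coefM m u -> symbol_M Lam rho m (fun k => fourier (u k)).
Proof.
move=> hu; have ru k := coefM_rapid k hu.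
have sm k : torus_smooth (fourier (u k) : 'rV[R]_n -> R[i]) by exact: fourier_torus_smooth.
split=> // gam gam1.
pose g := seq_of_mi gam.
have ug : uniq g.
  apply/(@count_mem_uniq _ g) => l; rewrite /g count_seq_of_mi.
  have := gam1 l; rewrite -has_pred1 has_count count_seq_of_mi.
  by case: (gam l) => [|[|]].
have rsg s k : rapid (fun j => sdiff s (fun k => (kps g k)%:~R * sdiff g (fun k => u k j) k) k).
  apply: (sdiff_fourier s k _).1 => q; apply: rapidZ; exact: (sdiff_fourier g q ru).1.
have EF s k x : sdiff s (fun k => (kpow k gam)%:~R * kdiff gam (fun q => fourier (u q) x) k) k =
    fourier (fun j => sdiff s (fun k => (kps g k)%:~R * sdiff g (fun k => u k j) k) k) (x : 'rV[R]_n).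
  rewrite -(sdiff_fourier s k (rsg [::])).2; congr (sdiff _ _ _); apply/funext => q.
  rewrite kpow_kps kdiffE -/g (sdiff_fourier g q ru).2 -fourierZ //.
  exact: (sdiff_fourier g q ru).1.
split.
  move=> k; rewrite (_ : (fun x => _) = fourier (fun j => (kps g k)%:~R * sdiff g (fun k => u k j) k)).
    exact: fourier_torus_smooth (rsg [::] k).
  by apply/funext => x; exact: (EF [::] k x).
move=> a b; pose s := seq_of_mi a.
have mg : mixed_bound m u [::] g by apply: (mixed_from_right (coefM_mixed hu)).
have [C C0' hC] := mg s (mi_size b + n.*2)%N.
have [B B0 hB] := fallmx_norm_le R b.
have [_ [S hS]] := summ_jp R (leqnn n.*2).
have S0 : 0 <= S by have := hS fset0; rewrite big_seq_fset0.
exists (B * C * S + 1) => [|k x]; first by rewrite ltr_wpDl // !mulr_ge0.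
rewrite (_ : (fun y => _) = fourier (fun j => sdiff s (fun k => (kps g k)%:~R * sdiff g (fun k => u k j) k) k)); last first.
  by apply/funext => y; rewrite kdiffE EF.
rewrite Dx_fourier //.
have W0 : 0 <= Lam k `^ (m - rho * (mi_size a)%:R) by exact: powR_ge0.
apply: (@le_trans _ _ (B * C * Lam k `^ (m - rho * (mi_size a)%:R) * S)).
  apply: (@fourier_bound _ _ n.*2) => //.
  - apply: (@rapid_mul _ _ _ _ (mi_size b) B) (rsg s k) => j.
    by rewrite -(jpN R j).
  - move=> j; rewrite Normc.normcM.
    have := hC k j; rewrite {1}/kps big_nil mul1r cats0 /s size_seq_of_mi => h1.
    have h2 := hB (- j); rewrite jpN in h2.
    apply: le_trans (ler_pM (normc_ge0 _) (normc_ge0 _) h2 h1) _.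
    rewrite -(jp_exp_split R j (mi_size b) n.*2) le_eqVlt; apply/orP; left; apply/eqP; ring.
  - by rewrite !mulr_ge0.
rewrite mulrDl mul1r mulrAC lerDl; exact: W0.
Qed.

End SymbolCoefficients.

(** * Composition of pseudo-differential operators *)

Section Kernel.
Variables (R : realType) (n : nat).
Local Notation Zn := 'rV[int]_n.
Implicit Types (k l j : Zn).

Lemma jp_exp_le_mul k l L : jp R (k - l) ^- L <= jp R l ^+ L * jp R k ^- L.
Proof.
rewrite ler_pdivlMr ?jp_exp_gt0 // mulrC ler_pdivrMr ?jp_exp_gt0 // -exprMn.
rewrite lerXn2r ?nnegrE ?jp_ge0 ?mulr_ge0 ?jp_ge0 // mulrC.
by rewrite -[X in jp R X](subrK l) jpD.
Qed.

(** Decay in [k - j] is turned into decay in [k] at the price of a power of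
    [jp j], and n.*2 further powers of [jp j] make the sum converge. *)
Lemma convolution_bound L : exists2 S : R, 0 <= S &
  forall (w : Zn -> R[i]) k B, 0 <= B ->
  (forall j, normc (w j) <= B * jp R j ^- (L + n.*2) * jp R (k - j) ^- L) ->
  dominated w /\ normc (clsum w) <= B * S * jp R k ^- L.
Proof.
have [b0 [S hS]] := summ_jp R (leqnn n.*2).
have S0 : 0 <= S by have := hS fset0; rewrite big_seq_fset0.
exists S => // w k B B0 hw.
have wb j : normc (w j) <= B * jp R k ^- L * jp R j ^- n.*2.
  apply: le_trans (hw j) _; rewrite -mulrA -[leRHS]mulrA; apply: ler_wpM2l => //.
  apply: le_trans (ler_wpM2l _ (jp_exp_le_mul k j L)) _.
    by rewrite invr_ge0 exprn_ge0 ?jp_ge0.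
  by rewrite -(jp_exp_split R j L n.*2) le_eqVlt; apply/orP; left; apply/eqP; ring.
have B1 : 0 <= B * jp R k ^- L by rewrite mulr_ge0 // invr_ge0 exprn_ge0 ?jp_ge0.
have dw : dominated w.
  exists (fun j => B * jp R k ^- L * jp R j ^- n.*2) => //.
  by apply: summZ => //; exact: summ_jp.
split=> //; apply: clsum_norm_le => // F.
apply: le_trans (ler_sum _ (fun j _ => wb j)) _.
by rewrite -mulr_sumr [leRHS]mulrAC; apply: ler_wpM2l.
Qed.

Lemma fourier_bounded (c : Zn -> R[i]) : rapid c ->
  exists2 G : R, 0 <= G & forall x : 'rV[R]_n, normc (fourier c x) <= G.
Proof.
move=> hc; have [C C0 hC] := hc n.*2; have [_ [S hS]] := summ_jp R (leqnn n.*2).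
have S0 : 0 <= S by have := hS fset0; rewrite big_seq_fset0.
exists (C * S) => [|x]; first exact: mulr_ge0.
exact: (@fourier_bound R n c C n.*2 x (leqnn _) hc hC S hS C0).
Qed.

(** Expanding [fourier f] under the integral leaves the Fourier coefficients of
    the symbol. *)
Lemma pdo_kernel (s : Zn -> Zn -> R[i]) (f : Zn -> R[i]) k : rapid (s k) -> rapid f ->
  pdo (R := R) (fun k => fourier (s k)) f k = clsum (fun l => f l * s k (k - l)).
Proof.
move=> hs hf; have [b sb hb] := rapid_summ hf; have [G G0 hG] := fourier_bounded hs.
have cs := ccont_fourier hs; have ce q := @ccont_ek R n q.
rewrite /pdo.
transitivity (torus_int (fun x : 'rV[R]_n => (ek k x * fourier (s k) x) *
    clsum (fun l => ek (- l) x * f l))).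
  by congr torus_int; apply/funext => x; rewrite [fourier f x]fourierE.
rewrite (@torus_int_clsum _ _ _ G _ b) //.
- congr clsum; apply/funext => l.
  transitivity (f l * coef (fourier (s k)) (k - l)); last by rewrite coef_fourier.
  rewrite /coef -torus_intZ; last exact: ccontM.
  by congr torus_int; apply/funext => x; rewrite ekD; ring.
- exact: ccontM.
- by move=> x; rewrite Normc.normcM normc_ek mul1r.
- by move=> l; apply: ccontM => //; exact: ccont_cst.
- by move=> l x; rewrite Normc.normcM normc_ek mul1r.
Qed.

(** Both sides are continuous, so that comparing coefficients suffices. *)
Lemma fourier_mul (c d : Zn -> R[i]) x : rapid c -> rapid d ->
  rapid (fun l => clsum (fun j => c j * d (l - j))) /\
  fourier c x * fourier d x = fourier (fun l => clsum (fun j => c j * d (l - j))) (x : 'rV[R]_n).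
Proof.
move=> hc hd.
have conv L : exists2 C : R, 0 <= C & forall l,
    normc (clsum (fun j => c j * d (l - j))) <= C * jp R l ^- L.
  have [S S0 hS] := convolution_bound L.
  have [C C0 hC] := hc (L + n.*2)%N; have [D D0 hD] := hd L.
  exists (C * D * S) => [|l]; first by rewrite !mulr_ge0.
  apply: (hS _ l _ _ _).2; first exact: mulr_ge0.
  move=> j; rewrite Normc.normcM.
  apply: le_trans (ler_pM (normc_ge0 _) (normc_ge0 _) (hC j) (hD (l - j))) _.
  by rewrite le_eqVlt; apply/orP; left; apply/eqP; ring.
split=> //.
have cc := ccont_fourier hc; have cd := ccont_fourier hd; have ce q := @ccont_ek R n q.
have cf := ccont_fourier conv.
apply/eqP; rewrite -subr_eq0; apply/eqP.
apply: (@fourier_uniq _ _ (fun x => fourier c x * fourier d x - fourier (fun l => clsum (fun j => c j * d (l - j))) x)).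
- by apply: ccontB => //; exact: ccontM.
- by move=> j y; rewrite !fourier_periodic.
move=> l; have [b sb hb] := rapid_summ hc; have [G G0 hG] := fourier_bounded hd.
transitivity (torus_int (fun x : 'rV[R]_n => ek l x * (fourier c x * fourier d x)) -
   coef (fourier (fun l => clsum (fun j => c j * d (l - j)))) l).
  rewrite /coef -torus_intB; try (by do ?[exact: ce | exact: cc | exact: cd | exact: cf| apply: ccontM]).
  by congr torus_int; apply/funext => y; rewrite mulrBr.
rewrite coef_fourier // (_ : torus_int _ = clsum (fun j => c j * d (l - j))) ?subrr //.
transitivity (torus_int (fun x : 'rV[R]_n => (ek l x * fourier d x) *
    clsum (fun j => ek (- j) x * c j))).
  by congr torus_int; apply/funext => y; rewrite [fourier c y]fourierE; ring.
rewrite (@torus_int_clsum _ _ _ G _ b) //.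
- congr clsum; apply/funext => j; rewrite -(coef_fourier (l - j) hd) /coef -torus_intZ; last exact: ccontM.
  by congr torus_int; apply/funext => y; rewrite ekD; ring.
- exact: ccontM.
- by move=> y; rewrite Normc.normcM normc_ek mul1r.
- by move=> j; apply: ccontM => //; exact: ccont_cst.
- by move=> j y; rewrite Normc.normcM normc_ek mul1r.
Qed.

End Kernel.

Section Composition.
Variables (R : realType) (n : nat) (mu0 mu1 mu C0 C1 : R).
Variables (Lam : 'rV[int]_n -> R) (hLam : weight_function mu0 mu1 mu C0 C1 Lam).
Variables (rho : R) (rho_gt0 : 0 < rho) (m1 m2 : R).
Local Notation Zn := 'rV[int]_n.
Local Notation omega := (omega Lam rho).
Local Notation coefM := (coefM Lam rho).
Variables (s t : Zn -> Zn -> R[i]).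
Hypotheses (hs : coefM m1 s) (ht : coefM m2 t).
Implicit Types (k l i j : Zn) (q : seq 'I_n).

(** The coefficients of the N-th remainder of the composed symbol; the
    composed symbol itself is the case N = 0. *)
Definition comp_rem N k i : R[i] :=
  clsum (fun j => s k j * taylor_rem N (fun k => t k (i - j)) k (- j)).

(** Leibniz' rule with the frequencies (j, i) as parameters: the factor [s] decays
    in j, the Newton remainder grows in j and decays in i - j. *)
Let summand_bound N q L : exists2 C : R, 0 <= C & forall i k j,
  normc (sdiff q (fun k => s k j * taylor_rem N (fun k => t k (i - j)) k (- j)) k) <=
  C * omega (m1 + m2 - rho * N%:R) q k * jp R j ^- (L + n.*2) * jp R (i - j) ^- L.
Proof.
pose B (p : Zn * Zn) : R := jp R (p.2 - p.1) ^- L.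
have B0 p : 0 <= B p by rewrite invr_ge0 exprn_ge0 ?jp_ge0.
have dec : decaying Lam rho (fun p : Zn * Zn => jp R p.1) m1 [::] (fun p k => s k p.1).
  move=> q' K; have [C C0' hC] := hs q' K; exists C => // p k; exact: hC.
have gro : growing Lam rho (fun p : Zn * Zn => jp R p.1) B (m2 - rho * N%:R) [::]
    (fun p k => taylor_rem N (fun k => t k (p.2 - p.1)) k (- p.1)).
  move=> q'; have [|C [M [C0' hC]]] := @taylor_bound _ _ _ _ _ _ _ _ hLam _ rho_gt0 _ B B0 N m2
      (fun p k => t k (p.2 - p.1)) _ q'.
    move=> q0; have [C C0' hC] := ht q0 L; exists C => // p k; exact: hC.
  exists C, M; split=> // p k; rewrite sdiff_taylor_rem.
  by have := hC p k (- p.1); rewrite jpN.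
have [C C0' hC] := sdiff_mul_bound hLam rho_gt0 (fun p => jp_ge1 R p.1) B0 q dec gro (L + n.*2).
exists C => // i k j; have := hC (j, i) k; rewrite /= addrA; move=> h.
by apply: le_trans h _; rewrite le_eqVlt; apply/orP; left; apply/eqP; rewrite /B /=; ring.
Qed.

Let summand_dominated N q i k :
  dominated (fun j => sdiff q (fun k => s k j * taylor_rem N (fun k => t k (i - j)) k (- j)) k).
Proof.
have [C C0' hC] := summand_bound N q 0; have [S S0 hS] := convolution_bound R n 0.
apply: (hS _ i (C * omega (m1 + m2 - rho * N%:R) q k) _ (hC i k)).1.
by rewrite mulr_ge0 // (omega_ge0 hLam).
Qed.

Lemma sdiff_comp_rem N q i k : sdiff q (fun k => comp_rem N k i) k =
  clsum (fun j => sdiff q (fun k => s k j * taylor_rem N (fun k => t k (i - j)) k (- j)) k).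
Proof.
elim: q k => [//|l q ih] k; rewrite sdiff_cons /kdiff1 !ih -clsumB //.
Qed.

Lemma coefM_comp_rem N : coefM (m1 + m2 - rho * N%:R) (comp_rem N).
Proof.
move=> q L; have [C C0' hC] := summand_bound N q L; have [S S0 hS] := convolution_bound R n L.
exists (C * S) => [|k i]; first exact: mulr_ge0.
rewrite sdiff_comp_rem.
have W0 := omega_ge0 hLam rho (m1 + m2 - rho * N%:R) q k.
apply: le_trans (hS _ i _ _ (hC i k)).2 _; first exact: mulr_ge0.
by rewrite le_eqVlt; apply/orP; left; apply/eqP; ring.
Qed.

Let rs k : rapid (s k). Proof. exact: (coefM_rapid hLam k hs). Qed.
Let rt k : rapid (t k). Proof. exact: (coefM_rapid hLam k ht). Qed.

Lemma comp_rem0E k i : comp_rem 0 k i = clsum (fun j => s k j * t (k - j) (i - j)).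
Proof.
congr clsum; apply/funext => j; rewrite /taylor_rem big_pred0 ?subr0 // => a.
Qed.

Lemma dominated_comp0 k i : dominated (fun j => s k j * t (k - j) (i - j)).
Proof.
have := summand_dominated 0 [::] i k; congr dominated; apply/funext => j.
by rewrite /= /taylor_rem big_pred0 ?subr0.
Qed.

Lemma coefM_growth m u : coefM m u -> exists M : nat, forall L, exists2 C : R, 0 <= C &
  forall k j, normc (u k j) <= C * jp R k ^+ M * jp R j ^- L.
Proof.
move=> hu; have [_ [D [M [D1 hD]]]] := temperate_omega hLam rho_gt0 m [::].
exists M => L; have [C C0' hC] := hu [::] L.
have W0 := omega_ge0 hLam rho m [::] 0.
exists (C * D * omega m [::] 0) => [|k j].
  by rewrite mulr_ge0 // mulr_ge0 // (le_trans ler01).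
apply: le_trans (hC k j) _.
have := hD 0 k; rewrite add0r => h1.
have c0 : 0 <= C * jp R j ^- L by rewrite mulr_ge0 // invr_ge0 exprn_ge0 ?jp_ge0.
apply: le_trans (ler_wpM2l c0 h1) _.
by rewrite le_eqVlt; apply/orP; left; apply/eqP; ring.
Qed.

(** The matrix [t k (k - l)] decays off the diagonal and grows polynomially in
    [k]. *)
Lemma pdo_rapid f : rapid f -> rapid (pdo (R := R) (fun k => fourier (t k)) f).
Proof.
move=> hf L; have [M hM] := coefM_growth ht.
have [C C0' hC] := hM (M + L)%N; have [F F0 hF] := hf (M + L + n.*2)%N.
have [S S0 hS] := convolution_bound R n (M + L).
exists (F * C * S) => [|k]; first by rewrite !mulr_ge0.
rewrite pdo_kernel //.
have e0 : 0 <= F * C * jp R k ^+ M by rewrite !mulr_ge0 // exprn_ge0 ?jp_ge0.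
apply: le_trans (hS _ k _ e0 _).2 _ => [l|].
  rewrite Normc.normcM.
  apply: le_trans (ler_pM (normc_ge0 _) (normc_ge0 _) (hF l) (hC k (k - l))) _.
  by rewrite le_eqVlt; apply/orP; left; apply/eqP; ring.
rewrite -(jp_exp_split R k M L) le_eqVlt; apply/orP; left; apply/eqP; ring.
Qed.

(** The product of the two matrices, summed in the other order: for fixed [k] the
    summand is dominated by a summable function of [j] times |f|. *)
Lemma pdo_comp f : rapid f ->
  pdo (R := R) (fun k => fourier (s k)) (pdo (R := R) (fun k => fourier (t k)) f) =
  pdo (R := R) (fun k => fourier (comp_rem 0 k)) f.
Proof.
move=> hf; apply/funext => k.
have hg := pdo_rapid hf.
have hc0 := coefM_comp_rem 0; have rc : rapid (comp_rem 0 k) by exact: (coefM_rapid hLam k hc0).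
rewrite !pdo_kernel //.
have refl : cancel (fun j => k - j) (fun j => k - j) by move=> j; rewrite subKr.
have [b sb hb] := rapid_summ hf.
have dl : dominated (fun l => pdo (R := R) (fun k => fourier (t k)) f l * s k (k - l)).
  have [Gb Gs Gh] := rapid_summ hg; have [C C0' hC] := rs k 0.
  exists (fun l => C * Gb l) => [|l]; first exact: summZ.
  rewrite Normc.normcM mulrC; apply: ler_pM; rewrite ?normc_ge0 //.
  by have := hC (k - l); rewrite expr0 invr1 mulr1.
rewrite -(clsum_reindex refl refl dl) /=.
have -> : (fun l => f l * comp_rem 0 k (k - l)) =
   fun l => f l * clsum (fun j => s k j * t (k - j) (k - l - j)).
  by apply/funext => l; rewrite comp_rem0E.
pose bounded (v : Zn -> R[i]) := exists B : R, forall l, normc (v l) <= B.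
have dom_bd v : bounded v -> dominated (fun l => f l * v l).
  move=> [B hB]; exists (fun l => B * b l) => [|l].
    by apply: summZ => //; apply: le_trans (normc_ge0 _) (hB 0).
  by rewrite Normc.normcM mulrC; apply: ler_pM; rewrite ?normc_ge0.
have [_ [S hS]] := sb.
have S0 : 0 <= S by have := hS fset0; rewrite big_seq_fset0.
have [M /(_ 0%N)[D D0 hD]] := coefM_growth ht.
have [E E0 hE] := rs k (M + n.*2)%N.
pose w j := E * D * jp R k ^+ M * jp R j ^- n.*2.
have kM : 0 <= jp R k ^+ M by rewrite exprn_ge0 ?jp_ge0.
have sw : summ w by apply: summZ; [rewrite !mulr_ge0 | exact: summ_jp].
have vw j l : normc (s k j * t (k - j) (k - l - j)) <= w j.
  rewrite Normc.normcM.
  have h2 : normc (t (k - j) (k - l - j)) <= D * (jp R k ^+ M * jp R j ^+ M).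
    apply: le_trans (hD _ _) _; rewrite expr0 invr1 mulr1; apply: ler_wpM2l => //.
    by rewrite -exprMn lerXn2r ?nnegrE ?jp_ge0 ?mulr_ge0 ?jp_ge0 // jp_sub.
  apply: le_trans (ler_pM (normc_ge0 _) (normc_ge0 _) (hE j) h2) _.
  by rewrite /w -(jp_exp_split R j M n.*2) le_eqVlt; apply/orP; left; apply/eqP; ring.
rewrite (@clsum_exchange _ _ _ bounded (fun v => clsum (fun l => f l * v l)) S
   (fun j l => s k j * t (k - j) (k - l - j)) w) //.
- congr clsum; apply/funext => j; rewrite /comp /= subKr pdo_kernel // mulrC -clsumZ.
    by congr clsum; apply/funext => l; rewrite mulrCA [k - l - j]addrAC.
  apply: dom_bd; have [C C0' hC] := rt (k - j) 0; exists C => l.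
  by have := hC (k - j - l); rewrite expr0 invr1 mulr1.
- by exists 0 => l; rewrite Normc.normc0.
- move=> u v [B hB] [B' hB']; exists (B + B') => l.
  by apply: le_trans (normcB_le _ _) (lerD (hB l) (hB' l)).
- move=> u v hu hv; rewrite -clsumB; try exact: dom_bd.
  by congr clsum; apply/funext => l; rewrite mulrBr.
- move=> v B B0 bv hv; apply: clsum_norm_le; first exact: dom_bd.
  move=> F; apply: le_trans (_ : \sum_(l <- F) B * b l <= _).
    by apply: ler_sum => l _; rewrite Normc.normcM mulrC; apply: ler_pM; rewrite ?normc_ge0.
  by rewrite -mulr_sumr mulrC; apply: ler_wpM2r.
- by move=> j; exists (w j) => l; exact: vw.
- have [_ [W hW]] := sw; exists W => l; apply: clsum_norm_le; first by exists w.
  by move=> F; apply: le_trans (hW F); apply: ler_sum => j _; exact: vw.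
Qed.

Lemma expansion_term_fourier (a : 'I_n -> nat) k (x : 'rV[R]_n) :
  let c i := clsum (fun j => s k j *
    (((mi_fact a)%:R)^-1 * fallmx R a (- j) * kdiff a (fun r => t r (i - j)) k)) in
  [/\ rapid c, (forall i, dominated (fun j => s k j *
    (((mi_fact a)%:R)^-1 * fallmx R a (- j) * kdiff a (fun r => t r (i - j)) k))) &
  expansion_term (fun k => fourier (s k)) (fun k => fourier (t k)) a k x = fourier c x].
Proof.
move=> c.
have [B B0 hB] := fallmx_norm_le R a.
pose sa j : R[i] := ((mi_fact a)%:R)^-1 * (fallmx R a (- j) * s k j).
have rfs : rapid (fun j => fallmx R a (- j) * s k j).
  by apply: (@rapid_mul _ _ _ _ (mi_size a) B) (rs k) => j; rewrite -(jpN R j).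
have rsa : rapid sa by exact: rapidZ.
have [rta fta] := sdiff_fourier (seq_of_mi a) k rt.
have [rc fc] := fourier_mul x rsa rta.
have E i j : s k j * (((mi_fact a)%:R)^-1 * fallmx R a (- j) * kdiff a (fun r => t r (i - j)) k) =
   sa j * sdiff (seq_of_mi a) (fun k => t k (i - j)) k.
  by rewrite kdiffE /sa; ring.
have cE : c = fun i => clsum (fun j => sa j * sdiff (seq_of_mi a) (fun k => t k (i - j)) k).
  by apply/funext => i; congr clsum; apply/funext => j.
split.
- by rewrite cE.
- move=> i; rewrite (_ : (fun j => _) = fun j => sa j * sdiff (seq_of_mi a) (fun k => t k (i - j)) k); last first.
    by apply/funext => j.
  have [Sb Ss Sh] := rapid_summ rsa; have [C C0' hC] := rta 0.
  exists (fun j => C * Sb j) => [|j]; first exact: summZ.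
  rewrite Normc.normcM mulrC; apply: ler_pM; rewrite ?normc_ge0 //.
  by have := hC (i - j); rewrite expr0 invr1 mulr1.
- rewrite cE -fc /sa fourierZ // /expansion_term Dx_fourier // kdiffE fta.
  by rewrite -mulrA.
Qed.

(** The terms of the expansion are the Newton terms subtracted in [taylor_rem]. *)
Lemma comp_rem_expansion N k (x : 'rV[R]_n) :
  fourier (comp_rem 0 k) x -
    expansion_sum N (fun k => fourier (s k)) (fun k => fourier (t k)) k x =
  fourier (comp_rem N k) x.
Proof.
pose term (a : {ffun 'I_n -> 'I_N}) i j : R[i] := s k j *
  (((mi_fact (fun p => a p))%:R)^-1 * fallmx R (fun p => a p) (- j) *
    kdiff (fun p => a p) (fun r => t r (i - j)) k).
pose P (a : {ffun 'I_n -> 'I_N}) := (mi_size (fun p => a p) < N)%N.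
have T a := expansion_term_fourier (fun p => nat_of_ord ((a : {ffun 'I_n -> 'I_N}) p)) k x.
have rc0 : rapid (comp_rem 0 k) by exact: (coefM_rapid hLam k (coefM_comp_rem 0)).
have sumE (r : seq {ffun 'I_n -> 'I_N}) :
   rapid (fun i => \sum_(a <- r | P a) clsum (term a i)) /\
   \sum_(a <- r | P a) expansion_term (fun k => fourier (s k)) (fun k => fourier (t k)) (fun p => a p) k x =
   fourier (fun i => \sum_(a <- r | P a) clsum (term a i)) x.
  elim: r => [|a r [ih1 ih2]].
    have -> : (fun i => \sum_(a <- [::] | P a) clsum (term a i)) = fun i => if i == 0 then 0 else 0.
      by apply/funext => i; rewrite big_nil; case: ifP.
    split; first exact: rapid_single.
    rewrite big_nil fourierE (@clsum_single _ _ _ 0) ?eqxx ?mulr0 // => i _.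
    by case: ifP; rewrite mulr0.
  case Pa: (P a).
    have [ra _ Ta] := T a.
    have -> : (fun i => \sum_(a0 <- a :: r | P a0) clsum (term a0 i)) =
      fun i => clsum (term a i) + \sum_(a0 <- r | P a0) clsum (term a0 i).
      by apply/funext => i; rewrite big_cons Pa.
    split; first exact: rapidD.
    by rewrite big_cons Pa ih2 Ta -fourierD.
  have -> : (fun i => \sum_(a0 <- a :: r | P a0) clsum (term a0 i)) =
    fun i => \sum_(a0 <- r | P a0) clsum (term a0 i).
    by apply/funext => i; rewrite big_cons Pa.
  by rewrite big_cons Pa.
have [rS eS] := sumE (index_enum _).
rewrite /expansion_sum eS -fourierB //; congr (fourier _ x); apply/funext => i.
rewrite comp_rem0E -clsum_sum; last by move=> a; have [_ da _] := T a; exact: da.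
rewrite -clsumB.
- congr clsum; apply/funext => j; rewrite /taylor_rem mulrBr mulr_sumr.
  by [].
- exact: dominated_comp0.
- by apply: dominated_sum => a; have [_ da _] := T a; exact: da.
Qed.

End Composition.

Theorem theorem4p2 (R : realType) (n : nat) (mu0 mu1 mu C0 C1 : R)
    (Lam : 'rV[int]_n -> R) (hLam : weight_function mu0 mu1 mu C0 C1 Lam)
    (rho : R) (hrho0 : 0 < rho) (hrho1 : rho <= mu^-1) (m1 m2 : R)
    (sigma tau : 'rV[int]_n -> 'rV[R]_n -> R[i])
    (hsigma : symbol_M Lam rho m1 sigma) (htau : symbol_M Lam rho m2 tau) :
  exists lambda : 'rV[int]_n -> 'rV[R]_n -> R[i],
    [/\ symbol_M Lam rho (m1 + m2) lambda,
        (forall f : 'rV[int]_n -> R[i], rapidly_decreasing f ->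
           rapidly_decreasing (pdo tau f) /\
           pdo sigma (pdo tau f) = pdo lambda f)
      & (forall N : nat,
           symbol_M Lam rho (m1 + m2 - rho * N%:R)
             (fun k x => lambda k x - expansion_sum N sigma tau k x))].
Proof.
pose s k j := coef (sigma k) j; pose t k j := coef (tau k) j.
have hs : coefM Lam rho m1 s := symbol_M_coefM hLam hrho0 hsigma.
have ht : coefM Lam rho m2 t := symbol_M_coefM hLam hrho0 htau.
have es : sigma = fun k => fourier (s k).
  apply/funext => k; apply/esym/fourier_inversion; first by case: hsigma.
  exact: (coefM_rapid hLam k hs).
have et : tau = fun k => fourier (t k).
  apply/funext => k; apply/esym/fourier_inversion; first by case: htau.
  exact: (coefM_rapid hLam k ht).
exists (fun k => fourier (comp_rem s t 0 k)); split.
- have := coefM_symbol_M hLam hrho0 (coefM_comp_rem hLam hrho0 hs ht 0).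
  by rewrite mulr0 subr0.
- move=> f /rapidP hf; rewrite es et; split.
    by apply/rapidP; exact: (pdo_rapid hLam hrho0 ht).
  exact: (pdo_comp hLam hrho0 hs ht).
- move=> N; rewrite es et.
  rewrite (_ : (fun k x => _) = fun k => fourier (comp_rem s t N k)).
    exact: (coefM_symbol_M hLam hrho0 (coefM_comp_rem hLam hrho0 hs ht N)).
  apply/funext => k; apply/funext => x.
  exact: (comp_rem_expansion hLam hrho0 hs ht).
Qed.
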